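(* Under the standing assumptions in the context, suppose that $c\in C^2(\omega_0\times\omega_1)$, that $J(y)=\frac12\|y-y_d\|_{L^2(\Omega)}^2$ with $y_d\in L^2(\Omega)$, and that $y_d\in C(\omega_1)$. Then every optimal control $\bar u$ of problem (P) is non-atomic in $\operatorname{int}(\omega_1)$, i.e., $\bar u(\{\xi\})=0$ for every $\xi\in\operatorname{int}(\omega_1)$.
   Context: For a compact set $X\subset\mathbb R^n$, $\mathfrak M(X)=C(X)^*$ denotes the finite signed Borel measures on $X$. $r'$ denotes the conjugate exponent of $r$. $C^2(\omega_0\times\omega_1)$ denotes the functions on $\omega_0\times\omega_1$ that are restrictions of $C^2$ functions defined on an open neighborhood of $\omega_0\times\omega_1$ in $\mathbb R^{d_0}\times\mathbb R^{d_1}$. (Every atom of a finite Borel measure on a compact subset of $\mathbb R^n$ can be identified with a single point of positive mass.) Standing assumptions. $d_0\in\mathbb N$, $d_1\in\{2,3\}$; $\Omega\subset\mathbb R^{d_1}$ is a bounded Lipschitz domain; $\omega_0\subset\mathbb R^{d_0}$ and $\omega_1\subset\overline\Omega$ are nonempty compact sets; $u^0\in\mathfrak M(\omega_0)$, $u^0\ge 0$; $c\in C(\omega_0\times\omega_1)$; $\alpha>0$. $p_\Omega>d_1$ is an exponent (provided by Theorem 0.5(a) of Jerison–Kenig 1995) such that for every $p\in(p_\Omega',p_\Omega)$ and every $f\in W^{-1,p}(\Omega)$ the equation $-\Delta y=f$ (weak Laplacian, $-\langle\Delta y,v\rangle=\int_\Omega\nabla y\cdot\nabla v\,d\lambda^{d_1}$)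 has a unique solution $y\in W^{1,p}_0(\Omega)$. The exponent $q$ is fixed with $q'\in(d_1,p_\Omega)$ and, if $d_1=3$, additionally $q'<6$ (so that $W^{1,q}_0(\Omega)\hookrightarrow L^2(\Omega)$). $E:W^{1,q'}_0(\Omega)\to C(\omega_1)$ is the Sobolev embedding into $C_0(\Omega)\subset C(\overline\Omega)$ followed by restriction to $\omega_1$; $\langle E^*u,v\rangle=\int_{\omega_1}v\,du$. $S:=(-\Delta)^{-1}E^*:\mathfrak M(\omega_1)\to W^{1,q}_0(\Omega)$. $\mathrm D^c_{u^0}(u):=\inf\{\int c\,d\pi:\pi\in\mathfrak M(\omega_0\times\omega_1),\ \pi\ge0,\ (P_0)_\#\pi=u^0,\ (P_1)_\#\pi=u\}$ with coordinate projections $P_0,P_1$ and $\inf\emptyset=\infty$. Problem (P): minimize $J(Su)+\alpha\,\mathrm D^c_{u^0}(u)$ over $u\in\mathfrak M(\omega_1)$; an optimal control is a (global) minimizer. *)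

(* Defs.v *)
(* R^n is 'rV[R]_n for R : realType; its library norm is the sup norm, which is
   used below only through the topology and Lipschitz continuity. *)
From HB Require Import structures.
From mathcomp Require Import all_boot all_order all_algebra.
From mathcomp Require Import all_classical all_reals all_analysis.
Set Implicit Arguments.
Unset Strict Implicit.
Unset Printing Implicit Defensive.
Import Order.TTheory GRing.Theory Num.Theory numFieldNormedType.Exports.
Local Open Scope classical_set_scope.
Local Open Scope ring_scope.

(* Borel sigma-algebra, so that [measurable], [continuous] and measures all
   live on the same type 'rV[R]_n. *)
HB.instance Definition _ (R : realType) (m n : nat) :=
  Measurable.copy 'M[R]_(m, n) (g_sigma_algebraType (@open 'M[R]_(m, n))).

Section borel_rV.
Context {R : realType}.

Lemma open_measurable_rV n (A : set 'rV[R]_n) : open A -> measurable A.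
Proof. by move=> oA; exact: sub_sigma_algebra. Qed.

Lemma measurable_fun_rV d (T : measurableType d) n (f : T -> 'rV[R]_n) :
  (forall i, measurable_fun setT (fun t => f t ord0 i)) ->
  measurable_fun setT f.
Proof.
move=> mf.
have mB (q : {ffun 'I_n -> rat}) (k : nat) :
    measurable (f @^-1` ball (\row_i ratr (q i) : 'rV[R]_n) (k.+1%:R^-1 : R)).
  rewrite (_ : _ @^-1` _ = \bigcap_(i in [set: 'I_n])
      ((fun t => f t ord0 i) @^-1` ball (ratr (q i) : R) (k.+1%:R^-1 : R))).
    apply: fin_bigcap_measurable; first exact: finite_finset.
    move=> i _; rewrite -[X in measurable X]setTI; apply: mf => //.
    by apply: measurable_realfun.open_measurable; exact: ball_open.
  apply/seteqP; split=> [t [_ tB] i _ /=|t tB /=].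
    by have := tB ord0 i; rewrite mxE.
  split; first by rewrite invr_gt0.
  by move=> i j; rewrite (ord1 i) mxE; exact: tB.
apply: (@measurability _ _ _ _ setT f (@open 'rV[R]_n)) => [//|_ [U oU <-]].
rewrite setTI.
rewrite (_ : f @^-1` U = \bigcup_(p in
    [set p : {ffun 'I_n -> rat} * nat |
      ball (\row_i ratr (p.1 i) : 'rV[R]_n) (p.2.+1%:R^-1 : R) `<=` U])
    (f @^-1` ball (\row_i ratr (p.1 i) : 'rV[R]_n) (p.2.+1%:R^-1 : R))).
  rewrite bigcup_mkcond; apply: countable_bigcupT_measurable => [|[q k]].
    exact: countableP.
  by case: ifP => // _; exact: mB.
apply/seteqP; split=> [t Ut|t [[q k] /= sU /sU//]].
have /nbhs_ballP[e /= e0 eU] : nbhs (f t) U by exact: open_nbhs_nbhs.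
have [k ke] : exists k : nat, k.+1%:R^-1 < e / 2.
  exists (Num.truncn (e / 2)^-1).
  rewrite -[ltRHS]invrK ltf_pV2 ?posrE ?invr_gt0 ?divr_gt0 ?ltr0n//.
  exact: truncnS_gt.
have k0 : 0 < k.+1%:R^-1 :> R by rewrite invr_gt0.
have qP i : exists r : rat, `|f t ord0 i - ratr r| < k.+1%:R^-1.
  have /rat_in_itvoo[r] : f t ord0 i < f t ord0 i + k.+1%:R^-1 by rewrite ltrDl.
  rewrite in_itv/= => /andP[r1 r2]; exists r.
  by rewrite distrC ger0_norm ?subr_ge0 ?(ltW r1)// ltrBlDl.
have [q qE] := choice qP.
have tq i : ball (ratr (q i) : R) (k.+1%:R^-1 : R) (f t ord0 i).
  by rewrite /ball/= distrC.
exists ([ffun i => q i], k) => /=; last first.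
  by split=> // i j; rewrite (ord1 i) mxE ffunE; exact: tq.
move=> y [_ yB]; apply: eU; split=> // i j; rewrite (ord1 i).
have := yB ord0 j; rewrite mxE ffunE => yBj.
apply: (@le_ball _ _ _ (k.+1%:R^-1 + k.+1%:R^-1)).
  by rewrite [leRHS]splitr lerD// ltW.
by apply: ball_triangle yBj; apply: ball_sym; exact: tq.
Qed.

Lemma measurable_coord n (i : 'I_n) :
  measurable_fun setT (fun v : 'rV[R]_n => v ord0 i).
Proof.
apply: (measurability _ (measurable_realfun.RGenOpens.measurableE R)) => //.
move=> _ [_ [a [b ->]] <-].
rewrite setTI; apply: open_measurable_rV.
by move/continuousP: (@coord_continuous R 1 n ord0 i); apply.
Qed.

End borel_rV.

Section lebesgue_rV.
Context {R : realType}.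

Definition cons_rV n (x : R * 'rV[R]_n) : 'rV[R]_n.+1 :=
  row_mx (x.1%:M : 'rV[R]_1) x.2.

Lemma measurable_cons_rV n : measurable_fun setT (@cons_rV n).
Proof.
apply: measurable_fun_rV => i; case: (split_ordP (i : 'I_(1 + n))) => j ->.
  apply: (eq_measurable_fun fst) => [x _|]; last exact: measurable_fst.
  transitivity ((x.1%:M : 'rV[R]_1) ord0 j); last first.
    exact/esym/(row_mxEl (x.1%:M : 'rV[R]_1) x.2).
  by rewrite (ord1 j) mxE eqxx mulr1n.
apply: (eq_measurable_fun (fun x : R * 'rV[R]_n => x.2 ord0 j)) => [x _|].
  exact/esym/(row_mxEr (x.1%:M : 'rV[R]_1) x.2).
exact: (measurableT_comp (measurable_coord j) measurable_snd).
Qed.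

Lemma measurable_uncons_rV n : measurable_fun setT
  (fun v : 'rV[R]_n.+1 => (v ord0 ord0, \row_(j < n) v ord0 (lift ord0 j))).
Proof.
apply: measurable_fun_pair; first exact: measurable_coord.
apply: measurable_fun_rV => i.
apply: (eq_measurable_fun (fun v : 'rV[R]_n.+1 => v ord0 (lift ord0 i))).
  by move=> v _; rewrite mxE.
exact: measurable_coord.
Qed.

Lemma uncons_rVK n (x : R * 'rV[R]_n) :
  (cons_rV x ord0 ord0, \row_(j < n) cons_rV x ord0 (lift ord0 j)) = x.
Proof.
case: x => a v; congr pair.
  rewrite (_ : ord0 = lshift n (ord0 : 'I_1)); last exact/val_inj.
  transitivity ((a%:M : 'rV[R]_1) ord0 ord0); last by rewrite mxE eqxx.
  exact: (row_mxEl (a%:M : 'rV[R]_1) v).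
apply/rowP => j; rewrite mxE.
rewrite (_ : lift ord0 j = rshift 1 j); last exact/val_inj.
exact: (row_mxEr (a%:M : 'rV[R]_1) v).
Qed.

Section lebesgue_cons.
Variables (n : nat) (m : {sigma_finite_measure set 'rV[R]_n -> \bar R}).

Definition lebesgue_cons : set 'rV[R]_n.+1 -> \bar R :=
  pushforward (lebesgue_measure \x m)%E (@cons_rV n).

Let lebesgue_cons0 : lebesgue_cons set0 = 0%E.
Proof. by rewrite /lebesgue_cons /pushforward preimage_set0 measure0. Qed.

Let lebesgue_cons_ge0 A : (0 <= lebesgue_cons A)%E.
Proof. by rewrite /lebesgue_cons /pushforward measure_ge0. Qed.

Let lebesgue_cons_additive : semi_sigma_additive lebesgue_cons.
Proof.
have mf := @measurable_cons_rV n.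
exact: measure_semi_sigma_additive.
Qed.

HB.instance Definition _ := isMeasure.Build _ _ _ lebesgue_cons
  lebesgue_cons0 lebesgue_cons_ge0 lebesgue_cons_additive.

Let lebesgue_cons_sigma_finite : sigma_finite setT lebesgue_cons.
Proof.
have /sigma_finiteP[F [TF ndF Foo]] := sigma_finiteT (@lebesgue_measure R).
have /sigma_finiteP[G [TG ndG Goo]] := sigma_finiteT m.
pose g (v : 'rV[R]_n.+1) := (v ord0 ord0, \row_(j < n) v ord0 (lift ord0 j)).
exists (fun k => g @^-1` (F k `*` G k)).
  rewrite -preimage_bigcup -(@preimage_setT _ _ g); congr (_ @^-1` _).
  apply/seteqP; split=> // -[x y] _.
  have [i _ Fix] : (\bigcup_i F i) x by rewrite -TF.
  have [j _ Gjy] : (\bigcup_i G i) y by rewrite -TG.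
  exists (maxn i j) => //; split=> /=.
    by move: x Fix; exact/subsetPset/ndF/leq_maxl.
  by move: y Gjy; exact/subsetPset/ndG/leq_maxr.
move=> k; have [mFk Fk] := Foo k; have [mGk Gk] := Goo k; split.
  rewrite -[X in measurable X]setTI; apply: measurable_uncons_rV => //.
  exact: measurableX.
rewrite /lebesgue_cons /pushforward (_ : _ @^-1` _ = F k `*` G k).
  by rewrite product_measure1E// lte_mul_pinfty// ge0_fin_numE.
by apply/seteqP; split=> x; rewrite /preimage /mkset /g uncons_rVK.
Qed.

HB.instance Definition _ := Measure_isSigmaFinite.Build _ _ _ lebesgue_cons
  lebesgue_cons_sigma_finite.

End lebesgue_cons.

Fixpoint lebesgue_rV n : {sigma_finite_measure set 'rV[R]_n -> \bar R} :=
  if n is n'.+1 then lebesgue_cons (lebesgue_rV n') else \d_(0 : 'rV[R]_0).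

End lebesgue_rV.

Section calculus.
Context {R : realType}.

(* All iterated directional derivatives up to order k exist and are continuous
   on U; in finite dimension this is the usual class C^k(U). *)
Fixpoint Ck (V : normedModType R) (U : set V) (k : nat) (f : V -> R) : Prop :=
  (forall x, U x -> {for x, continuous f}) /\
  if k is k'.+1 then
    forall v, (forall x, U x -> derivable f x v) /\ Ck U k' ('D_v f)
  else True.

Definition Ck_on_compact (V : normedModType R) (K : set V) (k : nat)
    (f : V -> R) : Prop :=
  exists (U : set V) (g : V -> R),
    [/\ open U, K `<=` U, Ck U k g & {in K, f =1 g}].

Definition partial d (i : 'I_d) (f : 'rV[R]_d -> R) : 'rV[R]_d -> R :=
  'D_(delta_mx ord0 i) f.

Definition test_function d (Om : set 'rV[R]_d) (phi : 'rV[R]_d -> R) : Prop :=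
  (forall k, Ck setT k phi) /\
  exists K, [/\ compact K, K `<=` Om & forall x, ~ K x -> phi x = 0].

(* Near each boundary point, in suitable orthonormal coordinates z = x A, the
   set is the strict supergraph z_j > g(z') of a Lipschitz function g of the
   remaining coordinates z'. *)
Definition lipschitz_domain d (Om : set 'rV[R]_d) : Prop :=
  [/\ open Om, connected Om, Om !=set0 &
    forall x0, closure Om x0 -> ~ Om x0 ->
    exists (A : 'M[R]_d) (j : 'I_d) (g : 'rV[R]_d.-1 -> R) (L r : R),
      [/\ A *m A^T = 1%:M, forall s t, `|g s - g t| <= L * `|s - t|, 0 < r &
        forall x, ball x0 r x ->
          (Om x <-> g (col' j (x *m A)) < (x *m A) ord0 j)]].

End calculus.

Section sobolev.
Context {R : realType} {d : nat}.
Implicit Types (Om : set 'rV[R]_d) (v phi : 'rV[R]_d -> R) (p : R).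

Local Notation leb := (@lebesgue_rV R d).

Definition conjexp p : R := fine (hoelder_conjugate p%:E).

(* Functions on Om are represented by total functions; their values outside Om
   are irrelevant ([v \_ Om] is v extended by 0 from Om). *)
Definition Lp_norm Om p v : \bar R := 'N[leb]_(p%:E) [EFin \o (v \_ Om)].

Definition in_Lp Om p v : Prop := v \_ Om \in Lfun leb p%:E.

Definition loc_integrable Om v : Prop := measurable_fun Om v /\
  forall K, compact K -> K `<=` Om -> leb.-integrable K (EFin \o v).

Definition is_weak_partial Om (i : 'I_d) v g : Prop :=
  [/\ loc_integrable Om v, loc_integrable Om g &
    forall phi, test_function Om phi ->
      \int[leb]_(x in Om) (v x * partial i phi x) =
      - \int[leb]_(x in Om) (g x * phi x)].

(* Unique up to null sets when it exists, whence the choice of a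
   representative. *)
Definition weak_partial Om (i : 'I_d) v : 'rV[R]_d -> R :=
  xget (cst 0) [set g | is_weak_partial Om i v g].

Definition in_W1p Om p v : Prop := in_Lp Om p v /\
  forall i, exists2 g, is_weak_partial Om i v g & in_Lp Om p g.

(* Equivalent to the p-power-sum norm; used only through the topology it
   induces. *)
Definition W1p_norm Om p v : \bar R :=
  (Lp_norm Om p v + \sum_(i < d) Lp_norm Om p (weak_partial Om i v))%E.

Definition in_W1p0 Om p v : Prop := in_W1p Om p v /\
  forall e : R, 0 < e -> exists2 phi, test_function Om phi &
    (W1p_norm Om p (v \- phi)%R < e%:E)%E.

(* F is an element of W^{-1,p}(Om), the dual of W_0^{1,p'}(Om); only the values
   of F on W_0^{1,p'}(Om) matter, and boundedness makes F constant on classes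
   modulo null sets. *)
Definition in_Wm1p Om p (F : ('rV[R]_d -> R) -> R) : Prop :=
  (forall (a : R) v w, in_W1p0 Om (conjexp p) v -> in_W1p0 Om (conjexp p) w ->
    F (fun x => a * v x + w x) = a * F v + F w) /\
  exists C : R, forall v, in_W1p0 Om (conjexp p) v ->
    (`|F v|%:E <= C%:E * W1p_norm Om (conjexp p) v)%E.

Definition grad_pairing Om y v : R :=
  \int[leb]_(x in Om)
    (\sum_(i < d) weak_partial Om i y x * weak_partial Om i v x).

(* y is a solution of -Laplace y = F in W_0^{1,p}(Om). *)
Definition poisson_solution Om p (F : ('rV[R]_d -> R) -> R) y : Prop :=
  in_W1p0 Om p y /\
  forall v, in_W1p0 Om (conjexp p) v -> grad_pairing Om y v = F v.

Definition poisson_exponent Om (pOm : R) : Prop :=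
  forall p, conjexp pOm < p < pOm -> forall F, in_Wm1p Om p F ->
    (exists y, poisson_solution Om p F y) /\
    forall y1 y2, poisson_solution Om p F y1 -> poisson_solution Om p F y2 ->
      {ae leb, forall x, Om x -> y1 x = y2 x}.

(* C_0(Om), as a subspace of C(closure Om). *)
Definition in_C0 Om v : Prop :=
  {within closure Om, continuous v} /\
  forall x, closure Om x -> ~ Om x -> v x = 0.

(* The representative of v in C_0(Om), i.e. the image of v under the Sobolev
   embedding into C_0(Om). *)
Definition C0_embedding Om v : 'rV[R]_d -> R :=
  xget (cst 0)
    [set w | in_C0 Om w /\ {ae leb, forall x, Om x -> w x = v x}].

End sobolev.

Section measures.
Context {R : realType}.

(* Measures on a compact X are the Borel measures on the ambient space that
   vanish on the sets disjoint from X. *)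
Definition carried_by d (T : measurableType d) (X : set T)
    (u : set T -> \bar R) : Prop :=
  forall A, measurable A -> A `&` X = set0 -> u A = 0%E.

Section charge_integral.
Context d (T : measurableType d) (u : {charge set T -> \bar R}).

Let P := projT1 (cid (Hahn_decomposition u)).
Let N := projT1 (cid (projT2 (cid (Hahn_decomposition u)))).
Let uPN : hahn_decomposition u P N :=
  projT2 (cid (projT2 (cid (Hahn_decomposition u)))).

Definition charge_integral (D : set T) (f : T -> R) : R :=
  \int[jordan_pos uPN]_(x in D) f x - \int[jordan_neg uPN]_(x in D) f x.

End charge_integral.

Definition is_coupling d0 d1 (om0 : set 'rV[R]_d0) (om1 : set 'rV[R]_d1)
    (u0 : set 'rV[R]_d0 -> \bar R) (u : set 'rV[R]_d1 -> \bar R)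
    (pi : {finite_measure set ('rV[R]_d0 * 'rV[R]_d1)%type -> \bar R}) : Prop :=
  [/\ carried_by (om0 `*` om1) pi,
    forall A, measurable A -> pushforward pi fst A = u0 A &
    forall A, measurable A -> pushforward pi snd A = u A].

(* The product sigma-algebra on which couplings are defined is the Borel one,
   both spaces being second countable; ereal_inf set0 = +oo. *)
Definition transport_cost d0 d1 (om0 : set 'rV[R]_d0) (om1 : set 'rV[R]_d1)
    (c : 'rV[R]_d0 * 'rV[R]_d1 -> R)
    (u0 : set 'rV[R]_d0 -> \bar R) (u : set 'rV[R]_d1 -> \bar R) : \bar R :=
  ereal_inf [set (\int[pi]_(z in om0 `*` om1) (c z)%:E)%E |
    pi in is_coupling om0 om1 u0 u].

End measures.

Section control.
Context {R : realType} {d : nat}.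
Variables (Om om1 : set 'rV[R]_d) (q : R).
Implicit Types (u : {charge set 'rV[R]_d -> \bar R}).

Definition adjoint_embedding u (v : 'rV[R]_d -> R) : R :=
  charge_integral u om1 (C0_embedding Om v).

Definition control_to_state u : 'rV[R]_d -> R :=
  xget (cst 0) [set y | poisson_solution Om q (adjoint_embedding u) y].

Definition tracking (yd y : 'rV[R]_d -> R) : \bar R :=
  (2^-1%:E * Lp_norm Om 2%R (y \- yd)%R ^+ 2)%E.

Definition objective d0 (om0 : set 'rV[R]_d0)
    (c : 'rV[R]_d0 * 'rV[R]_d -> R) (u0 : set 'rV[R]_d0 -> \bar R) (alpha : R)
    (J : ('rV[R]_d -> R) -> \bar R) u : \bar R :=
  (J (control_to_state u) + alpha%:E * transport_cost om0 om1 c u0 u)%E.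

Definition optimal_control d0 (om0 : set 'rV[R]_d0)
    (c : 'rV[R]_d0 * 'rV[R]_d -> R) (u0 : set 'rV[R]_d0 -> \bar R) (alpha : R)
    (J : ('rV[R]_d -> R) -> \bar R) (ubar : {charge set 'rV[R]_d -> \bar R})
    : Prop :=
  carried_by om1 ubar /\
  forall u, carried_by om1 u ->
    (objective om0 c u0 alpha J ubar <= objective om0 c u0 alpha J u)%E.

End control.

(* Main.v *)
(* Let eta be a smooth bump. The truncated fundamental solution w_s of scale 1/s
   around xi, with - Laplace w_s = m delta_xi - eta_s (eta_s the L^1 dilate of eta,
   m its mass), is a sum over j of dilates of a single smooth bump b. It lies in
   W_0^{1,q} and, as d <= 3, in L^2.

   Let u be optimal with an atom of mass mu at xi. Moving a fraction t of the atom
   to eta_s changes the state by a negative multiple of t w_s and, c being C^2, the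
   transport cost by O(t s^-2). Letting t tend to 0 bounds the integral of (y - yd) w_s by
   K s^-2, with K independent of s. The first term of the sum defining w_s is s^-2 b_s
   for an L^1 dilate b_s of b, so the integral of y b_s would be bounded in s.
   But b_{2s} - b_s is in turn - Laplace of a dilate of a bump beta, so testing
   the state equation with it shows that the integral of y b_s grows by at least
   mu beta(0) each time s is doubled: a contradiction.

   u is nonnegative because its objective is finite: the control spreading all the
   mass of u0 over eta_s has its state in L^2. The Sobolev embedding into C_0 comes
   from the same decomposition of delta_xi. *)
Require Import Defs.
From HB Require Import structures.
From mathcomp Require Import all_boot all_order all_algebra.
From mathcomp Require Import all_classical all_reals all_analysis.
From mathcomp Require Import measurable_realfun ring lra.
Import Order.TTheory GRing.Theory Num.Theory numFieldNormedType.Exports.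
Local Open Scope classical_set_scope.
Local Open Scope ring_scope.
Set Implicit Arguments.
Unset Strict Implicit.
Unset Printing Implicit Defensive.

(** * Affine changes of variables *)

Section affine_invariance.
Context {R : realType}.

(** Everything is compared at order [s^-2]. The kernel is radial, so no first-order term of [c]
    survives when the atom is spread: the change of cost is the integral of the Laplacian of [c] in
    the second variable against [w_s], whose mass is of order [s^-2]. The first term of [w_s]
    carries the same factor, so after division the optimality inequality is free of scale and any
    growth in [s] contradicts it.

    The obstacle is that near the atom the state is known only as an element of [W_0^{1,q}]. It is
    therefore never evaluated, but integrated against smooth dilates. The terms of [w_s] after the
    first are dropped by their sign: once the integral of [y b_s] exceeds the bound available for
    that of [y_d b_s], the growth keeps it above at every finer dyadic scale, so that all remaining
    terms are nonnegative.

    On the transport side, attainment of the infimum is bypassed: every coupling is modified in the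
    fibre over the atom, with the same bound on the increase of its cost. *)

Lemma ge0_integral_lebesgue_affine (s v : R) (f : R -> \bar R) : 0 < s ->
  measurable_fun setT f -> (forall x, (0 <= f x)%E) ->
  (s%:E * \int[lebesgue_measure]_x f (s * x + v)%R =
   \int[lebesgue_measure]_x f x)%E.
Proof.
move=> s0 mf f0.
pose T : measurableTypeR R -> measurableTypeR R := fun x : R => (s * x + v)%R.
have mT : measurable_fun setT T.
  by apply: measurable_funD => //; exact: measurable_funM.
pose pm : {measure set (measurableTypeR R) -> \bar R} :=
  pushforward (@lebesgue_measure R) T.
pose mu : {measure set (measurableTypeR R) -> \bar R} :=
  mscale (NngNum (ltW s0)) (pm mT).
(* Half-open intervals determine Lebesgue measure, so the rescaled image measure [mu] is Lebesgue
   measure. *)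
have muE X : ocitv X -> lebesgue_measure X = mu X.
  move=> [[a b] /= _ <-].
  rewrite /mu /mscale/= /pushforward/=.
  rewrite (_ : T @^-1` _ = [set` `](a - v) / s, (b - v) / s]]); last first.
    apply/seteqP; split => x /=; rewrite !in_itv/= /T;
    by rewrite ltr_pdivrMr// ler_pdivlMr// ltrBlDr lerBrDr mulrC.
  rewrite !lebesgue_measure_itv/= !lte_fin.
  rewrite ltr_pM2r ?invr_gt0// ltrD2r.
  case: ifPn => _; last by rewrite mule0.
  by rewrite -!EFinD -EFinM; congr EFin; field; rewrite gt_eqF.
transitivity (\int[mu]_x f x)%E; last first.
  by apply/esym/eq_measure_integral => A mA _; exact: lebesgue_measure_unique.
rewrite ge0_integral_mscale//=.
congr (_ * _)%E; rewrite ge0_integral_pushforward//.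
Qed.

Local Notation leb := (@lebesgue_rV R).

Lemma measurable_affine_rV n (s : R) (v : 'rV[R]_n) :
  measurable_fun setT (fun x : 'rV[R]_n => s *: x + v).
Proof.
apply: measurable_fun_rV => i.
rewrite (_ : (fun _ => _) = fun t : 'rV[R]_n => s * t ord0 i + v ord0 i).
  apply: measurable_funD => //; apply: measurable_funM => //.
  exact: measurable_coord.
by apply/funext => t; rewrite !mxE.
Qed.

Lemma cons_rV0 n (x : R * 'rV[R]_n) : cons_rV x ord0 ord0 = x.1.
Proof. by rewrite -[in RHS](uncons_rVK x). Qed.

Lemma cons_rVS n (x : R * 'rV[R]_n) (j : 'I_n) :
  cons_rV x ord0 (lift ord0 j) = x.2 ord0 j.
Proof. by rewrite -[in RHS](uncons_rVK x) [RHS]mxE. Qed.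

Lemma affine_cons_rV n (s : R) (v : 'rV[R]_n.+1) (x : R * 'rV[R]_n) :
  s *: cons_rV x + v =
  cons_rV (s * x.1 + v ord0 ord0, s *: x.2 + \row_j v ord0 (lift ord0 j)).
Proof.
apply/rowP => i; rewrite [LHS]mxE [X in X + _]mxE; have [j ->|->] := unliftP ord0 i.
  by rewrite !cons_rVS !mxE.
by rewrite !cons_rV0.
Qed.

(** Induction on the dimension by sections: the head coordinate is changed on the line, and each
    section is covered by the induction hypothesis with the translated tail of [v]. *)
Lemma lebesgue_rV_affine n (s : R) (v : 'rV[R]_n) (A : set 'rV[R]_n) :
  0 < s -> measurable A ->
  ((s ^+ n)%:E * leb n ((fun x => (s *: x + v)%R) @^-1` A) = leb n A)%E.
Proof.
move=> s0; elim: n v A => [v A mA|n IH v A mA].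
  rewrite expr0 mul1e; congr (leb 0 _); apply/seteqP; split => x/=;
    by rewrite (_ : _ + _ = x)//; apply/rowP; case.
rewrite /= /lebesgue_cons /pushforward/=.
have mT := @measurable_affine_rV n.+1 s v.
have mC := @measurable_cons_rV R n.
have mA' : measurable (@cons_rV R n @^-1` A).
  by rewrite -[X in measurable X]setTI; apply: mC.
rewrite [in RHS]/product_measure1.
rewrite -[RHS](@ge0_integral_lebesgue_affine s (v ord0 ord0))//; last first.
  exact: measurable_fun_xsection.
rewrite exprS EFinM -muleA; congr (_ * _)%E.
have mTA : measurable ((fun x => s *: x + v)%R @^-1` A).
  by rewrite -[X in measurable X]setTI; apply: mT.
rewrite /product_measure1 -ge0_integralZl//; first last.
- by rewrite lee_fin exprn_ge0// ltW.
- apply: measurable_fun_xsection.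
  by rewrite -[X in measurable X]setTI; apply: mC.
apply: eq_integral => a _ /=.
rewrite -[RHS](IH (\row_j v ord0 (lift ord0 j))); last first.
  by apply: measurable_xsection; exact: mA'.
congr (_ * leb n _)%E; apply/seteqP; split => x/=;
  by rewrite /xsection/= !inE/= affine_cons_rV.
Qed.

Lemma ge0_integral_affine n (s : R) (v : 'rV[R]_n) (f : 'rV[R]_n -> \bar R) :
  0 < s -> measurable_fun setT f -> (forall x, (0 <= f x)%E) ->
  ((s ^+ n)%:E * \int[leb n]_x f (s *: x + v)%R = \int[leb n]_x f x)%E.
Proof.
move=> s0 mf f0.
pose T := fun x : 'rV[R]_n => s *: x + v.
have mT : measurable_fun setT T by exact: measurable_affine_rV.
pose pm : {measure set 'rV[R]_n -> \bar R} := pushforward (leb n) T.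
have s0' : 0 <= s ^+ n by rewrite exprn_ge0// ltW.
pose mu : {measure set 'rV[R]_n -> \bar R} := mscale (NngNum s0') (pm mT).
transitivity (\int[mu]_x f x)%E; last first.
  apply: eq_measure_integral => A mA _; rewrite /mu /mscale/=.
  exact: lebesgue_rV_affine.
rewrite ge0_integral_mscale//=; congr (_ * _)%E.
by rewrite ge0_integral_pushforward.
Qed.

Lemma integrable_affine n (s : R) (v : 'rV[R]_n) (f : 'rV[R]_n -> R) :
  0 < s -> (leb n).-integrable setT (EFin \o f) ->
  (leb n).-integrable setT (EFin \o (fun x => f (s *: x + v))).
Proof.
move=> s0 /integrableP[mf foo]; apply/integrableP; split.
  exact: (measurableT_comp mf (measurable_affine_rV s v)).
have := @ge0_integral_affine n s v (abse \o (EFin \o f)) s0.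
have mg : measurable_fun setT (abse \o (EFin \o f)) by exact: measurableT_comp.
move=> /(_ mg (fun=> abse_ge0 _)) H.
rewrite -H in foo; apply: contraPlt foo; rewrite leye_eq => /eqP /= ->.
by rewrite gt0_muley ?ltxx// lte_fin exprn_gt0.
Qed.

Lemma Rintegral_affine n (s : R) (v : 'rV[R]_n) (f : 'rV[R]_n -> R) :
  0 < s -> measurable_fun setT f ->
  s ^+ n * \int[leb n]_x f (s *: x + v) = \int[leb n]_x f x.
Proof.
move=> s0 mf.
have mf' : measurable_fun setT (EFin \o f) by exact/measurable_EFinP.
rewrite /Rintegral [in RHS]integralE [in LHS]integralE.
have E1 := @ge0_integral_affine n s v _ s0 (measurable_funepos mf') (fun x => funepos_ge0 _ x).
have E2 := @ge0_integral_affine n s v _ s0 (measurable_funeneg mf') (fun x => funeneg_ge0 _ x).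
rewrite -{}E1 -{}E2.
have sn0 : 0 < s ^+ n by rewrite exprn_gt0.
set p := (X in fine (X - _)); set q := (X in fine (_ - X)).
set p' := (X in (_ * X - _)%E); set q' := (X in (_ - _ * X)%E).
have -> : p' = p by apply: eq_integral => x _; rewrite !funeposE.
have -> : q' = q by apply: eq_integral => x _; rewrite !funenegE.
have p0 : (0 <= p)%E by apply: integral_ge0.
have q0 : (0 <= q)%E by apply: integral_ge0.
(* Integrability is not assumed: if one of the two parts is infinite, both sides are 0, the value of
   [fine] at an infinite number. *)
move: p0 q0; clearbody p q; move: p q => [p| |] [q| |]//= _ _;
  rewrite ?gt0_muley ?lte_fin//= ?mulr0//.
by rewrite mulrBr.
Qed.

(** Balls of the sup norm are cubes of side [2 r], hence products of intervals. *)
Lemma lebesgue_rV_ball n (x : 'rV[R]_n) (r : R) : 0 < r ->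
  leb n (ball x r) = ((r *+ 2) ^+ n)%:E.
Proof.
move=> r0; elim: n x => [x|n IH x].
  rewrite expr0 /= diracE mem_set//.
  by split => // i [].
rewrite /= /lebesgue_cons /pushforward/=.
pose x' := \row_j x ord0 (lift ord0 j).
rewrite (_ : _ @^-1` _ = ball (x ord0 ord0) r `*` ball x' r).
  rewrite product_measure1E//.
  - have := IH x'; rewrite /= => ->.
    have := @lebesgue_measure_ball R (x ord0 ord0) r (ltW r0).
    by rewrite /= => ->; rewrite -EFinM exprS.
  - exact: measurable_ball.
  - by apply: open_measurable_rV; exact: ball_open.
apply/seteqP; split => [[a w] [_ /= H]|[a w] /= [H1 [_ H2]]]; split => //=.
- by have := H ord0 ord0; rewrite cons_rV0.
- split => // i j; rewrite (ord1 i) mxE.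
  by have := H ord0 (lift ord0 j); rewrite cons_rVS.
- move=> i j; rewrite (ord1 i).
  have [k ->|->] := unliftP ord0 j; last by rewrite cons_rV0.
  by rewrite cons_rVS; have := H2 ord0 k; rewrite mxE.
Qed.

End affine_invariance.

(** * Smooth profiles on the line *)

Section derivative_sequences.
Context {R : realType}.
Implicit Types F : nat -> R -> R.

(** A smooth profile is carried together with all its derivatives, so that composition, averaging
    and radial extension can be treated at all orders at once. *)
Definition derseq F := forall n x, is_derive x (1 : R) (F n) (F n.+1 x).

Lemma is_derive_continuous (f : R -> R) x df :
  is_derive x (1 : R) f df -> {for x, continuous f}.
Proof. by move=> [+ _] => /derivable1_diffP/differentiable_continuous. Qed.

Lemma derseq_continuous F n : derseq F -> continuous (F n).
Proof. by move=> dF x; exact: is_derive_continuous (dF n x). Qed.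

Lemma continuous_bounded_segment (f : R -> R) (A : R) : continuous f ->
  exists2 M, 0 <= M & forall x, `|x| <= A -> `|f x| <= M.
Proof.
move=> cf; have cA : compact (f @` `[- A, A]).
  by apply: continuous_compact; [exact: continuous_subspaceT|exact: segment_compact].
have [M [_ Mf]] := compact_bounded cA.
exists (`|M| + 1) => [|x xA]; first by rewrite addr_ge0.
apply: (Mf (`|M| + 1)); first by rewrite ltr_pwDr// ler_norm.
by exists x => //=; rewrite in_itv/= -ler_norml.
Qed.

Lemma is_derive_quad0 (f : R -> R) (C : R) :
  (forall h, `|f h| <= C * h ^+ 2) -> is_derive (0 : R) (1 : R) f 0.
Proof.
move=> fC.
have f0 : f 0 = 0.
  by apply/eqP; rewrite -normr_le0; have := fC 0; rewrite expr0n/= mulr0.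
have C0 : 0 <= C by have := fC 1; rewrite expr1n mulr1; exact: le_trans.
have H : h^-1 *: (f (h *: (1 : R) + 0) - f 0) @[h --> 0^'] --> (0 : R).
  apply/cvgr0Pnorm_lt => e e0; near=> h.
  have h0 : h != 0 by near: h; exact: nbhs_dnbhs_neq.
  rewrite f0 addr0 subr0 [_ *: 1]mulr1 normrZ normfV ltr_pdivrMl ?normr_gt0//.
  rewrite (le_lt_trans (fC h))// -[X in C * X]real_normK ?num_real//.
  rewrite expr2 mulrA mulrC ltr_pM2l ?normr_gt0//.
  rewrite (@le_lt_trans _ _ ((C + 1) * `|h|))//.
    by rewrite ler_wpM2r// lerDl.
  rewrite -ltr_pdivlMl ?ltr_wpDl//.
  near: h; apply/nbhs_dnbhs.
  have : 0 < (C + 1)^-1 * e by rewrite mulr_gt0// invr_gt0 ltr_wpDl.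
  by move=> /(@nbhs0_lt R R).
apply: DeriveDef; last exact/cvg_lim.
by apply/cvg_ex; exists 0.
Unshelve. all: end_near. Qed.

(** From [u^i <= i! exp u]. With [u = 1/t] it bounds a polynomial in [1/t] times [exp(-1/t)], which
    is what differentiability of [flat] at 0 requires. *)
Lemma horner_expR_bound (p : {poly R}) :
  exists2 C, 0 <= C & forall u, 0 <= u -> `|p.[u]| <= C * expR u.
Proof.
have powexp (i : nat) (u : R) : 0 <= u -> u ^+ i <= i`!%:R * expR u.
  move=> u0; case: i => [|i].
    by rewrite expr0 fact0 mul1r (le_trans _ (expR_ge1Dx _))// lerDl.
  rewrite mulrC -ler_pdivrMr ?ltr0n ?fact_gt0//.
  by apply: le_trans (expR_ge1Dxn i u0); rewrite lerDr.
exists (\sum_(i < size p) `|p`_i| * i`!%:R).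
  by rewrite sumr_ge0// => i _; rewrite mulr_ge0.
move=> u u0; rewrite horner_coef (le_trans (ler_norm_sum _ _ _))//.
rewrite mulr_suml ler_sum// => i _.
by rewrite normrM normrX (ger0_norm u0) -mulrA ler_wpM2l// powexp.
Qed.

(** The derivative of [P(1/t) exp(-1/t)] is [(P - P')(1/t) t^-2 exp(-1/t)]. *)
Fixpoint flat_poly n : {poly R} :=
  if n is n'.+1 then (flat_poly n' - (flat_poly n')^`()) * 'X^2 else 1.

(* The [n]-th derivative of [exp(-1/t)], extended by 0 to [t <= 0]. *)
Definition flat n (t : R) : R :=
  if 0 < t then (flat_poly n).[t^-1] * expR (- t^-1) else 0.

Lemma derseq_flat : derseq flat.
Proof.
move=> n x; have [x0|x0|x0] := ltgtP 0 x.
- have H : is_derive x (1 : R)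
      (fun t : R => (flat_poly n).[t^-1] * expR (- t^-1)) (flat n.+1 x).
    have x_n0 : x != 0 by rewrite gt_eqF.
    have dV : is_derive x (1 : R) (fun t : R => t^-1) (- x ^- 2).
      have := @is_deriveV R id x 1 1 x_n0 (is_derive_id x 1).
      by rewrite [_ *: _]mulr1.
    have dP : is_derive x (1 : R) (horner (flat_poly n) \o (fun t : R => t^-1))
        ((flat_poly n)^`().[x^-1] * - x ^- 2).
      exact: is_derive1_comp.
    have dE : is_derive x (1 : R) (expR \o (fun t : R => - t^-1))
        (expR (- x^-1) * x ^- 2).
      apply: is_derive1_comp.
      have := @is_deriveN _ _ _ (fun t : R => t^-1) x 1 (- x ^- 2) dV.
      by rewrite opprK.
    apply: (is_derive_eq (@is_deriveM _ _ _ _ _ _ _ _ dP dE)).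
    rewrite /flat x0 /= hornerM hornerXn hornerD hornerN /= /GRing.scale/=.
    by rewrite exprVn; ring.
  apply: near_eq_is_derive H; near=> t.
  have t0 : 0 < t by near: t; exact: (cvgr_gt x (@cvg_id _ _)).
  by rewrite /flat t0.
- rewrite [flat n.+1 x]/flat ltNge (ltW x0)/=.
  apply: (@near_eq_is_derive _ _ _ (cst 0)).
  near=> t; have t0 : t < 0 by near: t; exact: (cvgr_lt x (@cvg_id _ _)).
  by rewrite /flat ltNge (ltW t0).
- rewrite -x0 [flat n.+1 0]/flat ltxx.
  (* The extra factor ['X^2] turns the bound into [|flat n h| <= C h^2], so the derivative at 0 is
     0. *)
  have [C C0 HC] := horner_expR_bound (flat_poly n * 'X^2).
  apply: (@is_derive_quad0 _ C) => h; rewrite /flat.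
  have [h0|h0] := ltP 0 h; last by rewrite normr0 mulr_ge0// sqr_ge0.
  have := HC h^-1; rewrite invr_ge0 (ltW h0) => /(_ isT).
  rewrite hornerM hornerXn normrM (@ger0_norm _ (_ ^+ 2)) ?sqr_ge0//.
  rewrite exprVn ler_pdivrMr ?exprn_gt0// => HC'.
  rewrite normrM (ger0_norm (expR_ge0 _)) expRN ler_pdivrMr ?expR_gt0//.
  by rewrite mulrAC.
Unshelve. all: end_near. Qed.

Lemma flat_le0 n t : t <= 0 -> flat n t = 0.
Proof. by rewrite /flat leNgt => /negbTE ->. Qed.

Lemma flat0_gt0 t : 0 < t -> 0 < flat 0 t.
Proof. by rewrite /flat => ->/=; rewrite hornerC mul1r expR_gt0. Qed.

Lemma flat0_ge0 t : 0 <= flat 0 t.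
Proof. by have [/flat0_gt0/ltW//|/flat_le0->] := ltP 0 t. Qed.

Lemma flat0_le1 t : flat 0 t <= 1.
Proof.
rewrite /flat; case: ifPn => // t0.
by rewrite /= hornerC mul1r -expR0 ler_expR oppr_le0 invr_ge0 ltW.
Qed.

Lemma flat1_gt0 t : 0 < t -> 0 < flat 1 t.
Proof.
move=> t0; rewrite /flat t0/= derivC subr0 mul1r hornerXn.
by rewrite mulr_gt0 ?expR_gt0// exprn_gt0// invr_gt0.
Qed.

Lemma flat1_ge0 t : 0 <= flat 1 t.
Proof. by have [/flat1_gt0/ltW//|/flat_le0->] := ltP 0 t. Qed.

(** For [t > 0] the second derivative is [(1 - 2 t) t^-4 exp(-1/t)], which changes sign at 1/2. *)
Lemma flat2_gt0 t : 0 < t < 2^-1 -> 0 < flat 2 t.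
Proof.
move=> /andP[t0 t2]; rewrite /flat t0.
rewrite mulr_gt0 ?expR_gt0//= derivC subr0 mul1r derivXn.
rewrite hornerM hornerXn mulr_gt0 ?exprn_gt0 ?invr_gt0//.
rewrite hornerD hornerN hornerXn hornerMn hornerXn expr1 subr_gt0 expr2 -mulr_natl.
rewrite ltr_pM2r ?invr_gt0//.
by rewrite -[ltLHS]invrK ltf_pV2 ?posrE ?invr_gt0.
Qed.

Lemma flat2_ge0 t : t <= 2^-1 -> 0 <= flat 2 t.
Proof.
move=> t2; rewrite /flat; case: ifPn => // t0.
rewrite mulr_ge0 ?expR_ge0//= derivC subr0 mul1r derivXn.
rewrite hornerM hornerXn mulr_ge0 ?sqr_ge0 ?exprn_even_ge0//.
rewrite hornerD hornerN hornerXn hornerMn hornerXn expr1 subr_ge0 expr2 -mulr_natl.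
rewrite ler_pM2r ?invr_gt0//.
by rewrite -[leLHS]invrK lef_pV2 ?posrE ?invr_gt0.
Qed.

Lemma derseq_shiftN F (a : R) : derseq F ->
  derseq (fun n t => (-1) ^+ n * F n (a - t)).
Proof.
move=> dF n x.
have H : is_derive x (1 : R) (F n \o (fun t : R => a - t)) (F n.+1 (a - x) * -1).
  apply: is_derive1_comp; first exact: dF.
  have := @is_deriveB _ _ _ (cst a) id x 1 0 1 (is_derive_cst _ _ _) (is_derive_id x 1).
  by rewrite sub0r.
apply: (is_derive_eq (@is_deriveZ _ _ _ _ ((-1) ^+ n) _ _ _ H)).
by rewrite exprS mulN1r mulrN1 scalerN -mulNr.
Qed.

Lemma derseqS F : derseq F -> derseq (fun n => F n.+1).
Proof. by move=> dF n x; exact: dF. Qed.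

Lemma derseqZ (k : R) F : derseq F -> derseq (fun n t => k * F n t).
Proof. by move=> dF n x; exact: (@is_deriveZ _ _ _ _ k _ _ _ (dF n x)). Qed.

(* The [n]-th derivative of [t |-> \int_1^2 s^(a-b) F_0(s^2 t) ds]. *)
Definition avg (a b : nat) F n (t : R) : R :=
  \int[lebesgue_measure]_(s in `[1%R, 2%R])
    (s ^+ (a + n.*2) * s^-1 ^+ b * F n (s ^+ 2 * t)).

Let wt_continuous (a b : nat) (s : R) : s != 0 ->
  {for s, continuous (fun s : R => s ^+ a * s^-1 ^+ b)}.
Proof.
move=> s0; apply: continuousM; first exact: exprn_continuous.
by apply: (@continuous_comp _ _ _ (fun x : R => x^-1) (fun x => x ^+ b)); [exact: inv_continuous|exact: exprn_continuous].
Qed.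

Lemma avg_continuous a b (f : R -> R) (t : R) : continuous f ->
  {within `[1%R, 2%R], continuous (fun s : R => s ^+ a * s^-1 ^+ b * f (s ^+ 2 * t))}.
Proof.
move=> cf; apply: continuous_in_subspaceT => s; rewrite inE/= in_itv/= => /andP[s1 _].
have s0 : s != 0 by rewrite gt_eqF// (lt_le_trans _ s1).
apply: cvgM; first exact: wt_continuous.
apply: (@continuous_comp _ _ _ (fun s : R => s ^+ 2 * t) f); last exact: cf.
apply: continuousM; [exact: exprn_continuous|exact: cst_continuous].
Qed.

Lemma avg_integrable a b (f : R -> R) (t : R) : continuous f ->
  lebesgue_measure.-integrable `[1%R, 2%R]
    (EFin \o (fun s : R => s ^+ a * s^-1 ^+ b * f (s ^+ 2 * t))).
Proof.
move=> cf; apply: continuous_compact_integrable; first exact: segment_compact.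
exact: avg_continuous.
Qed.

Lemma derseq_avg a b F : derseq F -> derseq (avg a b F).
Proof.
move=> dF n x.
pose f (t s : R) := s ^+ (a + n.*2) * s^-1 ^+ b * F n (s ^+ 2 * t).
have df t s : is_derive t (1 : R) (f ^~ s)
    (s ^+ (a + n.+1.*2) * s^-1 ^+ b * F n.+1 (s ^+ 2 * t)).
  have H : is_derive t (1 : R) (F n \o (fun t : R => s ^+ 2 * t))
      (F n.+1 (s ^+ 2 * t) * s ^+ 2).
    apply: is_derive1_comp; first exact: dF.
    by have := @is_deriveZ _ _ _ id (s ^+ 2) t 1 1 (is_derive_id t 1); rewrite [_ *: _]mulr1.
  apply: (is_derive_eq (@is_deriveZ _ _ _ _ (s ^+ (a + n.*2) * s^-1 ^+ b) _ _ _ H)).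
  by rewrite doubleS !addnS !exprS /GRing.scale/=; ring.
have pf t s : partial1of2 f t s =
    s ^+ (a + n.+1.*2) * s^-1 ^+ b * F n.+1 (s ^+ 2 * t).
  by rewrite partial1of2E; apply: (@derive_val _ _ _ _ _ _ _ (df t s)).
have [M M0 HM] := continuous_bounded_segment (4 * (`|x| + 1)) (derseq_continuous (n := n.+1) dF).
have xI : `]x - 1, x + 1[%classic x by rewrite /= in_itv/= ltrBlDr !ltrDl ltr01.
have intf (t : R) : `]x - 1, x + 1[%classic t ->
    lebesgue_measure.-integrable `[1%R, 2%R] (EFin \o f t).
  by move=> _; apply: avg_integrable; exact: derseq_continuous.
have derf (t s : R) : `]x - 1, x + 1[%classic t -> `[1%R, 2%R]%classic s ->
    derivable (f ^~ s) t 1 by move=> _ _; exact: (ex_derive (is_derive := df t s)).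
(* On [[1, 2]] the power of [s] is at most that of 2 and [s^-b <= 1]; for [|t - x| <= 1] the
   argument [s^2 t] stays in [[-4(|x| + 1), 4(|x| + 1)]], where [M] bounds the next derivative. *)
pose G (s : R) : R := 2 ^+ (a + n.+1.*2) * M.
have G0 (s : R) : 0 <= G s by rewrite mulr_ge0.
have intG : lebesgue_measure.-integrable `[1%R, 2%R] (EFin \o G).
  apply: continuous_compact_integrable; first exact: segment_compact.
  by apply: continuous_subspaceT => s; exact: cst_continuous.
have GM (t s : R) : `]x - 1, x + 1[%classic t -> `[1%R, 2%R]%classic s ->
    `|partial1of2 f t s| <= G s.
  rewrite /= !in_itv/= => /andP[t1 t2] /andP[s1 s2]; rewrite pf.
  have s0 : 0 <= s by rewrite (le_trans _ s1).
  rewrite !normrM ler_pM//.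
    rewrite !normrX normfV !(ger0_norm s0) -[leRHS]mulr1 ler_pM//.
    - by rewrite exprn_ge0.
    - by rewrite exprn_ge0// invr_ge0.
    - by rewrite lerXn2r// nnegrE.
    - by rewrite exprn_ile1// ?invr_ge0// invf_le1// (lt_le_trans _ s1).
  apply: HM; rewrite normrM ler_pM// ?normrX ?(ger0_norm s0).
    by rewrite (le_trans (_ : _ <= 2 ^+ 2)) ?lerXn2r ?nnegrE// -natrX.
  have : `|t - x| <= 1 by rewrite ler_norml; apply/andP; split; lra.
  rewrite -lerBlDl; apply: le_trans; exact: lerB_dist.
have mI : measurable (`[1%R, 2%R] : set (measurableTypeR R)) by exact: measurable_itv.
apply: DeriveDef.
  exact: (@derivable_under_integral R _ _ lebesgue_measure f _ mI x _ _ xI intf derf G G0 intG GM).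
rewrite -derive1E.
rewrite (@differentiation_under_integral R _ _ lebesgue_measure f _ mI x _ _ xI intf derf G G0 intG GM).
by apply: eq_Rintegral => s _; rewrite pf.
Qed.

Lemma avg_ge0 a b F n t : (forall x, 0 <= F n x) -> 0 <= avg a b F n t.
Proof.
move=> F0; apply: Rintegral_ge0 => s /=; rewrite in_itv/= => /andP[s1 _].
have s0 : 0 <= s by rewrite (le_trans _ s1).
by rewrite !mulr_ge0// exprn_ge0// invr_ge0.
Qed.

(** For [s >= 1] and [t >= 0] one has [s^2 t >= t]: averaging does not enlarge the support. *)
Lemma avg_eq0 a b F n t c : 0 <= c -> (forall x, c <= x -> F n x = 0) ->
  c <= t -> avg a b F n t = 0.
Proof.
move=> c0 F0 ct; rewrite /avg -[RHS](@Rintegral_set0 _ _ _ (@lebesgue_measure R) (cst 0)).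
rewrite Rintegral_set0 -[RHS](fine0) /Rintegral; congr fine.
apply: integral0_eq => s /=; rewrite in_itv/= => /andP[s1 _].
rewrite F0 ?mulr0// (le_trans ct)// ler_peMl ?(le_trans c0 ct)//.
by rewrite exprn_ege1.
Qed.

(** The integrand is continuous on the compact [[1, 2]], so it attains a positive minimum there. *)
Lemma avg_gt0 a b F t : derseq F -> (forall x, 0 <= F 0%N x) ->
  (forall s, 1 <= s <= 2 -> 0 < F 0%N (s ^+ 2 * t)) -> 0 < avg a b F 0 t.
Proof.
move=> dF F0 Ft.
pose f (s : R) := s ^+ (a + 0%N.*2) * s^-1 ^+ b * F 0%N (s ^+ 2 * t).
have cF : continuous (F 0%N) := derseq_continuous dF.
have [c c12 fc] := @EVT_min R f 1 2 (ler1n _ 2) (@avg_continuous _ b _ t cF).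
have fc0 : 0 < f c.
  move: c12; rewrite in_itv/= => /andP[c1 c2].
  by rewrite !mulr_gt0 ?Ft ?c1// exprn_gt0 ?invr_gt0// (lt_le_trans _ c1).
rewrite (lt_le_trans fc0)//.
have -> : f c = \int[lebesgue_measure]_(s in `[1%R, 2%R]) (cst (f c)) s.
  rewrite (@Rintegral_cst _ _ _ (@lebesgue_measure R))//.
  have E : lebesgue_measure [set` `[1%R, 2%R]] = 1%:E :> \bar R.
    rewrite lebesgue_measure_itv/= lte_fin ltr1n/= -EFinB.
    by congr EFin; ring.
  by rewrite -[LHS]mulr1; congr (_ * _); exact: (congr1 fine (esym E)).
apply: le_Rintegral => //.
- apply: continuous_compact_integrable; first exact: segment_compact.
  by apply: continuous_subspaceT => s; exact: cst_continuous.
- exact: avg_integrable.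
Qed.

Let is_derive_exprn n (x : R) :
  is_derive x (1 : R) (fun s : R => s ^+ n) (n%:R * x ^+ n.-1).
Proof.
by apply: DeriveDef; [exact: exprn_derivable|rewrite -derive1E exp_derive1].
Qed.

Let avg_primitive d F t s : derseq F -> (0 < d)%N -> s != 0 ->
  is_derive s (1 : R) (fun s => 2 * (s ^+ d * F 1%N (s ^+ 2 * t)))
   (4 * t * (s ^+ (d + 4) * s^-1 ^+ 3 * F 2 (s ^+ 2 * t)) +
   (2 * d)%:R * (s ^+ (d + 2) * s^-1 ^+ 3 * F 1%N (s ^+ 2 * t))).
Proof.
move=> dF d0 s0.
have d2 : is_derive s (1 : R) (fun s : R => s ^+ 2 * t) (2 * s * t).
  have := @is_deriveM _ _ _ _ s 1 _ _ (is_derive_exprn 2 s) (is_derive_cst t s 1).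
  by move/is_derive_eq; apply; rewrite /GRing.scale/=; ring.
have dH : is_derive s (1 : R) (F 1%N \o (fun s => s ^+ 2 * t))
    (F 2 (s ^+ 2 * t) * (2 * s * t)).
  by apply: is_derive1_comp; exact: dF.
have := @is_deriveZ _ _ _ _ 2 _ _ _ (@is_deriveM _ _ _ _ s 1 _ _ (is_derive_exprn d s) dH).
move/is_derive_eq; apply.
case: d d0 => // d _; rewrite /GRing.scale/=.
rewrite natrM !exprD !exprS !expr0; field.
by [].
Qed.

(** The left-hand side is the Laplacian in dimension [d] of the radial function with profile
    [avg d 3 F]. Its integrand is the derivative in [s] of [2 s^d F'(s^2 t)], so only the endpoints
    1 and 2 remain; the weight [s^(d-3)] is chosen for this. *)
Lemma avg_laplacian d F t : derseq F -> (0 < d)%N ->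
  4 * t * avg d 3 F 2 t + (2 * d)%:R * avg d 3 F 1 t =
  2 ^+ d.+1 * F 1%N (4 * t) - 2 * F 1%N t.
Proof.
move=> dF d0.
have c1 : continuous (F 1%N) := derseq_continuous dF.
have c2 : continuous (F 2) := derseq_continuous dF.
have mI : measurable (`[1%R, 2%R] : set (measurableTypeR R)) by exact: measurable_itv.
have i1 := @avg_integrable (d + 2) 3 _ t c1.
have i2 := @avg_integrable (d + 4) 3 _ t c2.
pose g s := 4 * t * (s ^+ (d + 4) * s^-1 ^+ 3 * F 2 (s ^+ 2 * t)) +
   (2 * d)%:R * (s ^+ (d + 2) * s^-1 ^+ 3 * F 1%N (s ^+ 2 * t)).
pose P s := 2 * (s ^+ d * F 1%N (s ^+ 2 * t)).
have dP s : s != 0 -> is_derive s (1 : R) P (g s) by exact: avg_primitive.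
transitivity (\int[lebesgue_measure]_(s in `[1%R, 2%R]) g s).
  rewrite /avg -RintegralZl// -[X in _ + X]RintegralZl// -RintegralD//.
  - have := integrableZl mI (4 * t) i2.
    by apply: eq_integrable => // s _; rewrite /= EFinM.
  - have := integrableZl mI (2 * d)%:R i1.
    by apply: eq_integrable => // s _; rewrite /= EFinM.
have n0 s : s \in `]1, 2[ -> s != 0 :> R.
  by rewrite in_itv/= => /andP[s1 _]; rewrite gt_eqF// (lt_trans _ s1).
rewrite /Rintegral (@continuous_FTC2 _ g P)//=; first last.
- move=> s /n0 s0; rewrite derive1E; exact: (@derive_val _ _ _ _ _ _ _ (dP s s0)).
- split.
  + by move=> s /n0 s0; exact: (ex_derive (is_derive := dP s s0)).
  + by apply: cvg_at_right_filter; exact: is_derive_continuous (dP 1 (oner_neq0 _)).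
  + apply: cvg_at_left_filter; apply: is_derive_continuous (dP 2 _).
    by rewrite pnatr_eq0.
- move=> s; apply: cvgD; apply: cvgM; [exact: cvg_cst| |exact: cvg_cst|];
  exact: avg_continuous.
- exact: ltr1n.
by rewrite /P !expr1n !mul1r [in RHS]exprS mulrA -(natrX _ 2 2).
Qed.

End derivative_sequences.

(** * Smooth functions and radial Laplacians *)

Section directional_derivatives.
Context {R : realType} {V : normedModType R}.
Implicit Types (f g : V -> R) (x v a : V).

Lemma is_derive_lineP f x v df :
  is_derive x v f df <->
  is_derive (0 : R) (1 : R) (fun t : R => f (t *: v + x)) df.
Proof.
have E : 'D_v f x = 'D_1 (fun t : R => f (t *: v + x)) 0.
  rewrite /derive; set g1 := fun h => h^-1 *: _; set g2 := fun h => h^-1 *: _.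
  suff -> : g1 = g2 by [].
  by apply/funext => h; rewrite /g1 /g2/= addr0 scale0r add0r [_%:A]mulr1.
split=> [[d <-]|[d <-]].
  by rewrite E; apply: DeriveDef; last by []; exact: (derivable1P f x v).1 d.
by rewrite -E; apply: DeriveDef; last by []; exact: (derivable1P f x v).2 d.
Qed.

Lemma is_derive_comp1 f x v df (g : R -> R) dg :
  is_derive x v f df -> is_derive (f x) (1 : R) g dg ->
  is_derive x v (g \o f) (dg * df).
Proof.
move=> /is_derive_lineP H Hg; apply/is_derive_lineP.
pose l (t : R) := f (t *: v + x).
have -> : (fun t : R => (g \o f) (t *: v + x)) = g \o l by [].
by apply: is_derive1_comp => //; rewrite /l scale0r add0r.
Qed.

Lemma is_derive_affine f x v (s : R) a df :
  is_derive (s *: x + a) v f df ->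
  is_derive x v (fun x => f (s *: x + a)) (s * df).
Proof.
move=> /is_derive_lineP H; apply/is_derive_lineP.
pose l (t : R) := f (t *: v + (s *: x + a)).
have -> : (fun t : R => f (s *: (t *: v + x) + a)) = l \o (fun t : R => s * t).
  by apply/funext => t; rewrite /l/= scalerDr scalerA addrA.
rewrite mulrC; apply: is_derive1_comp; first by rewrite mulr0.
by have := @is_deriveZ _ _ _ id s (0 : R) (1 : R) 1 (is_derive_id _ _); rewrite [_ *: _]mulr1.
Qed.

Lemma derive_near0 f x v : (\forall y \near x, f y = 0) -> is_derive x v f 0.
Proof.
move=> f0; apply: (@near_eq_is_derive _ _ _ (cst 0)).
by near=> y; rewrite (near f0 y).
Unshelve. all: end_near. Qed.

Lemma Ck_continuous (U : set V) k f : Ck U k f ->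
  forall x, U x -> {for x, continuous f}.
Proof. by case: k => [|k] []. Qed.

Lemma CkW (U : set V) k f : Ck U k.+1 f -> Ck U k f.
Proof.
elim: k f => [f [] //|k IH f [cf df]]; split => // v.
by have [d Dv] := df v; split => //; exact: IH.
Qed.

Definition smooth f := forall k, Ck setT k f.

Lemma smooth_derive f v : smooth f -> smooth ('D_v f).
Proof. by move=> sf k; have [_ /(_ v)[]] := sf k.+1. Qed.

Lemma smooth_derivable f x v : smooth f -> derivable f x v.
Proof. by move=> sf; have [_ /(_ v)[+ _]] := sf 1%N; exact. Qed.

Lemma smooth_continuous f : smooth f -> continuous f.
Proof. by move=> sf x; apply: Ck_continuous (sf 0%N) _ _. Qed.

Lemma Ck_cst (a : R) k : Ck (@setT V) k (cst a).
Proof.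
elim: k a => [|k IH] a; split => //; try by move=> x _; exact: cst_continuous.
move=> v; split; first by move=> x _; exact: derivable_cst.
rewrite (_ : 'D_v _ = cst 0) //; apply/funext => x; exact: derive_cst.
Qed.

Lemma CkD k f g : Ck setT k f -> Ck setT k g -> Ck setT k (fun x => f x + g x).
Proof.
elim: k f g => [|k IH] f g [cf df] [cg dg]; split => //;
  try by move=> x _; apply: continuousD; [exact: cf|exact: cg].
move=> v; have [dfv Df] := df v; have [dgv Dg] := dg v.
split; first by move=> x _; apply: derivableD; [exact: dfv|exact: dgv].
rewrite (_ : 'D_v _ = (fun x => 'D_v f x + 'D_v g x)); first exact: IH.
by apply/funext => x; rewrite deriveD//; [exact: dfv|exact: dgv].
Qed.

Lemma CkM k f g : Ck setT k f -> Ck setT k g -> Ck setT k (fun x => f x * g x).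
Proof.
elim: k f g => [|k IH] f g hf hg; have [cf df] := hf; have [cg dg] := hg; split => //;
  try by move=> x _; apply: cvgM; [exact: cf|exact: cg].
move=> v; have [dfv Df] := df v; have [dgv Dg] := dg v.
split; first by move=> x _; apply: derivableM; [exact: dfv|exact: dgv].
rewrite (_ : 'D_v _ = (fun x => f x * 'D_v g x + g x * 'D_v f x)).
  by apply: CkD; apply: IH => //; exact: CkW.
by apply/funext => x; rewrite deriveM//; [exact: dfv|exact: dgv].
Qed.

(** The induction on [k] keeps [n] general, because each derivative of the composite moves one step
    along the sequence. *)
Lemma Ck_derseq F n k f : derseq F -> Ck setT k f -> Ck setT k (fun x => F n (f x)).
Proof.
move=> dF; elim: k n f => [|k IH] n f hf; have [cf df] := hf; split => //;
  try by move=> x _; apply: continuous_comp;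
    [exact: cf|exact: derseq_continuous].
move=> v; have [dfv Df] := df v.
have H x : is_derive x v (fun x => F n (f x)) (F n.+1 (f x) * 'D_v f x).
  by apply: is_derive_comp1; [exact/derivableP/dfv|exact: dF].
split; first by move=> x _; exact: (ex_derive (is_derive := H x)).
rewrite (_ : 'D_v _ = (fun x => F n.+1 (f x) * 'D_v f x)).
  by apply: CkM => //; apply: IH; exact: CkW.
by apply/funext => x; exact: (@derive_val _ _ _ _ _ _ _ (H x)).
Qed.

Lemma Ck_affine k f (s : R) a : Ck setT k f -> Ck setT k (fun x => f (s *: x + a)).
Proof.
elim: k f => [|k IH] f hf; have [cf df] := hf; split => //;
  try (move=> x _; apply: (@continuous_comp _ _ _ (fun x => s *: x + a) f);
    [by apply: cvgD; [apply: cvgZl_tmp; exact: cvg_id|exact: cvg_cst]|exact: cf]).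
move=> v; have [dfv Df] := df v.
have H x : is_derive x v (fun x => f (s *: x + a)) (s * 'D_v f (s *: x + a)).
  by apply: is_derive_affine; exact/derivableP/dfv.
split; first by move=> x _; exact: (ex_derive (is_derive := H x)).
rewrite (_ : 'D_v _ = (fun x => s * 'D_v f (s *: x + a))).
  by apply: (@CkM _ (cst s)); [exact: (Ck_cst s k)|exact: (IH _ Df)].
by apply/funext => x; exact: (@derive_val _ _ _ _ _ _ _ (H x)).
Qed.

Lemma smooth_cst (a : R) : smooth (cst a).
Proof. by move=> k; exact: Ck_cst. Qed.

Lemma smoothD f g : smooth f -> smooth g -> smooth (fun x => f x + g x).
Proof. by move=> sf sg k; exact: CkD. Qed.

Lemma smoothM f g : smooth f -> smooth g -> smooth (fun x => f x * g x).
Proof. by move=> sf sg k; exact: CkM. Qed.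

Lemma smoothZ (a : R) f : smooth f -> smooth (fun x => a * f x).
Proof. by move=> sf k; apply: CkM; [exact: Ck_cst|]. Qed.

Lemma smoothB f g : smooth f -> smooth g -> smooth (fun x => f x - g x).
Proof.
move=> sf sg; rewrite (_ : (fun _ => _) = (fun x => f x + (-1) * g x)).
  by apply: smoothD => //; exact: smoothZ.
by apply/funext => x; rewrite mulN1r.
Qed.

Lemma smooth_sum (I : Type) (s : seq I) (h : I -> V -> R) :
  (forall i, smooth (h i)) -> smooth (fun x => \sum_(i <- s) h i x).
Proof.
move=> sh; elim: s => [|i s IH].
  rewrite (_ : (fun _ => _) = cst 0); first exact: smooth_cst.
  by apply/funext => x; rewrite big_nil.
rewrite (_ : (fun _ => _) = (fun x => h i x + \sum_(j <- s) h j x)).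
  exact: smoothD.
by apply/funext => x; rewrite big_cons.
Qed.

Lemma smooth_derseq F n f : derseq F -> smooth f -> smooth (fun x => F n (f x)).
Proof. by move=> dF sf k; exact: Ck_derseq. Qed.

Lemma smooth_affine f (s : R) a : smooth f -> smooth (fun x => f (s *: x + a)).
Proof. by move=> sf k; exact: Ck_affine. Qed.

Lemma deriveD_smooth f g v x : smooth f -> smooth g ->
  'D_v (fun x => f x + g x) x = 'D_v f x + 'D_v g x.
Proof. by move=> sf sg; rewrite deriveD//; exact: smooth_derivable. Qed.

Lemma deriveZ_smooth (a : R) f v x : smooth f ->
  'D_v (fun x => a * f x) x = a * 'D_v f x.
Proof. by move=> sf; rewrite deriveMl//; exact: smooth_derivable. Qed.

Lemma derive_affine f (s : R) a v x : smooth f ->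
  'D_v (fun x => f (s *: x + a)) x = s * 'D_v f (s *: x + a).
Proof.
move=> sf; apply: (@derive_val _ _ _ _ _ _ _ (is_derive_affine _)).
exact/derivableP/smooth_derivable.
Qed.

Lemma derive_sum_smooth (I : Type) (s : seq I) (h : I -> V -> R) v x :
  (forall i, smooth (h i)) ->
  'D_v (fun x => \sum_(i <- s) h i x) x = \sum_(i <- s) 'D_v (h i) x.
Proof.
move=> sh; elim: s => [|i s IH].
  rewrite big_nil (_ : (fun _ => _) = cst 0) ?derive_cst//.
  by apply/funext => y; rewrite big_nil.
rewrite (_ : (fun _ => _) = (fun x => h i x + \sum_(j <- s) h j x)).
  by rewrite deriveD_smooth//; [rewrite IH big_cons|exact: smooth_sum].
by apply/funext => y; rewrite big_cons.
Qed.

End directional_derivatives.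

(** * Coordinates, the Euclidean square and the Laplacian *)

Section euclidean_radial.
Context {R : realType} {d : nat}.
Implicit Types (x : 'rV[R]_d) (f : 'rV[R]_d -> R).

Lemma ler_coord_norm x i : `|x ord0 i| <= `|x|.
Proof.
have /mapP[j Hj ->] : `|x ord0 i| \in [seq `|x k.1 k.2| | k : 'I_1 * 'I_d].
  by apply/mapP; exists (ord0, i) => //=; rewrite mem_enum.
by rewrite [leRHS]/Num.norm /= mx_normrE; apply/bigmax_geP; right => /=; exists j.
Qed.

Lemma is_derive_coord (i : 'I_d) x (v : 'rV[R]_d) :
  is_derive x v (fun x : 'rV[R]_d => x ord0 i) (v ord0 i).
Proof.
apply/is_derive_lineP.
rewrite (_ : (fun _ => _) = fun t : R => t * v ord0 i + x ord0 i); last first.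
  by apply/funext => t; rewrite !mxE.
have dl : is_derive (0 : R) (1 : R) (fun t : R => t * v ord0 i) (v ord0 i).
  have := @is_deriveM _ _ id (cst (v ord0 i)) (0 : R) (1 : R) _ _
    (is_derive_id _ _) (is_derive_cst _ _ _).
  by move/is_derive_eq; apply; rewrite /GRing.scale/= mul0r mulr1 add0r.
have := @is_deriveD _ _ _ _ _ (0 : R) (1 : R) _ _ dl
  (is_derive_cst (x ord0 i) (0 : R) (1 : R)).
by move/is_derive_eq; apply; rewrite addr0.
Qed.

Lemma derive_coord (i : 'I_d) x (v : 'rV[R]_d) :
  'D_v (fun x : 'rV[R]_d => x ord0 i) x = v ord0 i.
Proof. exact: (@derive_val _ _ _ _ _ _ _ (is_derive_coord i x v)). Qed.

Lemma smooth_coord (i : 'I_d) : smooth (fun x : 'rV[R]_d => x ord0 i).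
Proof.
case=> [|k]; split => //; try by move=> x _; exact: coord_continuous.
move=> v; split.
  by move=> x _; exact: (ex_derive (is_derive := is_derive_coord i x v)).
rewrite (_ : 'D_v _ = cst (v ord0 i)); first exact: Ck_cst.
by apply/funext => x; exact: derive_coord.
Qed.

(** The library norm is the sup norm; the Euclidean norm enters only through this smooth square,
    which is all that radial functions use. *)
Definition sqnorm x : R := \sum_(i < d) x ord0 i * x ord0 i.

Lemma smooth_sqnorm : smooth sqnorm.
Proof. by apply: smooth_sum => i; apply: smoothM; exact: smooth_coord. Qed.

Lemma partial_sqnorm (i : 'I_d) x : partial i sqnorm x = 2 * x ord0 i.
Proof.
rewrite /partial /sqnorm derive_sum_smooth; last first.
  by move=> j; apply: smoothM; exact: smooth_coord.
rewrite (bigD1 i)//= big1 ?addr0 => [|j ji]; rewrite deriveM;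
  try (exact/smooth_derivable/smooth_coord).
  by rewrite derive_coord mxE !eqxx /GRing.scale/= mulr1; ring.
by rewrite derive_coord mxE eqxx (negbTE ji) /GRing.scale/= mulr0 addr0.
Qed.

Lemma sqnormZ (s : R) x : sqnorm (s *: x) = s ^+ 2 * sqnorm x.
Proof. by rewrite /sqnorm mulr_sumr; apply: eq_bigr => i _; rewrite !mxE; ring. Qed.

Lemma sqnorm0 : sqnorm 0 = 0.
Proof. by rewrite /sqnorm big1// => i _; rewrite mxE mulr0. Qed.

Lemma sqnorm_ge0 x : 0 <= sqnorm x.
Proof. by apply: sumr_ge0 => i _; rewrite -expr2 sqr_ge0. Qed.

Lemma ler_norm_sqnorm x : `|x| ^+ 2 <= sqnorm x.
Proof.
have [->|/mx_norm_neq0] := eqVneq (`|x|) 0; first by rewrite expr0n/= sqnorm_ge0.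
move=> [[i j] /=]; rewrite -[mx_norm x]/(`|x|) => ->; rewrite (ord1 i).
rewrite real_normK ?num_real// /sqnorm (bigD1 j)//= expr2 lerDl sumr_ge0// => k _.
by rewrite -expr2 sqr_ge0.
Qed.

Definition lap f x : R := \sum_(i < d) partial i (partial i f) x.

Lemma smooth_lap f : smooth f -> smooth (lap f).
Proof. by move=> sf; apply: smooth_sum => i; do 2 apply: smooth_derive. Qed.

Definition radial (F : nat -> R -> R) x : R := F 0%N (sqnorm x).

Lemma smooth_radial F : derseq F -> smooth (radial F).
Proof. by move=> dF; apply: smooth_derseq => //; exact: smooth_sqnorm. Qed.

Lemma partial_radial F n (i : 'I_d) x : derseq F ->
  partial i (fun x => F n (sqnorm x)) x = F n.+1 (sqnorm x) * (2 * x ord0 i).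
Proof.
move=> dF; rewrite -partial_sqnorm /partial.
have H : is_derive x (delta_mx ord0 i) sqnorm ('D_(delta_mx ord0 i) sqnorm x).
  exact/derivableP/smooth_derivable/smooth_sqnorm.
exact: (@derive_val _ _ _ _ _ _ _ (is_derive_comp1 H (dF n (sqnorm x)))).
Qed.

Lemma lap_radial F x : derseq F ->
  lap (radial F) x = 4 * sqnorm x * F 2 (sqnorm x) + (2 * d)%:R * F 1%N (sqnorm x).
Proof.
move=> dF; have s1 : smooth (fun x => F 1%N (sqnorm x)).
  by apply: smooth_derseq => //; exact: smooth_sqnorm.
transitivity (\sum_(i < d) (F 2 (sqnorm x) * 4 * (x ord0 i * x ord0 i) + 2 * F 1%N (sqnorm x))).
  apply: eq_bigr => i _; rewrite {1}/partial.
  rewrite (_ : partial i _ = (fun x => F 1%N (sqnorm x) * (2 * x ord0 i))); last first.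
    by apply/funext => y; exact: partial_radial.
  rewrite deriveM; [|exact: smooth_derivable|apply/smooth_derivable/smoothZ; exact: smooth_coord].
  rewrite deriveZ_smooth; last exact: smooth_coord.
  rewrite derive_coord mxE !eqxx.
  by have := @partial_radial F 1 i x dF; rewrite /partial => ->; rewrite /GRing.scale/=; ring.
rewrite big_split/= -mulr_sumr -/(sqnorm x) sumr_const card_ord -mulr_natr natrM.
by ring.
Qed.

Lemma partial_affine f (i : 'I_d) (s : R) a x : smooth f ->
  partial i (fun x => f (s *: x + a)) x = s * partial i f (s *: x + a).
Proof. exact: derive_affine. Qed.

Lemma lap_affine f (s : R) a x : smooth f ->
  lap (fun x => f (s *: x + a)) x = s ^+ 2 * lap f (s *: x + a).
Proof.
move=> sf; rewrite /lap mulr_sumr; apply: eq_bigr => i _.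
rewrite {1}/partial (_ : partial i _ = (fun x => s * partial i f (s *: x + a))).
  rewrite deriveZ_smooth; last by apply: smooth_affine; exact: smooth_derive.
  by rewrite derive_affine ?mulrA//; exact: smooth_derive.
by apply/funext => y; exact: partial_affine.
Qed.

Lemma lapZ (a : R) f x : smooth f -> lap (fun x => a * f x) x = a * lap f x.
Proof.
move=> sf; rewrite /lap mulr_sumr; apply: eq_bigr => i _.
rewrite {1}/partial (_ : partial i _ = (fun x => a * partial i f x)).
  by rewrite deriveZ_smooth//; exact: smooth_derive.
by apply/funext => y; exact: deriveZ_smooth.
Qed.

Lemma near0_outside f (a : 'rV[R]_d) (r : R) : (forall x, r < `|x - a| -> f x = 0) ->
  forall x, r < `|x - a| -> \forall y \near x, f y = 0.
Proof.
move=> f0 x xr; near=> y; apply: f0.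
have : `|y - x| < `|x - a| - r.
  rewrite distrC; near: y; apply: (@cvgr_dist_lt _ _ _ _ _ id x); first exact: cvg_id.
  by rewrite subr_gt0.
rewrite ltrBrDl -ltrBrDr => /lt_le_trans; apply.
by have := ler_distD y x a; rewrite (distrC x y) -lerBlDl.
Unshelve. all: end_near. Qed.

Lemma derive_outside f (v a : 'rV[R]_d) (r : R) : (forall x, r < `|x - a| -> f x = 0) ->
  forall x, r < `|x - a| -> 'D_v f x = 0.
Proof.
move=> f0 x /(near0_outside f0) H.
exact: (@derive_val _ _ _ _ _ _ _ (derive_near0 v H)).
Qed.

Lemma compact_cball (a : 'rV[R]_d) (r : R) : compact [set x : 'rV[R]_d | `|x - a| <= r].
Proof.
apply: bounded_closed_compact.
  exists (`|a| + `|r|); split; first by rewrite num_real.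
  move=> M aM x /= xr; rewrite (le_trans _ (ltW aM))//.
  rewrite -(subrK a x) (le_trans (ler_normD _ _))// addrC lerD2l.
  by rewrite (le_trans xr)// ler_norm.
rewrite (_ : [set _ | _] = (fun x => `|x - a|) @^-1` [set t | t <= r]) //.
apply: closed_comp; last exact: closed_le.
move=> x _; apply: (@continuous_comp _ _ _ (fun x => x - a) Num.norm).
  by apply: continuousB; [exact: cvg_id|exact: cst_continuous].
exact: norm_continuous.
Qed.

Lemma test_function_cball (Om : set 'rV[R]_d) f (a : 'rV[R]_d) (r : R) : smooth f ->
  (forall x, r < `|x - a| -> f x = 0) -> [set x | `|x - a| <= r] `<=` Om ->
  test_function Om f.
Proof.
move=> sf f0 aOm; split => //; exists [set x | `|x - a| <= r]; split => //.
  exact: compact_cball.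
by move=> x /= /negP; rewrite -ltNge => /f0.
Qed.

End euclidean_radial.

(** * Integration by parts *)

Section lebesgue_continuous.
Context {R : realType} {d : nat}.
Local Notation leb := (@lebesgue_rV R d).
Local Notation cball a r := [set x : 'rV[R]_d | (`|x - a| <= r)%R].
Implicit Types (f g : 'rV[R]_d -> R) (a x v : 'rV[R]_d).

Lemma continuous_measurable_rV f : continuous f -> measurable_fun setT f.
Proof.
move=> cf; apply: (measurability _ (measurable_realfun.RGenOpens.measurableE R)) => //.
move=> _ [_ [a [b ->]] <-].
rewrite setTI; apply: open_measurable_rV.
by move/continuousP: cf; apply.
Qed.

Lemma closed_measurable_rV (A : set 'rV[R]_d) : closed A -> measurable A.
Proof.
move=> cA; rewrite -(setCK A); apply: measurableC; apply: open_measurable_rV.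
exact: closed_openC.
Qed.

Lemma measurable_rV_set1 a : measurable [set a].
Proof.
apply: closed_measurable_rV.
exact: (accessible_closed_set1 (hausdorff_accessible (@norm_hausdorff _ _))).
Qed.

Lemma measurable_cball a (r : R) : measurable [set x | `|x - a| <= r].
Proof.
apply: closed_measurable_rV; apply: compact_closed; last exact: compact_cball.
exact: norm_hausdorff.
Qed.

Lemma lebesgue_cball_lty a (r : R) : (leb (cball a r) < +oo)%E.
Proof.
apply: (@le_lt_trans _ _ (leb (ball a (`|r| + 1)))); last first.
  by rewrite lebesgue_rV_ball ?ltry// ltr_wpDl.
apply: le_measure; rewrite ?inE.
- exact: measurable_cball.
- by apply: open_measurable_rV; exact: ball_open.
- move=> x /= xr; rewrite -ball_normE/= distrC (le_lt_trans xr)//.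
  by rewrite (le_lt_trans (ler_norm r))// ltrDl.
Qed.

Lemma continuous_bounded_cball f a (r : R) : continuous f ->
  exists2 M, 0 <= M & forall x, `|x - a| <= r -> `|f x| <= M.
Proof.
move=> cf; have cA : compact (f @` [set x | `|x - a| <= r]).
  by apply: continuous_compact; [exact: continuous_subspaceT|exact: compact_cball].
have [M [_ Mf]] := compact_bounded cA.
exists (`|M| + 1) => [|x xA]; first by rewrite addr_ge0.
apply: (Mf (`|M| + 1)); first by rewrite ltr_pwDr// ler_norm.
by exists x.
Qed.

Lemma compact_support_bounded f a (r : R) : continuous f ->
  (forall x, r < `|x - a| -> f x = 0) ->
  exists2 M, 0 <= M & forall x, `|f x| <= M.
Proof.
move=> cf f0; have [M M0 HM] := continuous_bounded_cball a r cf.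
exists M => // x; have [|/f0->] := leP (`|x - a|) r; first exact: HM.
by rewrite normr0.
Qed.

Lemma bounded_support_integrable f (M : R) a (r : R) : measurable_fun setT f ->
  (forall x, `|f x| <= M) -> (forall x, r < `|x - a| -> f x = 0) ->
  leb.-integrable setT (EFin \o f).
Proof.
move=> mf fM f0.
have i1 : leb.-integrable [set x | `|x - a| <= r] (EFin \o f).
  apply: measurable_bounded_integrable.
  - exact: measurable_cball.
  - exact: lebesgue_cball_lty.
  - exact: measurable_funS mf.
  - exists M; split; first by rewrite num_real.
    by move=> N MN x _ /=; exact: le_trans (fM x) (ltW MN).
move: i1 => /(integrable_mkcond _ (measurable_cball a r)).1.
apply: eq_integrable => // x _; rewrite patchE.
case: ifPn => //; rewrite notin_setE/= => /negP; rewrite -ltNge => /f0/= ->.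
by [].
Qed.

Lemma compact_support_integrable f a (r : R) : continuous f ->
  (forall x, r < `|x - a| -> f x = 0) -> leb.-integrable setT (EFin \o f).
Proof.
move=> cf f0; have [M _ HM] := compact_support_bounded cf f0.
exact: bounded_support_integrable (continuous_measurable_rV cf) HM f0.
Qed.

Lemma is_derive_along f v (df : 'rV[R]_d -> R) x (t : R) :
  (forall x, is_derive x v f (df x)) ->
  is_derive t (1 : R) (fun s : R => f (s *: v + x)) (df (t *: v + x)).
Proof.
move=> dfv; have /is_derive_lineP H := dfv (t *: v + x).
pose k (s : R) := f (s *: v + (t *: v + x)).
rewrite (_ : (fun _ => _) = k \o (fun s : R => s - t)); last first.
  by apply/funext => s; rewrite /k/= addrA -scalerDl subrK.
rewrite -[df _]mulr1; apply: is_derive1_comp; first by rewrite subrr.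
have := @is_deriveB _ _ _ id (cst t) t (1 : R) 1 0 (is_derive_id _ _) (is_derive_cst _ _ _).
by rewrite subr0.
Qed.

Lemma derive_mean_value f v (M : R) x (t : R) : (forall x, derivable f x v) ->
  (forall x, `|'D_v f x| <= M) -> 0 <= t -> `|f (t *: v + x) - f x| <= M * t.
Proof.
move=> dfv fM t0.
pose k (s : R) := f (s *: v + x).
have dk (s : R) : is_derive s (1 : R) k ('D_v f (s *: v + x)).
  exact: (@is_derive_along f v ('D_v f) x s (fun y => derivableP (dfv y))).
have [c c0t] := @MVT_segment R k (fun s => 'D_v f (s *: v + x)) 0 t t0
  (fun s _ => dk s) (continuous_subspaceT (fun s => is_derive_continuous (dk s))).
rewrite /k scale0r add0r subr0 => ->.
by rewrite normrM (ger0_norm t0) ler_wpM2r.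
Qed.

Lemma integrable_Rintegral_EFin f : leb.-integrable setT (EFin \o f) ->
  (\int[leb]_x (f x)%:E = (\int[leb]_x f x)%:E)%E.
Proof. by move=> fi; rewrite fineK// integrable_fin_num. Qed.

(** Difference quotients of [f] integrate to 0 by translation invariance; dominated convergence
    passes to the derivative. *)
Lemma Rintegral_derive0 f v a (r : R) : continuous f ->
  (forall x, derivable f x v) -> continuous ('D_v f) ->
  (forall x, r < `|x - a| -> f x = 0) -> \int[leb]_x 'D_v f x = 0.
Proof.
move=> cf dfv cdf f0.
have df0 := @derive_outside R d f v a r f0.
have [M M0 HM] := compact_support_bounded cdf df0.
pose t (n : nat) : R := n.+1%:R^-1.
have t0 n : 0 < t n by rewrite invr_gt0.
have t1 n : t n <= 1 by rewrite invf_le1// ler1n.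
pose g n x := (t n)^-1 * (f (1 *: x + t n *: v) - f x).
have fi := compact_support_integrable cf f0.
have fti n : leb.-integrable setT (EFin \o (fun x => f (1 *: x + t n *: v))).
  exact: integrable_affine.
have gi n : leb.-integrable setT (EFin \o g n).
  have := integrableZl measurableT (t n)^-1 (integrableB measurableT (fti n) fi).
  by apply: eq_integrable => // x _; rewrite /= EFinM EFinB.
have g0 n : (\int[leb]_x (g n x)%:E = 0)%E.
  rewrite integrable_Rintegral_EFin// /g RintegralZl//; last first.
    have := integrableB measurableT (fti n) fi.
    by apply: eq_integrable => // x _; rewrite /= EFinB.
  rewrite RintegralB//.
  have := @Rintegral_affine R d 1 (t n *: v) f ltr01 (continuous_measurable_rV cf).
  by rewrite expr1n mul1r => ->; rewrite subrr mulr0.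
(* The steps [t n] are at most 1, so all the quotients are supported in the ball enlarged by [|v|],
   and the mean value theorem bounds them by [M]. *)
pose G x : R := M * \1_(cball a (r + `|v|)) x.
have Gi : leb.-integrable setT (EFin \o G).
  apply: (@bounded_support_integrable _ M a (r + `|v|)).
  - apply: measurable_funM => //; apply: measurable_indic; exact: measurable_cball.
  - move=> x; rewrite /G indicE; case: (_ \in _); first by rewrite mulr1 ger0_norm.
    by rewrite mulr0 normr0.
  - move=> x xr; rewrite /G indicE memNset ?mulr0//=.
    by apply/negP; rewrite -ltNge.
have gG n x : `|g n x| <= G x.
  rewrite /G /g scale1r (addrC x); have [xr|xr] := leP (`|x - a|) (r + `|v|).
    rewrite indicE mem_set// mulr1 normrM ger0_norm ?invr_ge0 ?(ltW (t0 n))//.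
    by rewrite ler_pdivrMl// mulrC; apply: derive_mean_value => //; exact: ltW.
  rewrite indicE memNset/= ?mulr0; last by apply/negP; rewrite -ltNge.
  rewrite !f0 ?subr0 ?mulr0 ?normr0//.
    by rewrite (le_lt_trans _ xr)// lerDl.
  rewrite -addrA; have : `|x - a| <= `|t n *: v + (x - a)| + `|v|.
    have := ler_normB (t n *: v + (x - a)) (t n *: v); rewrite addrAC subrr add0r.
    move=> /le_trans; apply; rewrite lerD2l normrZ (ger0_norm (ltW (t0 n))).
    by rewrite ler_piMl.
  by rewrite -lerBlDr => /(lt_le_trans _); apply; rewrite ltrBrDr.
have gD x : g ^~ x @ \oo --> 'D_v f x.
  have := dfv x; rewrite /derivable => /cvgr_dnbhsP /(_ t).
  rewrite -/('D_v f x) /t /g; move=> H.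
  have tc : (forall n, t n != 0) /\ t n @[n --> \oo] --> (0 : R).
    by split=> [n|]; [rewrite gt_eqF|exact: cvg_harmonic].
  have := H tc; apply: cvg_trans; apply: near_eq_cvg; near=> n.
  by rewrite /= scale1r (addrC x).
have := @dominated_convergence _ _ _ leb setT measurableT (fun n x => (g n x)%:E)
  (fun x => ('D_v f x)%:E) (EFin \o G).
case.
- by move=> n; have /integrableP[] := gi n.
- by apply/measurable_EFinP; exact: continuous_measurable_rV.
- by apply: aeW => x _; apply: cvg_EFin; [exact: nearW|exact: gD].
- exact: Gi.
- by apply: aeW => x n _; rewrite lee_fin gG.
move=> Di _; rewrite (_ : [sequence _]_n = cst 0%E); last first.
  by apply/funext => n /=; exact: g0.
move=> /(cvg_unique _ (cvg_cst _)) H.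
by rewrite /Rintegral -H.
Unshelve. all: end_near. Qed.

(** Regularity along a single direction and on a set only: it will be applied to the slices of the
    cost, which are regular just near [om1]. *)
Definition C1_on (U : set 'rV[R]_d) v f := forall x, U x ->
  [/\ derivable f x v, {for x, continuous f} & {for x, continuous ('D_v f)}].

Lemma smooth_C1_on U v f : smooth f -> C1_on U v f.
Proof.
move=> sf x _; split; [exact: smooth_derivable|exact: smooth_continuous|].
by apply: smooth_continuous; exact: smooth_derive.
Qed.

Lemma continuous_mul_supported (U : set 'rV[R]_d) (h e : 'rV[R]_d -> R) a (r : R) :
  [set x | `|x - a| <= r] `<=` U -> (forall x, U x -> {for x, continuous h}) ->
  continuous e -> (forall x, r < `|x - a| -> e x = 0) -> continuous (fun x => h x * e x).
Proof.
move=> aU ch ce e0 x; have [Ux|Ux] := pselect (U x).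
  exact: (cvgM (ch x Ux) (ce x)).
have xr : r < `|x - a| by rewrite ltNge; apply/negP => /aU.
have he0 y : r < `|y - a| -> h y * e y = 0 by move=> /e0 ->; rewrite mulr0.
rewrite /prop_for /continuous_at (he0 _ xr).
have := near0_outside he0 xr => N0.
exact: (@cvg_near_cst _ _ _ _ _ _ N0).
Qed.

(** Outside [U] the function [g] is arbitrary, but every such point has a neighbourhood on which
    [psi] vanishes; the products are therefore regular on the whole space. *)
Lemma Rintegral_by_parts (U : set 'rV[R]_d) g psi v a (r : R) :
  open U -> [set x | `|x - a| <= r] `<=` U -> C1_on U v g -> smooth psi ->
  (forall x, r < `|x - a| -> psi x = 0) ->
  [/\ continuous (fun x => g x * 'D_v psi x), continuous (fun x => 'D_v g x * psi x) &
   \int[leb]_x (g x * 'D_v psi x) = - \int[leb]_x ('D_v g x * psi x)].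
Proof.
move=> oU aU gC sp p0.
have cpsi := smooth_continuous sp.
have dp0 := @derive_outside R d psi v a r p0.
have sdp : smooth ('D_v psi) by exact: smooth_derive.
have cdpsi := smooth_continuous sdp.
have outU x : ~ U x -> r < `|x - a|.
  by move=> Ux; rewrite ltNge; apply/negP => /aU.
have c1 : continuous (fun x => g x * 'D_v psi x) by apply: (continuous_mul_supported aU) => // x /gC[].
have c2 : continuous (fun x => 'D_v g x * psi x) by apply: (continuous_mul_supported aU) => // x /gC[].
have c3 : continuous (fun x => g x * psi x) by apply: (continuous_mul_supported aU) => // x /gC[].
have H x : is_derive x v (fun x => g x * psi x) (g x * 'D_v psi x + 'D_v g x * psi x).
  have [Ux|Ux] := pselect (U x).
    have [dg _ _] := gC _ Ux.
    have := @is_deriveM _ _ _ _ x v _ _ (derivableP dg) (derivableP (smooth_derivable sp : derivable psi x v)).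
    by move/is_derive_eq; apply; rewrite /GRing.scale/= [psi x * _]mulrC.
  have xr := outU _ Ux; rewrite p0// dp0// !mulr0 addr0.
  by apply: derive_near0; apply: (near0_outside _ xr) => y /p0 ->; rewrite mulr0.
have DE : 'D_v (fun x => g x * psi x) = (fun x => g x * 'D_v psi x + 'D_v g x * psi x).
  by apply/funext => x; exact: (@derive_val _ _ _ _ _ _ _ (H x)).
split => //.
have i1 := @compact_support_integrable _ a r c1.
have i2 := @compact_support_integrable _ a r c2.
apply/eqP; rewrite -addr_eq0 -RintegralD//; last 2 first.
- by apply: i1 => x /dp0 ->; rewrite mulr0.
- by apply: i2 => x /p0 ->; rewrite mulr0.
have Z : \int[leb]_x 'D_v (fun x => g x * psi x) x = 0.
  apply: (@Rintegral_derive0 (fun x => g x * psi x) v a r).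
  - exact: c3.
  - by move=> x; exact: (ex_derive (is_derive := H x)).
  - by rewrite DE => x; exact: (cvgD (c1 x) (c2 x)).
  - by move=> x /p0 ->; rewrite mulr0.
by rewrite DE in Z; apply/eqP.
Qed.

End lebesgue_continuous.

(** * Fundamental lemma of the calculus of variations *)

Section density_measure.
Context d (T : measurableType d) {R : realType} (mu : {measure set T -> \bar R}).
Variables (f : T -> R) (mf : measurable_fun setT f) (f0 : forall x, 0 <= f x).

(** Both proofs are arguments, so that [density mf f0] can carry the measure structure declared
    below. *)
Definition density of measurable_fun setT f & (forall x, 0 <= f x) :=
  fun A : set T => (\int[mu]_(x in A) (f x)%:E)%E.

Let density0 : density mf f0 set0 = 0%E.
Proof. by rewrite /density integral_set0. Qed.

Let density_ge0 A : (0 <= density mf f0 A)%E.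
Proof. by apply: integral_ge0 => x _; rewrite lee_fin. Qed.

Let density_sigma_additive : semi_sigma_additive (density mf f0).
Proof.
apply: semi_sigma_additive_nng_induced; first exact/measurable_EFinP.
by move=> x; rewrite lee_fin.
Qed.

HB.instance Definition _ := isMeasure.Build _ _ _ (density mf f0)
  density0 density_ge0 density_sigma_additive.

End density_measure.

Section box_bumps.
Context {R : realType} {d : nat}.
Local Notation leb := (@lebesgue_rV R d).
Local Notation cball a r := [set x : 'rV[R]_d | (`|x - a| <= r)%R].

Lemma smooth_prod (I : Type) (s : seq I) (h : I -> 'rV[R]_d -> R) :
  (forall i, smooth (h i)) -> smooth (fun x => \prod_(i <- s) h i x).
Proof.
move=> sh; elim: s => [|i s IH].
  rewrite (_ : (fun _ => _) = cst 1); first exact: smooth_cst.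
  by apply/funext => x; rewrite big_nil.
rewrite (_ : (fun _ => _) = (fun x => h i x * \prod_(j <- s) h j x)).
  exact: smoothM.
by apply/funext => x; rewrite big_cons.
Qed.

(** The factor [flat 0 r] takes care of the empty product: the set of positivity is [ball a r] for
    every real [r], in dimension 0 too. *)
Definition box_bump (a : 'rV[R]_d) (r : R) (x : 'rV[R]_d) : R :=
  flat 0 r * \prod_(i < d)
    (flat 0 (r - (x ord0 i - a ord0 i)) * flat 0 (r + (x ord0 i - a ord0 i))).

Lemma box_bump_ge0 a r x : 0 <= box_bump a r x.
Proof.
by rewrite mulr_ge0 ?flat0_ge0// prodr_ge0// => i _; rewrite mulr_ge0// flat0_ge0.
Qed.

Lemma smooth_box_bump a r : smooth (box_bump a r).
Proof.
apply: smoothZ; apply: smooth_prod => i; apply: smoothM;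
  apply: smooth_derseq (derseq_flat) _.
  apply: smoothB; first exact: smooth_cst.
  by apply: smoothB; [exact: smooth_coord|exact: smooth_cst].
apply: smoothD; first exact: smooth_cst.
by apply: smoothB; [exact: smooth_coord|exact: smooth_cst].
Qed.

Lemma flat0_gt0P (t : R) : (0 < flat 0 t) = (0 < t).
Proof. by have [/flat0_gt0->//|/flat_le0->] := ltP 0 t; rewrite ltxx. Qed.

Lemma box_bump_gt0P a r x : 0 < box_bump a r x <-> ball a r x.
Proof.
split=> [|[r0 H]].
  rewrite lt_neqAle eq_sym mulf_eq0 negb_or => /andP[/andP[r0 p0] _].
  have {}r0 : 0 < r by rewrite -flat0_gt0P lt_neqAle eq_sym r0 flat0_ge0.
  split => // i j; rewrite (ord1 i).
  move/prodf_neq0: p0 => /(_ j isT); rewrite mulf_eq0 negb_or => /andP[h1 h2].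
  have {}h1 : 0 < r - (x ord0 j - a ord0 j).
    by rewrite -flat0_gt0P lt_neqAle eq_sym h1 flat0_ge0.
  have {}h2 : 0 < r + (x ord0 j - a ord0 j).
    by rewrite -flat0_gt0P lt_neqAle eq_sym h2 flat0_ge0.
  by rewrite /ball/= ltr_norml; apply/andP; split; lra.
rewrite mulr_gt0 ?flat0_gt0P// prodr_gt0// => j _.
have := H ord0 j; rewrite /ball/= ltr_norml => /andP[h1 h2].
by rewrite mulr_gt0// flat0_gt0P; lra.
Qed.

(** Rational centres and radii [1/(k+1)] suffice. To index by all natural numbers, codes without an
    admissible ball receive the radius -1, whose ball is empty. *)
Lemma open_bigcup_ball (W : set 'rV[R]_d) : open W ->
  exists (a : nat -> 'rV[R]_d) (r : nat -> R),
    (forall k, cball (a k) (r k) `<=` W) /\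
    forall x, W x <-> exists k, ball (a k) (r k) x.
Proof.
move=> oW.
pose c (p : {ffun 'I_d -> rat} * nat) : 'rV[R]_d := \row_i ratr (p.1 i).
pose s (p : {ffun 'I_d -> rat} * nat) : R :=
  if pselect (cball (c p) (p.2.+1%:R^-1) `<=` W) then p.2.+1%:R^-1 else -1.
have sW p : cball (c p) (s p) `<=` W.
  rewrite /s; case: pselect => // _ x /= x1.
  by have := le_trans (normr_ge0 _) x1; rewrite lerNr oppr0 ler10.
pose a k := if unpickle k is Some p then c p else 0.
pose r k := if unpickle k is Some p then s p else -1.
exists a, r; split.
  move=> k; rewrite /a /r; case: unpickle => [p|]; first exact: sW.
  by move=> x /= x1; have := le_trans (normr_ge0 _) x1; rewrite lerNr oppr0 ler10.
move=> x; split=> [Wx|[k xk]]; last first.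
  suff : cball (a k) (r k) x.
    rewrite /a /r; case: unpickle => [p|]; first exact: sW.
    by move=> /= x1; have := le_trans (normr_ge0 _) x1; rewrite lerNr oppr0 ler10.
  by move: xk; rewrite -ball_normE/= distrC => /ltW.
have /nbhs_ballP[e /= e0 eW] : nbhs x W by exact: open_nbhs_nbhs.
have [k ke] : exists k : nat, k.+1%:R^-1 < e / 2.
  exists (Num.truncn (e / 2)^-1).
  rewrite -[ltRHS]invrK ltf_pV2 ?posrE ?invr_gt0 ?divr_gt0 ?ltr0n//.
  exact: truncnS_gt.
have k0 : 0 < k.+1%:R^-1 :> R by rewrite invr_gt0.
have qP i : exists q : rat, `|x ord0 i - ratr q| < k.+1%:R^-1.
  have /rat_in_itvoo[q] : x ord0 i < x ord0 i + k.+1%:R^-1 by rewrite ltrDl.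
  rewrite in_itv/= => /andP[r1 r2]; exists q.
  by rewrite distrC ger0_norm ?subr_ge0 ?(ltW r1)// ltrBlDl.
have [q qE] := choice qP.
pose p : {ffun 'I_d -> rat} * nat := ([ffun i => q i], k).
have xp : ball (c p) (k.+1%:R^-1) x.
  by split => // i j; rewrite (ord1 i) mxE ffunE /ball/= distrC; exact: qE.
exists (pickle p); rewrite /a /r pickleK /s; case: pselect => //; case.
move=> y /= yp; apply: eW; rewrite -ball_normE/=.
rewrite (le_lt_trans (ler_distD (c p) x y))// [ltRHS]splitr ltr_leD//.
  by move: xp; rewrite -ball_normE/= distrC => /lt_trans; exact.
by rewrite distrC (le_trans yp)// ltW.
Qed.

Lemma ae_open_cover (W : set 'rV[R]_d) (P : 'rV[R]_d -> Prop) : open W ->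
  (forall a r, cball a r `<=` W -> {ae leb, forall x, ball a r x -> P x}) ->
  {ae leb, forall x, W x -> P x}.
Proof.
move=> /open_bigcup_ball[a [r [arW WP]]] H.
have /ae_foralln : forall n, {ae leb, forall x, ball (a n) (r n) x -> P x}.
  by move=> n; exact: H.
by apply: filterS => x Hx /WP[k]; exact: Hx.
Qed.

Lemma flat0_natmul_cvg (t : R) : 0 < t -> flat 0 (n%:R * t) @[n --> \oo] --> (1 : R).
Proof.
move=> t0.
have H : expR (- (n.+1%:R * t)^-1) @[n --> \oo] --> (1 : R).
  have E : (1 : R) = expR (- (0 * t^-1)) by rewrite mul0r oppr0 expR0.
  rewrite [X in _ --> X]E.
  apply: continuous_cvg; first exact: continuous_expR.
  apply: cvgN.
  rewrite (_ : (fun _ => _) = (fun n : nat => n.+1%:R^-1 * t^-1)).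
    by apply: cvgMr_tmp; exact: cvg_harmonic.
  by apply/funext => n; rewrite invfM.
rewrite -(cvg_shiftS (fun n => flat 0 (n%:R * t))).
apply: cvg_trans H; apply: near_eq_cvg; near=> n.
by rewrite /flat/= mulr_gt0//= hornerC mul1r.
Unshelve. all: end_near. Qed.

(** Indicators of open sets are bounded limits of smooth functions, so [g] has integral 0 over every
    open subset of the ball. Open sets generate the Borel sets, so the same holds for all of
    these. *)
Lemma ae0_of_smooth_test (g : 'rV[R]_d -> R) a r :
  leb.-integrable (ball a r) (EFin \o g) ->
  (forall phi, smooth phi -> (forall x, ~ ball a r x -> phi x = 0) ->
     \int[leb]_(x in ball a r) (g x * phi x) = 0) ->
  {ae leb, forall x, ball a r x -> g x = 0}.
Proof.
set B : set 'rV[R]_d := ball a r => gi g0.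
have mB : measurable B by apply: open_measurable_rV; exact: ball_open.
pose gB := g \_ B.
have gBi : leb.-integrable setT (EFin \o gB).
  move/(integrable_mkcond _ mB): gi; apply: eq_integrable => // x _.
  by rewrite /gB /= !patchE; case: ifPn.
have mgB : measurable_fun setT gB by apply/measurable_EFinP; case/integrableP: gBi.
have openB A : open A -> (\int[leb]_(x in A) (gB x)%:E = 0)%E.
  move=> oA; have mA := open_measurable_rV oA.
  have oW : open (A `&` B) by apply: openI => //; exact: ball_open.
  have mW := open_measurable_rV oW.
  have [b [s [bsW WP]]] := open_bigcup_ball oW.
  pose psi n x := \sum_(k < n) box_bump (b k) (s k) x.
  (* Where [psi n] is eventually bounded below by a positive number this tends to [flat 0] at
     infinity, which is 1; it stays 0 outside the open set and lies between 0 and 1. *)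
  pose phi n x := flat 0 (n%:R * psi n x).
  have sphi n : smooth (phi n).
    apply: smooth_derseq derseq_flat _; apply: smoothZ; apply: smooth_sum => k.
    exact: smooth_box_bump.
  have psi0 n x : ~ (A `&` B) x -> psi n x = 0.
    move=> Wx; apply: big1 => k _; apply/eqP; rewrite eq_le box_bump_ge0 andbT.
    rewrite leNgt; apply/negP => /box_bump_gt0P H; apply: Wx; apply/WP.
    by exists k.
  have phi0 n x : ~ (A `&` B) x -> phi n x = 0.
    by move=> /(psi0 n) px; rewrite /phi px mulr0 flat_le0.
  have phicv x : phi n x @[n --> \oo] --> (\1_(A `&` B) x : R).
    have [Wx|Wx] := pselect ((A `&` B) x); last first.
      rewrite indicE memNset//; apply: cvg_near_cst; apply: nearW => n.
      exact: phi0.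
    rewrite indicE mem_set//; have [k /box_bump_gt0P xk] := (WP x).1 Wx.
    have := flat0_natmul_cvg xk => cv1.
    apply: (@squeeze_cvgr _ _ _ _ (fun n => flat 0 (n%:R * box_bump (b k) (s k) x)) (cst 1)) => //; last exact: cvg_cst.
    near=> n; rewrite flat0_le1 andbT /phi.
    have mono (u v : R) : u <= v -> flat 0 u <= flat 0 v.
      move=> uv; have [u0|u0] := leP u 0; first by rewrite flat_le0// flat0_ge0.
      rewrite /flat u0 (lt_le_trans u0 uv)/= !hornerC !mul1r ler_expR lerN2.
      by rewrite lef_pV2 ?posrE// (lt_le_trans u0 uv).
    apply: mono; rewrite ler_wpM2l// /psi.
    have kn : (k < n)%N by near: n; exact: nbhs_infty_gt.
    rewrite (bigD1 (Ordinal kn))//= lerDl sumr_ge0// => i _.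
    exact: box_bump_ge0.
  have cphi n := smooth_continuous (sphi n).
  have gphi n x : `|g x * phi n x| <= `|g x|.
    rewrite normrM (ger0_norm (flat0_ge0 _)) -[leRHS]mulr1.
    by rewrite ler_wpM2l// flat0_le1.
  have mg : measurable_fun B g by apply/measurable_EFinP; case/integrableP: gi.
  have mgp n : measurable_fun B (fun x => g x * phi n x).
    apply: measurable_funM => //; apply: measurable_funS (continuous_measurable_rV (cphi n)) => //.
  have gpi n : leb.-integrable B (EFin \o (fun x => g x * phi n x)).
    apply: (le_integrable mB _ _ gi); first exact/measurable_EFinP.
    by move=> x _; rewrite lee_fin.
  have int0 n : (\int[leb]_(x in B) (g x * phi n x)%:E = 0)%E.
    rewrite -(fineK (integrable_fin_num mB (gpi n))).
    have Z : \int[leb]_(x in B) (g x * phi n x) = 0.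
      by apply: g0 => // x Bx; apply: phi0 => -[_]; exact: Bx.
    exact: (congr1 EFin Z).
  have mg1 : measurable_fun B (fun x => (g x * \1_(A `&` B) x)%:E).
    by apply/measurable_EFinP; exact: measurable_funM.
  have [] := @dominated_convergence _ _ _ leb B mB (fun n x => (g x * phi n x)%:E)
    (fun x => (g x * \1_(A `&` B) x)%:E) (EFin \o (Num.norm \o g)).
  - by move=> n; exact/measurable_EFinP.
  - exact: mg1.
  - apply: aeW => x _; apply: cvg_EFin; first exact: nearW.
    by apply: cvgMl_tmp; exact: phicv.
  - by have := integrable_abse gi.
  - by apply: aeW => x n _; rewrite lee_fin gphi.
  move=> _ _; rewrite (_ : [sequence _]_n = cst 0%E); last first.
    by apply/funext => n /=; exact: int0.
  move=> /(cvg_unique _ (cvg_cst _)) H.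
  rewrite [RHS]H//.
  rewrite [LHS]integral_mkcond [in RHS]integral_mkcond; apply: eq_integral => x _.
  rewrite /gB /patch/= indicE in_setI.
  by case: (x \in A); case: (x \in B); rewrite /= ?mulr1 ?mulr0.
(* The positive and negative parts of [gB] define two finite measures that agree on the open sets,
   hence on all Borel sets. *)
pose m1 : {measure set 'rV[R]_d -> \bar R} :=
  density leb (measurable_funrpos mgB) (funrpos_ge0 gB).
pose m2 : {measure set 'rV[R]_d -> \bar R} :=
  density leb (measurable_funrneg mgB) (funrneg_ge0 gB).
have m1fin A : measurable A -> m1 A \is a fin_num.
  move=> mA; apply: integrable_fin_num => //; apply: integrableS (integrable_funrpos measurableT gBi) => //.
have m2fin A : measurable A -> m2 A \is a fin_num.
  move=> mA; apply: integrable_fin_num => //; apply: integrableS (integrable_funrneg measurableT gBi) => //.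
have int12 A : measurable A -> (\int[leb]_(x in A) (gB x)%:E = m1 A - m2 A)%E.
  move=> mA; rewrite integralE; congr (_ - _)%E; apply: eq_integral => x _.
    by rewrite funeposE /funrpos/= EFin_max.
  by rewrite funenegE /funrneg/= EFin_max.
have m12 A : measurable A -> m1 A = m2 A.
  move=> mA.
  have mE : @measurable _ 'rV[R]_d = <<s @open 'rV[R]_d >> by [].
  have MU := @measure_unique _ R 'rV[R]_d (@open 'rV[R]_d) (fun=> setT) mE.
  apply: (MU _ _ _ m1 m2).
  - by move=> ? ?; exact: openI.
  - by move=> ?; exact: openT.
  - by rewrite bigcup_const.
  - move=> A' oA; have mA' := open_measurable_rV oA.
    have := openB _ oA; rewrite int12// => /eqP.
    by rewrite sube_eq ?m1fin// ?fin_num_adde_defl ?m2fin// add0e => /eqP.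
  - by move=> _; have := m1fin _ measurableT; rewrite fin_numE ltey => /andP[].
  - exact: mA.
have := @integral_ae_eq _ _ _ leb setT measurableT (cst 0%E) (EFin \o gB) gBi (measurable_cst _).
have E0 E : E `<=` setT -> measurable E -> (\int[leb]_(x in E) (gB x)%:E = \int[leb]_(x in E) 0)%E.
  by move=> _ mE; rewrite int12// m12// integral0 subee// m2fin.
move=> /(_ E0); apply: filterS => x /(_ I)[+] Bx.
by rewrite /gB patchE mem_set.
Unshelve. all: end_near. Qed.

End box_bumps.

(** * Lp norms and weak derivatives *)

Section Lnorm_facts.
Context d (T : measurableType d) {R : realType} (mu : {measure set T -> \bar R}).
Implicit Types (f g : T -> R) (p q : R).
Local Notation N p f := ('N[mu]_(p%:E)[EFin \o f])%E.

Lemma measurable_powR_norm f p : measurable_fun setT f ->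
  measurable_fun setT (fun x => `|f x| `^ p).
Proof.
move=> mf; apply: (@measurableT_comp _ _ _ _ _ _ (@powR R ^~ p)) => //.
exact: measurableT_comp.
Qed.

Lemma LnormE p f : (N p f = (\int[mu]_x (`|f x| `^ p)%:E) `^ p^-1)%E.
Proof.
by rewrite unlock; congr (_ `^ _)%E; apply: eq_integral => x _; rewrite /= poweR_EFin.
Qed.

Lemma Lnorm_scale p f (a : R) : 0 < p -> measurable_fun setT f ->
  (N p (fun x => (a * f x)%R) = `|a|%:E * N p f)%E.
Proof.
move=> p0 mf; rewrite !LnormE.
under eq_integral do rewrite normrM powRM// EFinM.
rewrite ge0_integralZl//.
- rewrite poweRM ?lee_fin ?powR_ge0 ?integral_ge0//.
  by rewrite poweR_EFin -powRrM mulfV ?gt_eqF// powRr1.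
- exact/measurable_EFinP/measurable_powR_norm.
Qed.

Lemma Lnorm_ae_eq p f g : measurable_fun setT f -> measurable_fun setT g ->
  {ae mu, forall x, f x = g x} -> N p f = N p g.
Proof.
move=> mf mg fg; rewrite !LnormE; congr (_ `^ _)%E.
have /measurable_EFinP mfp := measurable_powR_norm p mf.
have /measurable_EFinP mgp := measurable_powR_norm p mg.
apply: (@ae_eq_integral _ _ _ mu setT _ _ measurableT mfp mgp).
by apply: filterS fg => x /= -> _.
Qed.

Lemma Lnorm_le p f g : 0 < p -> measurable_fun setT f -> measurable_fun setT g ->
  (forall x, `|f x| <= `|g x|) -> (N p f <= N p g)%E.
Proof.
move=> p0 mf mg fg; rewrite !LnormE; apply: gt0_ler_poweR.
- by rewrite invr_ge0 ltW.
- by rewrite in_itv/= leey integral_ge0// => x _; rewrite lee_fin powR_ge0.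
- by rewrite in_itv/= leey integral_ge0// => x _; rewrite lee_fin powR_ge0.
apply: ge0_le_integral => //.
- exact/measurable_EFinP/measurable_powR_norm.
- exact/measurable_EFinP/measurable_powR_norm.
- by move=> x _; rewrite lee_fin ge0_ler_powR ?nnegrE// ltW.
Qed.

Lemma hoelder_integrable p q f g : 0 < p -> 0 < q -> p^-1 + q^-1 = 1 ->
  measurable_fun setT f -> measurable_fun setT g ->
  (N p f < +oo)%E -> (N q g < +oo)%E ->
  mu.-integrable setT (EFin \o (fun x => f x * g x)).
Proof.
move=> p0 q0 pq mf mg fp gq; apply/integrableP; split.
  by apply/measurable_EFinP; exact: measurable_funM.
have := hoelder mu mf mg p0 q0 pq; rewrite Lnorm1 => /le_lt_trans; apply.
by rewrite lte_mul_pinfty ?Lnorm_ge0// ge0_fin_numE// Lnorm_ge0.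
Qed.

Lemma hoelder_Rintegral p q f g : 0 < p -> 0 < q -> p^-1 + q^-1 = 1 ->
  measurable_fun setT f -> measurable_fun setT g ->
  (N p f < +oo)%E -> (N q g < +oo)%E ->
  (`|\int[mu]_x (f x * g x)|%:E <= N p f * N q g)%E.
Proof.
move=> p0 q0 pq mf mg fp gq.
have fg := hoelder_integrable p0 q0 pq mf mg fp gq.
apply: le_trans (hoelder mu mf mg p0 q0 pq); rewrite Lnorm1.
by rewrite EFin_normr_Rintegral//; apply: le_abse_integral => //; case/integrableP: fg.
Qed.

(** The Hoelder inequality with exponent [q / p] for [|f|^p] and the indicator of [D]; the constant
    depends on [D] only. *)
Lemma Lnorm_embedding p q (D : set T) : 0 < p -> p < q -> measurable D ->
  (mu D < +oo)%E ->
  exists2 C : R, 0 <= C & forall f, measurable_fun setT f -> (forall x, ~ D x -> f x = 0) ->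
    (N p f <= C%:E * N q f)%E.
Proof.
move=> p0 pq mD Doo; have q0 := lt_trans p0 pq.
pose r := q / p; pose s := (1 - r^-1)^-1.
have r1 : 1 < r by rewrite /r ltr_pdivlMr// mul1r.
have r0 : 0 < r by rewrite (lt_trans ltr01).
have s0 : 0 < s by rewrite invr_gt0 subr_gt0 invf_lt1.
have rs : r^-1 + s^-1 = 1 by rewrite invrK subrKC.
have N1oo : (N s (\1_D) < +oo)%E.
  rewrite LnormE poweR_lty// (@le_lt_trans _ _ (mu D))//.
  have -> : mu D = (\int[mu]_x (\1_D x)%:E)%E by rewrite integral_indic// setIT.
  apply: ge0_le_integral => //.
  - by apply/measurable_EFinP/measurable_powR_norm.
  - by apply/measurable_EFinP; exact: measurable_indic.
  - move=> x _; rewrite lee_fin indicE; case: (_ \in _); first by rewrite normr1 powR1.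
    by rewrite normr0 powR0// gt_eqF.
pose K := (N s (\1_D : T -> R) `^ p^-1)%E.
have Kfin : K \is a fin_num.
  by rewrite fin_num_poweR// ge0_fin_numE ?Lnorm_ge0.
exists (fine K); first by rewrite fine_ge0// poweR_ge0.
move=> f mf f0; rewrite (fineK Kfin).
have mfp := measurable_powR_norm p mf.
have := @hoelder _ _ _ mu (fun x => `|f x| `^ p) (\1_D) r s mfp (measurable_indic mD) r0 s0 rs.
rewrite Lnorm1 [in leLHS](_ : (fun x => _) = (fun x => (`|f x| `^ p)%:E)); last first.
  apply/funext => x /=; rewrite indicE.
  have [xD|xD] := boolP (x \in D); first by rewrite mulr1 ger0_norm ?powR_ge0.
  by rewrite f0 ?normr0 ?powR0 ?mul0r ?normr0 ?gt_eqF//; move: xD; rewrite notin_setE.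
move=> H; have p'0 : 0 <= p^-1 by rewrite invr_ge0 ltW.
have I0 : (0 <= \int[mu]_x (`|f x| `^ p)%:E)%E.
  by apply: integral_ge0 => x _; rewrite lee_fin powR_ge0.
rewrite [leLHS]LnormE.
have := gt0_ler_poweR p'0 _ _ H.
rewrite !in_itv/= !leey !andbT => /(_ I0).
rewrite mule_ge0 ?Lnorm_ge0// => /(_ isT) /le_trans; apply.
rewrite poweRM ?Lnorm_ge0// -/K muleC lee_wpmul2l ?poweR_ge0//.
rewrite !LnormE -poweRrM (_ : r^-1 * p^-1 = q^-1); last first.
  by rewrite /r invf_div; field; rewrite !gt_eqF.
rewrite le_eqVlt; apply/orP; left.
apply/eqP; congr (_ `^ _)%E; apply: eq_integral => x _; congr EFin.
rewrite norm_powR// normr_id -powRrM (_ : p * r = q)//.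
by rewrite /r; field; rewrite gt_eqF.
Qed.

End Lnorm_facts.

(** * Weak derivatives on an open set *)

Section weak_derivatives.
Context {R : realType} {d : nat}.
Local Notation leb := (@lebesgue_rV R d).
Local Notation cball a r := [set x : 'rV[R]_d | (`|x - a| <= r)%R].
Variables (Om : set 'rV[R]_d) (oOm : open Om).
Implicit Types (v w g phi f : 'rV[R]_d -> R) (p : R) (i : 'I_d).

Let mOm : measurable Om := open_measurable_rV oOm.

Lemma compact_measurable_rV (K : set 'rV[R]_d) : compact K -> measurable K.
Proof.
by move=> cK; apply: closed_measurable_rV; apply: compact_closed => //; exact: norm_hausdorff.
Qed.

Lemma compact_sub_cball (K : set 'rV[R]_d) : compact K ->
  exists2 r, 0 <= r & K `<=` cball 0 r.
Proof.
move=> /compact_bounded[M [_ HM]]; exists (`|M| + 1); first by rewrite addr_ge0.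
move=> x Kx /=; rewrite subr0; apply: (HM (`|M| + 1)) => //.
by rewrite ltr_pwDr// ler_norm.
Qed.

Lemma test_functionP phi : test_function Om phi ->
  smooth phi /\ exists K, [/\ compact K, K `<=` Om, forall x, ~ K x -> phi x = 0 &
    forall (u x : 'rV[R]_d), ~ K x -> 'D_u phi x = 0].
Proof.
move=> [sphi [K [cK KOm K0]]]; split => //; exists K; split => // u x Kx.
apply: (@derive_val _ _ _ _ _ _ _ (derive_near0 u _)).
have oKC : open (~` K).
  by apply: closed_openC; apply: compact_closed => //; exact: norm_hausdorff.
have : nbhs x (~` K) by exact: open_nbhs_nbhs.
by apply: filterS => y Ky; exact: K0.
Qed.

Lemma test_function_derive phi (u : 'rV[R]_d) : test_function Om phi ->
  test_function Om ('D_u phi).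
Proof.
move=> /test_functionP[sphi [K [cK KOm _ K0]]]; split; first exact: smooth_derive.
by exists K; split => // x; exact: K0.
Qed.

Lemma loc_integrable_mul_support v phi (K : set 'rV[R]_d) : loc_integrable Om v ->
  continuous phi -> compact K -> K `<=` Om -> (forall x, ~ K x -> phi x = 0) ->
  leb.-integrable Om (EFin \o (fun x => v x * phi x)).
Proof.
move=> [mv vi] cphi cK KOm phi0; have mK := compact_measurable_rV cK.
have i1 : leb.-integrable K (EFin \o (fun x => v x * phi x)).
  have := @integrableMl _ _ _ leb K mK (EFin \o v) phi (vi K cK KOm).
  rewrite (_ : ((EFin \o v) \* (EFin \o phi))%E = EFin \o (fun x => v x * phi x)%R); last first.
    by apply/funext => x; rewrite /= EFinM.
  apply; first by apply: measurable_funS (continuous_measurable_rV cphi).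
  have [r r0 Kr] := compact_sub_cball cK.
  have [M M0 HM] := continuous_bounded_cball 0 r cphi.
  exists M; split; first by rewrite num_real.
  by move=> M' MM' x Kx /=; rewrite (le_trans (HM _ (Kr _ Kx)))// ltW.
apply/(integrable_mkcond _ mOm); move/(integrable_mkcond _ mK): i1.
apply: eq_integrable => // x _; rewrite /patch.
have [xK|xK] := boolP (x \in K).
  by rewrite mem_set//; apply: KOm; exact: set_mem.
case: ifPn => // _; rewrite /= phi0 ?mulr0//.
by move=> Kx; move: xK; rewrite mem_set.
Qed.

Lemma loc_integrable_mul_test v phi : loc_integrable Om v -> test_function Om phi ->
  leb.-integrable Om (EFin \o (fun x => v x * phi x)).
Proof.
move=> lv /test_functionP[sphi [K [cK KOm K0 _]]].
exact: (loc_integrable_mul_support lv (smooth_continuous sphi) cK).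
Qed.

Lemma Rintegral_Om_support f : (forall x, ~ Om x -> f x = 0) ->
  \int[leb]_(x in Om) f x = \int[leb]_x f x.
Proof.
move=> f0; rewrite Rintegral_mkcond; apply: eq_Rintegral => x _.
rewrite patchE; case: ifPn => // xOm; rewrite f0//; by move: xOm; rewrite notin_setE.
Qed.

(** The fundamental lemma is local: it is applied on the balls whose closed versions lie in [Om],
    where the candidates are integrable, and countably many of these cover [Om]. *)
Lemma is_weak_partial_unique i v g1 g2 :
  is_weak_partial Om i v g1 -> is_weak_partial Om i v g2 ->
  {ae leb, forall x, Om x -> g1 x = g2 x}.
Proof.
move=> [lv lg1 H1] [_ lg2 H2]; apply: ae_open_cover => // a r arOm.
have mB : measurable (ball a r) by apply: open_measurable_rV; exact: ball_open.
have Bc : ball a r `<=` cball a r.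
  by move=> x; rewrite -ball_normE/= distrC => /ltW.
have BOm := subset_trans Bc arOm.
have li g : loc_integrable Om g -> leb.-integrable (ball a r) (EFin \o g).
  move=> [_ /(_ _ (@compact_cball _ _ a r) arOm)]; apply: integrableS => //.
  exact: measurable_cball.
suff : {ae leb, forall x, ball a r x -> g1 x - g2 x = 0}.
  by apply: filterS => x H /H/eqP; rewrite subr_eq0 => /eqP.
apply: ae0_of_smooth_test.
  have := integrableB mB (li _ lg1) (li _ lg2).
  by apply: eq_integrable => // x _; rewrite /= EFinB.
move=> phi sphi phi0.
have tphi : test_function Om phi.
  by apply: (@test_function_cball _ _ _ _ a r) => // x xr; apply: phi0 => /Bc /=; rewrite leNgt xr.
have := loc_integrable_mul_test lg1 tphi => i1.
have := loc_integrable_mul_test lg2 tphi => i2.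
transitivity (\int[leb]_(x in Om) (g1 x * phi x - g2 x * phi x)).
  rewrite Rintegral_mkcond [RHS]Rintegral_mkcond; apply: eq_Rintegral => x _.
  rewrite !patchE -mulrBl; case: ifPn => xB.
    by rewrite mem_set//; apply: BOm; exact: set_mem.
  by case: ifPn => // _; rewrite phi0 ?mulr0//; move: xB; rewrite notin_setE.
by rewrite RintegralB//; apply/eqP; rewrite subr_eq0 -eqr_opp -H1// -H2.
Qed.

Lemma loc_integrable_continuous f : continuous f -> loc_integrable Om f.
Proof.
move=> cf; split; first by apply: measurable_funS (continuous_measurable_rV cf).
move=> K cK KOm; apply: measurable_bounded_integrable.
- exact: compact_measurable_rV.
- have [r _ Kr] := compact_sub_cball cK.
  apply: (le_lt_trans _ (lebesgue_cball_lty 0 r)).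
  apply: le_measure => //; rewrite inE; [exact: compact_measurable_rV|exact: measurable_cball].
- by apply: measurable_funS (continuous_measurable_rV cf).
- have [r r0 Kr] := compact_sub_cball cK.
  have [M M0 HM] := continuous_bounded_cball 0 r cf.
  exists M; split; first by rewrite num_real.
  by move=> M' MM' x Kx /=; rewrite (le_trans (HM _ (Kr _ Kx)))// ltW.
Qed.

Lemma is_weak_partial_smooth i f : smooth f -> is_weak_partial Om i f (partial i f).
Proof.
move=> sf; split; [exact/loc_integrable_continuous/smooth_continuous|
  exact/loc_integrable_continuous/smooth_continuous/smooth_derive|].
move=> phi /test_functionP[sphi [K [cK KOm K0 dK0]]].
have [r r0 Kr] := compact_sub_cball cK.
have p0 x : r < `|x - 0| -> phi x = 0.
  by move=> xr; apply: K0 => /Kr /=; rewrite leNgt xr.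
have [_ _] := @Rintegral_by_parts _ _ setT f phi (delta_mx ord0 i) 0 r openT
  (@subsetT _ _) (@smooth_C1_on _ _ setT _ _ sf) sphi p0.
rewrite !Rintegral_Om_support//.
- by move=> x Omx; rewrite K0 ?mulr0// => /KOm.
- by move=> x Omx; rewrite /partial dK0 ?mulr0// => /KOm.
Qed.

Lemma is_weak_partial_lin i (a : R) v w g h :
  is_weak_partial Om i v g -> is_weak_partial Om i w h ->
  is_weak_partial Om i (fun x => a * v x + w x) (fun x => a * g x + h x).
Proof.
move=> [lv lg Hv] [lw lh Hw].
have loc (f1 f2 : 'rV[R]_d -> R) : loc_integrable Om f1 -> loc_integrable Om f2 ->
    loc_integrable Om (fun x => a * f1 x + f2 x).
  move=> [m1 i1] [m2 i2]; split.
    by apply: measurable_funD => //; exact: measurable_funM.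
  move=> K cK KOm; have mK := compact_measurable_rV cK.
  have := integrableD mK (integrableZl mK a (i1 K cK KOm)) (i2 K cK KOm).
  by apply: eq_integrable => // x _; rewrite /= EFinD EFinM.
split; [exact: loc|exact: loc|] => phi tphi.
have tdphi := test_function_derive (delta_mx ord0 i) tphi.
have E (f1 f2 psi : 'rV[R]_d -> R) : loc_integrable Om f1 -> loc_integrable Om f2 ->
    test_function Om psi -> \int[leb]_(x in Om) ((a * f1 x + f2 x) * psi x) =
    a * \int[leb]_(x in Om) (f1 x * psi x) + \int[leb]_(x in Om) (f2 x * psi x).
  move=> l1 l2 tpsi.
  have i1 := loc_integrable_mul_test l1 tpsi.
  have i2 := loc_integrable_mul_test l2 tpsi.
  rewrite -RintegralZl// -RintegralD//.
    by apply: eq_Rintegral => x _; rewrite mulrDl mulrA.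
  have := integrableZl mOm a i1.
  by apply: eq_integrable => // x _; rewrite /= EFinM.
by rewrite !E// Hv// Hw//; rewrite mulrN opprD.
Qed.

Lemma is_weak_partial_weak_partial i v g : is_weak_partial Om i v g ->
  is_weak_partial Om i v (weak_partial Om i v).
Proof. by move=> H; rewrite /weak_partial; apply: (@xgetPex _ (cst 0) [set g0 | is_weak_partial Om i v g0]); exists g. Qed.

Lemma weak_partial_ae i v g : is_weak_partial Om i v g ->
  {ae leb, forall x, Om x -> weak_partial Om i v x = g x}.
Proof.
by move=> H; apply: is_weak_partial_unique (is_weak_partial_weak_partial H) H.
Qed.

End weak_derivatives.

(** * Sobolev spaces *)

Section sobolev_spaces.
Context {R : realType} {d : nat}.
Local Notation leb := (@lebesgue_rV R d).
Local Notation cball a r := [set x : 'rV[R]_d | (`|x - a| <= r)%R].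
Variables (Om : set 'rV[R]_d) (oOm : open Om).
Implicit Types (v w g phi f : 'rV[R]_d -> R) (p q : R) (i : 'I_d).

Let mOm : measurable Om := open_measurable_rV oOm.

Let restrict_lin (a : R) v w :
  (fun x => a * v x + w x) \_ Om = fun x => a * (v \_ Om) x + (w \_ Om) x.
Proof.
by apply/funext => x; rewrite !patchE; case: ifPn => // _; rewrite /= mulr0 addr0.
Qed.

Lemma in_LpP p v : in_Lp Om p v <->
  measurable_fun setT (v \_ Om) /\ (Lp_norm Om p v < +oo)%E.
Proof.
rewrite /in_Lp; split=> [|[mv vp]].
  by move=> /andP[mv vp]; split; [move: mv|move: vp]; rewrite inE.
by rewrite inE; apply/andP; split; rewrite inE.
Qed.

Lemma Lp_norm_ge0 p v : (0 <= Lp_norm Om p v)%E.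
Proof. exact: Lnorm_ge0. Qed.

Lemma in_Lp_fin_num p v : in_Lp Om p v -> Lp_norm Om p v \is a fin_num.
Proof. by move=> /in_LpP[_ vp]; rewrite ge0_fin_numE// Lp_norm_ge0. Qed.

Lemma measurable_fun_restrict v : measurable_fun Om v ->
  measurable_fun setT (v \_ Om).
Proof. by move=> mv; apply/(measurable_restrictT _ mOm). Qed.

Lemma in_Lp_measurable p v : in_Lp Om p v -> measurable_fun Om v.
Proof. by move=> /in_LpP[/(measurable_restrictT _ mOm)]. Qed.

Lemma Lp_norm_lin p (a : R) v w : 1 <= p ->
  measurable_fun Om v -> measurable_fun Om w ->
  (Lp_norm Om p (fun x => a * v x + w x)%R <=
   `|a|%:E * Lp_norm Om p v + Lp_norm Om p w)%E.
Proof.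
move=> p1 mv mw; have p0 : 0 < p by rewrite (lt_le_trans ltr01).
have mv' := measurable_fun_restrict mv; have mw' := measurable_fun_restrict mw.
rewrite /Lp_norm restrict_lin -Lnorm_scale//.
by apply: (@minkowski_EFin _ _ _ leb (fun x => a * (v \_ Om) x)) => //; exact: measurable_funM.
Qed.

Lemma in_Lp_lin p (a : R) v w : 1 <= p -> in_Lp Om p v -> in_Lp Om p w ->
  in_Lp Om p (fun x => a * v x + w x).
Proof.
move=> p1 hv hw; have [mv vp] := (in_LpP p v).1 hv; have [mw wp] := (in_LpP p w).1 hw.
apply/in_LpP; split.
  by rewrite restrict_lin; apply: measurable_funD => //; exact: measurable_funM.
apply: (le_lt_trans (Lp_norm_lin a p1 (in_Lp_measurable hv) (in_Lp_measurable hw))).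
rewrite lte_add_pinfty// -ge0_fin_numE ?mule_ge0 ?Lp_norm_ge0//.
by rewrite fin_numM// in_Lp_fin_num.
Qed.

Lemma Lp_norm_ae p v w : measurable_fun Om v -> measurable_fun Om w ->
  {ae leb, forall x, Om x -> v x = w x} -> Lp_norm Om p v = Lp_norm Om p w.
Proof.
move=> /measurable_fun_restrict mv /measurable_fun_restrict mw vw.
apply: Lnorm_ae_eq => //; apply: filterS vw => x H; rewrite !patchE.
by case: ifPn => // /set_mem /H.
Qed.

Lemma in_Lp_ae p v w : measurable_fun Om w -> {ae leb, forall x, Om x -> v x = w x} ->
  in_Lp Om p v -> in_Lp Om p w.
Proof.
move=> mw vw hv; have [mv vp] := (in_LpP p v).1 hv; apply/in_LpP; split.
  exact: measurable_fun_restrict.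
by rewrite -(Lp_norm_ae p (in_Lp_measurable hv) mw vw).
Qed.

Lemma hoelder_Om p q v w : 0 < p -> 0 < q -> p^-1 + q^-1 = 1 ->
  in_Lp Om p v -> in_Lp Om q w ->
  leb.-integrable Om (EFin \o (fun x => v x * w x)) /\
  (`|\int[leb]_(x in Om) (v x * w x)|%:E <= Lp_norm Om p v * Lp_norm Om q w)%E.
Proof.
move=> p0 q0 pq /in_LpP[mv vp] /in_LpP[mw wq].
have E : (fun x => (v \_ Om) x * (w \_ Om) x) = (fun x => v x * w x) \_ Om.
  by apply/funext => x; rewrite !patchE; case: ifPn => //; rewrite /= mulr0.
split.
  apply/(integrable_mkcond _ mOm).
  have := hoelder_integrable p0 q0 pq mv mw vp wq; rewrite E.
  by apply: eq_integrable => // x _; rewrite /= !patchE; case: ifPn.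
by have := hoelder_Rintegral p0 q0 pq mv mw vp wq; rewrite E -Rintegral_mkcond.
Qed.

Lemma compact_support_Lnorm f a (r : R) p : 0 < p -> continuous f ->
  (forall x, r < `|x - a| -> f x = 0) -> ('N[leb]_(p%:E)[EFin \o f] < +oo)%E.
Proof.
move=> p0 cf f0; rewrite LnormE poweR_lty//.
have [M M0 HM] := compact_support_bounded cf f0.
have mf := continuous_measurable_rV cf.
have : leb.-integrable setT (EFin \o (fun x => `|f x| `^ p)).
  apply: (@bounded_support_integrable _ _ _ (M `^ p) a r).
  - apply: (@measurableT_comp _ _ _ _ _ _ (@powR R ^~ p)) => //.
    exact: measurableT_comp.
  - by move=> x; rewrite ger0_norm ?powR_ge0// ge0_ler_powR ?nnegrE// ltW.
  - by move=> x /f0 ->; rewrite normr0 powR0// gt_eqF.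
move=> /integrableP[_]; apply: le_lt_trans; apply: ge0_le_integral => //.
- exact/measurable_EFinP/measurable_powR_norm.
- by apply: measurableT_comp => //; exact/measurable_EFinP/measurable_powR_norm.
- by move=> x _; rewrite lee_fin ler_norm.
Qed.

Lemma in_Lp_test p phi : 0 < p -> test_function Om phi -> in_Lp Om p phi.
Proof.
move=> p0 /test_functionP[sphi [K [cK KOm K0 _]]].
have cphi := smooth_continuous sphi.
have E : phi \_ Om = phi.
  apply/funext => x; rewrite patchE; case: ifPn => //; rewrite notin_setE => xOm.
  by rewrite K0// => /KOm.
have [r r0 Kr] := compact_sub_cball cK.
apply/in_LpP; rewrite /Lp_norm E; split; first exact: continuous_measurable_rV.
apply: (@compact_support_Lnorm _ 0 r) => // x xr; apply: K0 => /Kr /=.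
by rewrite leNgt xr.
Qed.

Lemma in_Lp_loc_integrable p v : 1 < p -> in_Lp Om p v -> loc_integrable Om v.
Proof.
move=> p1 hv; split; first exact: in_Lp_measurable hv.
move=> K cK KOm; have mK := compact_measurable_rV cK.
have p0 : 0 < p by rewrite (lt_trans ltr01).
pose q := (1 - p^-1)^-1.
have q0 : 0 < q by rewrite invr_gt0 subr_gt0 invf_lt1.
have pq : p^-1 + q^-1 = 1 by rewrite invrK subrKC.
have h1 : in_Lp Om q (\1_K).
  apply/in_LpP.
  have E : (\1_K : 'rV[R]_d -> R) \_ Om = \1_K.
    apply/funext => x; rewrite patchE; case: ifPn => //; rewrite notin_setE => xOm.
    by rewrite indicE memNset// => /KOm.
  rewrite /Lp_norm E; split; first exact: measurable_indic.
  rewrite LnormE poweR_lty// (@le_lt_trans _ _ (leb K))//.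
    have -> : leb K = (\int[leb]_x (\1_K x)%:E)%E by rewrite integral_indic// setIT.
    apply: ge0_le_integral => //.
    - by apply/measurable_EFinP/measurable_powR_norm.
    - by apply/measurable_EFinP.
    - move=> x _; rewrite lee_fin indicE; case: (_ \in _); first by rewrite normr1 powR1.
      by rewrite normr0 powR0// gt_eqF.
  have [r r0 Kr] := compact_sub_cball cK.
  apply: (le_lt_trans _ (lebesgue_cball_lty (0 : 'rV[R]_d) r)).
  by apply: le_measure; rewrite ?inE//; exact: measurable_cball.
have [i1 _] := hoelder_Om p0 q0 pq hv h1.
have := integrableS mOm mK KOm i1; apply: eq_integrable => // x xK.
by rewrite /= indicE xK mulr1.
Qed.

Lemma in_W1p_weak_partial p v i : in_W1p Om p v ->
  is_weak_partial Om i v (weak_partial Om i v) /\ in_Lp Om p (weak_partial Om i v).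
Proof.
move=> [_ /(_ i)[g wg gp]]; have H := is_weak_partial_weak_partial wg.
split => //; apply: in_Lp_ae gp; first by have [_ []] := H.
by have := weak_partial_ae oOm wg; apply: filterS => x E /E.
Qed.

Lemma Lp_norm_weak_partial p v g i : is_weak_partial Om i v g ->
  Lp_norm Om p (weak_partial Om i v) = Lp_norm Om p g.
Proof.
move=> wg; have [_ [m1 _] _] := is_weak_partial_weak_partial wg.
have [_ [m2 _] _] := wg.
by apply: Lp_norm_ae => //; exact: weak_partial_ae wg.
Qed.

Lemma W1p_norm_ge0 p v : (0 <= W1p_norm Om p v)%E.
Proof. by rewrite adde_ge0 ?Lp_norm_ge0// sume_ge0// => i _; exact: Lp_norm_ge0. Qed.

Lemma Lp_le_W1p_norm p v : (Lp_norm Om p v <= W1p_norm Om p v)%E.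
Proof. by rewrite leeDl// sume_ge0// => i _; exact: Lp_norm_ge0. Qed.

Lemma Lp_weak_partial_le_W1p_norm p v i :
  (Lp_norm Om p (weak_partial Om i v) <= W1p_norm Om p v)%E.
Proof.
rewrite /W1p_norm (bigD1 i)//= addeCA leeDl// adde_ge0 ?Lp_norm_ge0//.
by rewrite sume_ge0// => j _; exact: Lp_norm_ge0.
Qed.

Lemma W1p_norm_fin_num p v : in_W1p Om p v -> W1p_norm Om p v \is a fin_num.
Proof.
move=> hv; rewrite /W1p_norm fin_numD in_Lp_fin_num; last by have [] := hv.
rewrite /=.
apply/sum_fin_numP => i _ _; apply: in_Lp_fin_num.
by have [] := in_W1p_weak_partial i hv.
Qed.

Lemma in_W1p_test p phi : 0 < p -> test_function Om phi -> in_W1p Om p phi.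
Proof.
move=> p0 tphi; split; first exact: in_Lp_test.
move=> i; exists (partial i phi); first by apply: is_weak_partial_smooth => //; have [] := tphi.
by apply: in_Lp_test => //; exact: test_function_derive.
Qed.

Lemma in_W1p_lin p (a : R) v w : 1 <= p -> in_W1p Om p v -> in_W1p Om p w ->
  in_W1p Om p (fun x => a * v x + w x).
Proof.
move=> p1 hv hw; split; first by apply: in_Lp_lin => //; [have [] := hv|have [] := hw].
move=> i; have [w1 l1] := in_W1p_weak_partial i hv.
have [w2 l2] := in_W1p_weak_partial i hw.
exists (fun x => a * weak_partial Om i v x + weak_partial Om i w x).
  exact: is_weak_partial_lin.
exact: in_Lp_lin.
Qed.

Lemma W1p_norm_lin p (a : R) v w : 1 <= p -> in_W1p Om p v -> in_W1p Om p w ->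
  (W1p_norm Om p (fun x => a * v x + w x)%R <=
   `|a|%:E * W1p_norm Om p v + W1p_norm Om p w)%E.
Proof.
move=> p1 hv hw; rewrite /W1p_norm.
rewrite ge0_muleDr ?Lp_norm_ge0//; last by rewrite sume_ge0// => i _; exact: Lp_norm_ge0.
rewrite addeACA leeD//.
  by apply: Lp_norm_lin => //; [have [/in_Lp_measurable] := hv|have [/in_Lp_measurable] := hw].
rewrite ge0_sume_distrr => [|i _]; last exact: Lp_norm_ge0.
rewrite -big_split/=; apply: lee_sum => i _.
have [w1 l1] := in_W1p_weak_partial i hv.
have [w2 l2] := in_W1p_weak_partial i hw.
rewrite (Lp_norm_weak_partial p (is_weak_partial_lin oOm a w1 w2)).
by apply: Lp_norm_lin => //; [exact: in_Lp_measurable l1|exact: in_Lp_measurable l2].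
Qed.

Lemma Lp_norm0 p : 0 < p -> Lp_norm Om p (cst 0) = 0%E.
Proof.
move=> p0; rewrite /Lp_norm (_ : EFin \o _ = cst 0%E) ?Lnorm0 ?eqe ?gt_eqF//.
by apply/funext => x; rewrite /= patchE; case: ifPn.
Qed.

Lemma W1p_norm0 p : 0 < p -> W1p_norm Om p (cst 0) = 0%E.
Proof.
move=> p0; rewrite /W1p_norm Lp_norm0// add0e big1// => i _.
rewrite (Lp_norm_weak_partial p (is_weak_partial_smooth Om i (smooth_cst 0))).
rewrite (_ : partial i _ = cst 0) ?Lp_norm0//.
by apply/funext => x; exact: derive_cst.
Qed.

Lemma in_W1p0_test p phi : 0 < p -> test_function Om phi -> in_W1p0 Om p phi.
Proof.
move=> p0 tphi; split; first exact: in_W1p_test.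
move=> e e0; exists phi => //.
rewrite (_ : (phi \- phi)%R = cst 0) ?W1p_norm0 ?lte_fin//.
by apply/funext => x /=; rewrite subrr.
Qed.

Lemma test_function_lin (a : R) phi f : test_function Om phi -> test_function Om f ->
  test_function Om (fun x => a * phi x + f x).
Proof.
move=> [s1 [K1 [c1 k1 z1]]] [s2 [K2 [c2 k2 z2]]]; split.
  by apply: smoothD => //; exact: smoothZ.
exists (K1 `|` K2); split; first exact: compactU.
  by move=> x [/k1|/k2].
by move=> x xK; rewrite z1 ?z2 ?mulr0 ?addr0// => ?; apply: xK; [right|left].
Qed.

Lemma in_W1p0_lin p (a : R) v w : 1 <= p -> in_W1p0 Om p v -> in_W1p0 Om p w ->
  in_W1p0 Om p (fun x => a * v x + w x).
Proof.
move=> p1 [hv av] [hw aw]; have p0 : 0 < p by rewrite (lt_le_trans ltr01).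
split; first exact: in_W1p_lin.
move=> e e0; pose e1 := e / 2 / (`|a| + 1).
have a1 : 0 < `|a| + 1 by rewrite ltr_wpDl.
have e10 : 0 < e1 by rewrite !divr_gt0.
have [phi tphi Hphi] := av _ e10.
have [psi tpsi Hpsi] := aw _ (divr_gt0 e0 (ltr0n _ 2)).
exists (fun x => a * phi x + psi x); first exact: test_function_lin.
have sub u f0 : in_W1p Om p u -> test_function Om f0 -> in_W1p Om p (u \- f0)%R.
  move=> hu tf; rewrite (_ : (u \- f0)%R = fun x => -1 * f0 x + u x).
    by apply: in_W1p_lin => //; exact: in_W1p_test.
  by apply/funext => x /=; rewrite mulN1r addrC.
rewrite (_ : (_ \- _)%R = fun x => a * (v \- phi)%R x + (w \- psi)%R x); last first.
  by apply/funext => x /=; ring.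
apply: (le_lt_trans (W1p_norm_lin a p1 (sub _ _ hv tphi) (sub _ _ hw tpsi))).
have f1 := W1p_norm_fin_num (sub _ _ hv tphi).
have f2 := W1p_norm_fin_num (sub _ _ hw tpsi).
move: Hphi Hpsi; rewrite -(fineK f1) -(fineK f2) !lte_fin => H1 H2.
have h1 : `|a| * fine (W1p_norm Om p (v \- phi)%R) <= `|a| * e1 by rewrite ler_wpM2l// ltW.
have h2 : `|a| * e1 <= e / 2.
  rewrite /e1 mulrCA -[leRHS]mulr1 ler_wpM2l ?divr_ge0 ?(ltW e0)//.
  by rewrite ler_pdivrMr// mul1r lerDl.
by rewrite [ltRHS]splitr ler_ltD// (le_trans h1).
Qed.

Section pairing.
Variables (p q : R).
Hypotheses (p1 : 1 < p) (q1 : 1 < q) (pq : p^-1 + q^-1 = 1).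
Let p0 : 0 < p := lt_trans ltr01 p1.
Let q0 : 0 < q := lt_trans ltr01 q1.

(** Weak derivatives are closed under limits, because both sides of the defining identity are
    continuous in [L^p] by Hoelder. This identifies the gradient of the singular state of a point
    source. *)
Lemma is_weak_partial_lim i (V G : nat -> 'rV[R]_d -> R) v g :
  (forall n, is_weak_partial Om i (V n) (G n)) ->
  (forall n, in_Lp Om p (V n)) -> (forall n, in_Lp Om p (G n)) ->
  in_Lp Om p v -> in_Lp Om p g ->
  (forall e, 0 < e -> exists n, (Lp_norm Om p (fun x => v x - V n x)%R < e%:E)%E /\
     (Lp_norm Om p (fun x => g x - G n x)%R < e%:E)%E) ->
  is_weak_partial Om i v g.
Proof.
move=> wVG LV LG Lv Lg H.
split; [exact: in_Lp_loc_integrable Lv|exact: in_Lp_loc_integrable Lg|] => phi tphi.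
have tdphi := test_function_derive (delta_mx ord0 i) tphi.
have Lphi := in_Lp_test q0 tphi; have Ldphi := in_Lp_test q0 tdphi.
set A := fine (Lp_norm Om q phi); set B := fine (Lp_norm Om q (partial i phi)).
have A0 : 0 <= A by rewrite fine_ge0// Lp_norm_ge0.
have B0 : 0 <= B by rewrite fine_ge0// Lp_norm_ge0.
have int u f0 : in_Lp Om p u -> in_Lp Om q f0 ->
    leb.-integrable Om (EFin \o (fun x => u x * f0 x)).
  by move=> hu hf; have [] := hoelder_Om p0 q0 pq hu hf.
have diff u U f0 (e : R) : in_Lp Om p u -> in_Lp Om p U -> in_Lp Om q f0 ->
    (Lp_norm Om p (fun x => u x - U x)%R < e%:E)%E ->
    `|\int[leb]_(x in Om) (u x * f0 x) - \int[leb]_(x in Om) (U x * f0 x)| <=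
    e * fine (Lp_norm Om q f0).
  move=> hu hU hf ue.
  have hd : in_Lp Om p (fun x => u x - U x).
    rewrite (_ : (fun _ => _) = fun x => -1 * U x + u x); first by apply: in_Lp_lin => //; exact: ltW.
    by apply/funext => x; rewrite mulN1r addrC.
  rewrite -RintegralB//; [|exact: int..].
  under eq_Rintegral do rewrite -mulrBl.
  have [_ Hh] := hoelder_Om p0 q0 pq hd hf.
  rewrite -lee_fin (le_trans Hh)// EFinM fineK ?in_Lp_fin_num// lee_wpmul2r ?Lp_norm_ge0//.
  exact: ltW.
apply/eqP; rewrite -subr_eq0 opprK -normr_eq0 eq_le normr_ge0 andbT.
apply/ler_addgt0Pr => e e0; rewrite add0r.
have e' : 0 < e / (A + B + 1) by rewrite divr_gt0// ltr_wpDl// addr_ge0.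
have [n [H1 H2]] := H _ e'.
have D1 := diff _ _ _ _ Lv (LV n) Ldphi H1.
have D2 := diff _ _ _ _ Lg (LG n) Lphi H2.
have [_ _ /(_ _ tphi) E] := wVG n.
set x1 := (X in X + _); set x2 := (X in _ + X).
move: D1 D2; rewrite -/x1 -/x2 E opprK -/A -/B.
set y := (X in x1 + X) => D1 D2.
rewrite (_ : x1 + x2 = (x1 + y) + (x2 - y)); last by rewrite addrACA subrr addr0.
rewrite (le_trans (ler_normD _ _))// (le_trans (lerD D1 D2))//.
rewrite -mulrDr (addrC B A) -mulrA ler_piMr ?(ltW e0)//.
by rewrite mulrC ler_pdivrMr ?mul1r ?lerDl// ltr_wpDl// addr_ge0.
Qed.

Lemma grad_pairing_integrable y v i : in_W1p Om p y -> in_W1p Om q v ->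
  leb.-integrable Om (EFin \o (fun x => weak_partial Om i y x * weak_partial Om i v x)).
Proof.
move=> hy hv; have [_ l1] := in_W1p_weak_partial i hy.
have [_ l2] := in_W1p_weak_partial i hv.
by have [] := hoelder_Om p0 q0 pq l1 l2.
Qed.

Lemma grad_pairingE y v : in_W1p Om p y -> in_W1p Om q v ->
  grad_pairing Om y v =
  \sum_(i < d) \int[leb]_(x in Om) (weak_partial Om i y x * weak_partial Om i v x).
Proof.
move=> hy hv; rewrite /grad_pairing /Rintegral.
under eq_integral do rewrite -sumEFin.
rewrite (@integral_sum _ _ _ leb Om mOm _ (fun i x => (weak_partial Om i y x * weak_partial Om i v x)%:E)).
  rewrite sum_fine// => i _; apply: integrable_fin_num => //.
  exact: grad_pairing_integrable.
by move=> i; exact: grad_pairing_integrable.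
Qed.

Lemma grad_pairing_bound y v : in_W1p Om p y -> in_W1p Om q v ->
  (`|grad_pairing Om y v|%:E <= W1p_norm Om p y * W1p_norm Om q v)%E.
Proof.
move=> hy hv; rewrite grad_pairingE//.
apply: (@le_trans _ _ (\sum_(i < d) Lp_norm Om p (weak_partial Om i y) * W1p_norm Om q v)%E).
  apply: (@le_trans _ _ (\sum_(i < d) `|\int[leb]_(x in Om) (weak_partial Om i y x * weak_partial Om i v x)|%:E)%E).
    by rewrite sumEFin lee_fin ler_norm_sum.
  apply: lee_sum => i _; have [_ l1] := in_W1p_weak_partial i hy.
  have [_ l2] := in_W1p_weak_partial i hv.
  have [_ H] := hoelder_Om p0 q0 pq l1 l2.
  by rewrite (le_trans H)// lee_wpmul2l ?Lp_norm_ge0// Lp_weak_partial_le_W1p_norm.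
rewrite -ge0_sume_distrl => [|i _]; last exact: Lp_norm_ge0.
by rewrite lee_wpmul2r ?W1p_norm_ge0// leeDr// Lp_norm_ge0.
Qed.

Lemma grad_pairing_linl (a : R) y z v : in_W1p Om p y -> in_W1p Om p z -> in_W1p Om q v ->
  grad_pairing Om (fun x => a * y x + z x) v = a * grad_pairing Om y v + grad_pairing Om z v.
Proof.
move=> hy hz hv; have hyz := in_W1p_lin a (ltW p1) hy hz.
rewrite !grad_pairingE// mulr_sumr -big_split/=; apply: eq_bigr => i _.
have [w1 l1] := in_W1p_weak_partial i hy.
have [w2 l2] := in_W1p_weak_partial i hz.
have ay := weak_partial_ae oOm (is_weak_partial_lin oOm a w1 w2).
have iy := grad_pairing_integrable i hy hv.
have iz := grad_pairing_integrable i hz hv.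
have iyz := grad_pairing_integrable i hyz hv.
have iay : leb.-integrable Om (EFin \o (fun x => a * (weak_partial Om i y x * weak_partial Om i v x))).
  by have := integrableZl mOm a iy; apply: eq_integrable => // x _; rewrite /= EFinM.
rewrite -RintegralZl// -RintegralD//.
congr fine; apply: ae_eq_integral => //.
- by case/integrableP: iyz.
- by have := integrableD mOm iay iz; case/integrableP.
- by apply: filterS ay => x H /H /= ->; congr EFin; ring.
Qed.

End pairing.

Lemma in_Lp_le p q v : 0 < p -> p < q -> (leb Om < +oo)%E -> in_Lp Om q v -> in_Lp Om p v.
Proof.
move=> p0 pq Omoo /in_LpP[mv vq]; apply/in_LpP; split => //.
have [C C0 HC] := Lnorm_embedding p0 pq mOm Omoo.
have v0 x : ~ Om x -> (v \_ Om) x = 0.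
  by move=> xOm; rewrite patchE memNset.
apply: (le_lt_trans (HC _ mv v0)).
by rewrite lte_mul_pinfty// -/(Lp_norm Om q v) ge0_fin_numE// Lp_norm_ge0.
Qed.

Lemma W1p_norm_le p q : 0 < p -> p < q -> (leb Om < +oo)%E ->
  exists2 C : R, 0 <= C & forall v, in_W1p Om q v ->
    (W1p_norm Om p v <= C%:E * W1p_norm Om q v)%E.
Proof.
move=> p0 pq Omoo; have [C C0 HC] := Lnorm_embedding p0 pq mOm Omoo.
exists C => // v hv.
have L u : in_Lp Om q u -> (Lp_norm Om p u <= C%:E * Lp_norm Om q u)%E.
  by move=> /in_LpP[mu _]; apply: HC => // x xOm; rewrite patchE memNset.
rewrite /W1p_norm ge0_muleDr ?Lp_norm_ge0//; last by rewrite sume_ge0// => i _; exact: Lp_norm_ge0.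
rewrite leeD//; first by apply: L; have [] := hv.
rewrite ge0_sume_distrr => [|i _]; last exact: Lp_norm_ge0.
apply: lee_sum => i _; apply: L; by have [] := in_W1p_weak_partial i hv.
Qed.

Lemma in_W1p_le p q v : 0 < p -> p < q -> (leb Om < +oo)%E -> in_W1p Om q v -> in_W1p Om p v.
Proof.
move=> p0 pq Omoo [hv gv]; split; first exact: in_Lp_le hv.
by move=> i; have [g wg gq] := gv i; exists g => //; exact: in_Lp_le gq.
Qed.

(** Passes from the exponent 2 to the control exponent below 2 for solutions, and from its conjugate
    to 2 for the functions they are tested with. *)
Lemma in_W1p0_le p q v : 1 <= p -> p < q -> (leb Om < +oo)%E -> in_W1p0 Om q v -> in_W1p0 Om p v.
Proof.
move=> p1 pq Omoo [hv av]; have p0 : 0 < p by rewrite (lt_le_trans ltr01).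
have q0 := lt_trans p0 pq.
split; first exact: in_W1p_le hv.
move=> e e0; have [C C0 HC] := W1p_norm_le p0 pq Omoo.
have e' : 0 < e / (C + 1) by rewrite divr_gt0// ltr_wpDl.
have [phi tphi H] := av _ e'; exists phi => //.
have hs : in_W1p Om q (v \- phi)%R.
  rewrite (_ : (v \- phi)%R = fun x => -1 * phi x + v x).
    by apply: in_W1p_lin => //; [rewrite (le_trans p1)// ltW|exact: in_W1p_test].
  by apply/funext => x /=; rewrite mulN1r addrC.
apply: (le_lt_trans (HC _ hs)).
move: H; rewrite -(fineK (W1p_norm_fin_num hs)) -EFinM !lte_fin => H.
have h1 : C * fine (W1p_norm Om q (v \- phi)%R) <= C * (e / (C + 1)) by rewrite ler_wpM2l// ltW.
apply: (le_lt_trans h1).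
by rewrite mulrCA gtr_pMr// ltr_pdivrMr ?mul1r ?ltrDl// ltr_wpDl.
Qed.

End sobolev_spaces.

(** * Dilated kernels *)

Section Lnorm_series.
Context d (T : measurableType d) {R : realType} (mu : {measure set T -> \bar R}).
Local Notation N p f := ('N[mu]_(p%:E)[EFin \o f])%E.

(** Fatou applied to the powers [|h n|^p]. *)
Lemma Lnorm_cvg_le (p M : R) (h : nat -> T -> R) (f : T -> R) : 0 < p -> 0 <= M ->
  (forall n, measurable_fun setT (h n)) ->
  (forall x, h ^~ x @ \oo --> f x) -> (forall n, (N p (h n) <= M%:E)%E) ->
  (N p f <= M%:E)%E.
Proof.
move=> p0 M0 mh hf hM.
have mf : measurable_fun setT f by apply: (measurable_fun_cvg mh) => x _; exact: hf.
have I0 (g : T -> R) : (0 <= \int[mu]_x (`|g x| `^ p)%:E)%E.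
  by apply: integral_ge0 => x _; rewrite lee_fin powR_ge0.
have hMp n : (\int[mu]_x (`|h n x| `^ p)%:E <= (M `^ p)%:E)%E.
  have := hM n; rewrite LnormE => H.
  have := gt0_ler_poweR (ltW p0) _ _ H; rewrite !in_itv/= !leey !andbT lee_fin.
  rewrite poweR_ge0 => /(_ isT M0).
  by rewrite -poweRrM mulVf ?gt_eqF// poweRe1.
suff : (\int[mu]_x (`|f x| `^ p)%:E <= (M `^ p)%:E)%E.
  move=> H; rewrite LnormE.
  have p'0 : 0 <= p^-1 by rewrite invr_ge0 ltW.
  have := gt0_ler_poweR p'0 _ _ H; rewrite !in_itv/= !leey !andbT lee_fin.
  move=> /(_ (I0 f) (powR_ge0 _ _)) /le_trans; apply.
  by rewrite -powRrM mulfV ?gt_eqF// powRr1.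
have -> : (\int[mu]_x (`|f x| `^ p)%:E =
    \int[mu]_x limn_einf (fun n => (`|h n x| `^ p)%:E))%E.
  apply: eq_integral => x _.
  have cv : (fun n => (`|h n x| `^ p)%:E) @ \oo --> (`|f x| `^ p)%:E.
    apply: cvg_EFin; first exact: nearW.
    have cn : `|h n x| @[n --> \oo] --> `|f x| by apply: cvg_norm; exact: hf.
    (* Away from 0 the power is [exp(p ln _)] and its continuity is that of [exp] and [ln]; the
       limit 0 is treated by hand. *)
    have [f0|f0] := eqVneq (`|f x|) 0; last first.
      have fx0 : 0 < `|f x| by rewrite lt_neqAle eq_sym f0 normr_ge0.
      rewrite /powR (negbTE f0).
      apply: (@cvg_trans _ ((fun n => expR (p * ln `|h n x|)) @ \oo)).
        apply: near_eq_cvg; near=> n; rewrite /= gt_eqF//; near: n.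
        exact: (cvgr_gt _ cn).
      apply: continuous_cvg; first exact: continuous_expR.
      apply: cvgMr; apply: continuous_cvg cn.
      exact: continuous_ln.
    rewrite f0 powR0 ?gt_eqF//; rewrite f0 in cn.
    apply/cvgrPdist_lt => e e0.
    have ep : 0 < e `^ p^-1 by rewrite powR_gt0.
    near=> n.
    rewrite sub0r normrN ger0_norm ?powR_ge0//.
    rewrite (_ : e = (e `^ p^-1) `^ p); last first.
      by rewrite -powRrM mulVf ?gt_eqF// powRr1// ltW.
    rewrite gt0_ltr_powR ?nnegrE// ?powR_ge0//.
    near: n; move/cvgrPdist_lt: cn => /(_ _ ep); apply: filterS => n.
    by rewrite sub0r normrN normr_id.
  by rewrite is_cvg_limn_einfE; [apply/esym/cvg_lim|apply/cvg_ex; eexists; exact: cv].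
apply: (le_trans (fatou _ _ _ _)) => //.
  by move=> n; exact/measurable_EFinP/measurable_powR_norm.
rewrite limn_einf_lim; apply: lime_le; first exact: is_cvg_einfs.
apply: nearW => n; apply: le_trans (hMp n).
by apply: ereal_inf_lbound; exists n => /=.
Unshelve. all: end_near. Qed.

(** Minkowski and the geometric sum bound each finite block of the tail uniformly; since the series
    converges pointwise, [Lnorm_cvg_le] transfers the bound to the whole tail. *)
Lemma Lnorm_series_tail (p a rho : R) (h : nat -> T -> R) (f : T -> R) (n : nat) :
  1 <= p -> 0 <= a -> 0 <= rho < 1 -> (forall j, measurable_fun setT (h j)) ->
  (forall j, (N p (h j) <= (a * rho ^+ j)%:E)%E) ->
  (forall x, \sum_(0 <= j < m) h j x @[m --> \oo] --> f x) ->
  (N p (fun x => (f x - \sum_(0 <= j < n) h j x)%R) <= (a * rho ^+ n / (1 - rho))%:E)%E.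
Proof.
move=> p1 a0 /andP[rho0 rho1] mh hN hf.
have p0 : 0 < p by rewrite (lt_le_trans ltr01).
have r1 : 0 < 1 - rho by rewrite subr_gt0.
pose S k x := \sum_(n <= j < n + k) h j x.
have mS k : measurable_fun setT (S k) by apply: measurable_sum => j; exact: mh.
apply: (@Lnorm_cvg_le _ _ S) => //.
- by rewrite divr_ge0 ?(ltW r1)// mulr_ge0// exprn_ge0.
- move=> x.
  rewrite (_ : S^~ x = (fun k => \sum_(0 <= j < n + k) h j x - \sum_(0 <= j < n) h j x)).
    apply: cvgB; last exact: cvg_cst.
    by have := hf x; rewrite -(cvg_shiftn n); under eq_fun do rewrite addnC.
  by apply/funext => k; rewrite /S (@big_cat_nat _ _ _ n 0%N (n + k))//= ?leq_addr// addrAC subrr add0r.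
move=> k; apply: (@le_trans _ _ (\sum_(n <= j < n + k) a * rho ^+ j)%:E).
  rewrite /S {S mS}; elim: k => [|k IH].
    rewrite addn0 big_geq// (_ : (fun x => _) = cst 0); last first.
      by apply/funext => x; rewrite big_geq.
    rewrite (_ : EFin \o _ = cst 0%E) ?Lnorm0// eqe gt_eqF//.
  rewrite addnS big_nat_recr ?leq_addr//= EFinD.
  rewrite (_ : (fun x => _) = (fun x => \sum_(n <= j < n + k) h j x) \+ h (n + k)%N)%R; last first.
    by apply/funext => x; rewrite big_nat_recr ?leq_addr.
  apply: (le_trans (minkowski_EFin mu _ (mh _) p1)); first by apply: measurable_sum => j; exact: mh.
  by rewrite leeD.
rewrite lee_fin -mulr_sumr -[leRHS]mulrA ler_wpM2l// ler_pdivlMr//.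
rewrite -{1}(add0n n) big_addn addKn mulr_suml.
have -> : \sum_(0 <= i < k) rho ^+ (i + n) * (1 - rho) = rho ^+ n * (1 - rho ^+ k).
  elim: k => [|k IH]; first by rewrite big_geq// expr0 subrr mulr0.
  by rewrite big_nat_recr//= IH exprD exprS; ring.
by rewrite ler_piMr ?exprn_ge0// gerBl exprn_ge0.
Qed.

End Lnorm_series.

Section dilations.
Context {R : realType} {d : nat}.
Local Notation leb := (@lebesgue_rV R d).
Implicit Types (f : 'rV[R]_d -> R) (xi x : 'rV[R]_d).

(** Zoom by [s] about [xi], in the affine form used by the change of variables and by
    [smooth_affine]. *)
Definition dilate (s : R) xi f x := f (s *: x + - (s *: xi)).

Lemma dilateE s xi f x : dilate s xi f x = f (s *: (x - xi)).
Proof. by rewrite /dilate scalerBr. Qed.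

Lemma smooth_dilate s xi f : smooth f -> smooth (dilate s xi f).
Proof. exact: smooth_affine. Qed.

Lemma measurable_dilate s xi f : measurable_fun setT f ->
  measurable_fun setT (dilate s xi f).
Proof. by move=> mf; exact: measurableT_comp mf (measurable_affine_rV _ _). Qed.

Lemma Lnorm_dilate (p s : R) xi f : 0 < p -> 0 < s -> measurable_fun setT f ->
  ('N[leb]_(p%:E)[EFin \o dilate s xi f] =
   (s `^ (- (d%:R / p)))%:E * 'N[leb]_(p%:E)[EFin \o f])%E.
Proof.
move=> p0 s0 mf; rewrite !LnormE.
have := @ge0_integral_affine R d s (- (s *: xi)) (fun x => (`|f x| `^ p)%:E) s0.
move=> /(_ _ _) <-.
- have sd : 0 < s ^+ d by rewrite exprn_gt0.
  rewrite poweRM ?lee_fin ?exprn_ge0 ?(ltW s0)//; last first.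
    by apply: integral_ge0 => x _; rewrite lee_fin powR_ge0.
  rewrite muleA poweR_EFin -EFinM -powR_mulrn ?(ltW s0)// -powRrM -powRD.
    by rewrite addNr powRr0 mul1e.
  by rewrite (gt_eqF s0) implybT.
- exact/measurable_EFinP/measurable_powR_norm.
- by move=> x; rewrite lee_fin powR_ge0.
Qed.

Lemma dilate_support s xi f (r : R) : 0 < s -> (forall x, r < `|x| -> f x = 0) ->
  forall x, r / s < `|x - xi| -> dilate s xi f x = 0.
Proof.
move=> s0 f0 x; rewrite ltr_pdivrMr// => xr; rewrite dilateE f0// normrZ.
by rewrite (ger0_norm (ltW s0)) mulrC.
Qed.

Lemma integrable_dilate s xi f (a : R) : 0 < s -> leb.-integrable setT (EFin \o f) ->
  leb.-integrable setT (EFin \o (fun x => a * dilate s xi f x)).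
Proof.
move=> s0 fi; have := integrableZl measurableT a (integrable_affine (- (s *: xi)) s0 fi).
by apply: eq_integrable => // x _; rewrite /= EFinM.
Qed.

Lemma Rintegral_dilate s xi f : 0 < s -> leb.-integrable setT (EFin \o f) ->
  \int[leb]_x (s ^+ d * dilate s xi f x) = \int[leb]_x f x.
Proof.
move=> s0 fi.
have mf : measurable_fun setT f by apply/measurable_EFinP; case/integrableP: fi.
rewrite -(Rintegral_affine (- (s *: xi)) s0 mf) RintegralZl//.
exact: integrable_affine.
Qed.

Lemma lap_dilate s xi f x : smooth f -> lap (dilate s xi f) x = s ^+ 2 * dilate s xi (lap f) x.
Proof. exact: lap_affine. Qed.

Lemma partial_dilate s xi f i x : smooth f ->
  partial i (dilate s xi f) x = s * dilate s xi (partial i f) x.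
Proof. exact: partial_affine. Qed.

(** The dilate [s^d k_s] is nonnegative, keeps the mass of [k] and lives within [r / s] of [xi],
    where [g] is within [eps] of [c]. *)
Lemma dilate_concentrate (s eps c r : R) xi (k g : 'rV[R]_d -> R) : 0 < s ->
  continuous k -> (forall x, 0 <= k x) -> (forall x, r < `|x| -> k x = 0) ->
  (forall x, `|x - xi| <= r / s -> `|g x - c| <= eps) ->
  leb.-integrable setT (EFin \o (fun x => s ^+ d * dilate s xi k x * g x)) ->
  `|\int[leb]_x (s ^+ d * dilate s xi k x * g x) - c * \int[leb]_x k x| <=
  eps * \int[leb]_x k x.
Proof.
move=> s0 ck k0 kr gc gi.
have mk := continuous_measurable_rV ck.
have ki0 : leb.-integrable setT (EFin \o k).
  apply: (@compact_support_integrable _ _ _ 0 r) => // x.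
  by rewrite subr0; exact: kr.
have sd : 0 < s ^+ d by rewrite exprn_gt0.
have K0 x : 0 <= s ^+ d * dilate s xi k x by rewrite mulr_ge0 ?k0// ltW.
have ki : leb.-integrable setT (EFin \o (fun x => s ^+ d * dilate s xi k x)).
  exact: integrable_dilate.
have Zi (a : R) : leb.-integrable setT (EFin \o (fun x => a * (s ^+ d * dilate s xi k x))).
  have := integrableZl measurableT a ki.
  by apply: eq_integrable => // x _; rewrite /= EFinM.
rewrite -(Rintegral_dilate xi s0 ki0) -!RintegralZl// -RintegralB//.
have di : leb.-integrable setT (EFin \o (fun x => s ^+ d * dilate s xi k x * g x -
    c * (s ^+ d * dilate s xi k x))).
  have := integrableB measurableT gi (Zi c).
  by apply: eq_integrable => // x _; rewrite /= EFinB.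
rewrite (le_trans (le_normr_Rintegral measurableT di))//.
apply: le_Rintegral => //.
- have := integrable_abse di; by apply: eq_integrable => // x _.
move=> x _; rewrite [c * _]mulrC -mulrBr normrM (ger0_norm (K0 x)) mulrC.
have [xr|xr] := leP (`|x - xi|) (r / s); first by rewrite ler_wpM2r// gc.
by rewrite (dilate_support s0 kr xr) mulr0 !mulr0.
Qed.

Lemma lebesgue_rV_set1 (a : 'rV[R]_d) : (0 < d)%N -> leb [set a] = 0%E.
Proof.
move=> d0; apply/eqP; rewrite eq_le measure_ge0 andbT.
apply/lee_addgt0Pr => e e0; rewrite add0e.
pose r := Num.min 1 e / 2.
have m0 : 0 < Num.min 1 e by rewrite lt_min ltr01.
have r0 : 0 < r by rewrite divr_gt0.
apply: (@le_trans _ _ (leb (ball a r))).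
  apply: le_measure; rewrite ?inE.
  - exact: measurable_rV_set1.
  - by apply: open_measurable_rV; exact: ball_open.
  - by move=> x ->; exact: ballxx.
rewrite lebesgue_rV_ball// lee_fin -mulr_natr /r divfK//.
case: d d0 => // n _; rewrite exprS.
have le1 : Num.min 1 e <= 1 by rewrite ge_min lexx.
rewrite (@le_trans _ _ (Num.min 1 e * 1))//.
  by rewrite ler_wpM2l ?(ltW m0)// exprn_ile1// ltW.
by rewrite mulr1 ge_min lexx orbT.
Qed.

End dilations.

Section positive_integral.
Context {R : realType} {d : nat}.
Local Notation leb := (@lebesgue_rV R d).

Lemma Rintegral_continuous_gt0 (f : 'rV[R]_d -> R) a : continuous f ->
  (forall x, 0 <= f x) -> 0 < f a -> leb.-integrable setT (EFin \o f) ->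
  0 < \int[leb]_x f x.
Proof.
move=> cf f0 fa fi.
have [r r0 H] : exists2 r : R, 0 < r & forall x, ball a r x -> f a / 2 <= f x.
  have : \forall x \near a, f a / 2 < f x.
    by apply: (cvgr_gt (f a) (cf a)); rewrite ltr_pdivrMr// ltr_pMr// ltr1n.
  by move=> /nbhs_ballP[r /= r0 rH]; exists r => // x /rH /ltW.
have mB : measurable (ball a r) by apply: open_measurable_rV; exact: ball_open.
have mf : measurable_fun setT (fun x => (f x)%:E).
  by apply/measurable_EFinP; exact: continuous_measurable_rV.
rewrite -lte_fin -integrable_Rintegral_EFin//.
apply: (@lt_le_trans _ _ (\int[leb]_(x in ball a r) (f a / 2)%:E)%E).
  have -> : (\int[leb]_(x in ball a r) (f a / 2)%:E = (f a / 2)%:E * ((r *+ 2) ^+ d)%:E)%E.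
    by rewrite -(lebesgue_rV_ball a r0); exact: integral_cst.
  by rewrite -EFinM lte_fin mulr_gt0 ?divr_gt0// exprn_gt0// mulrn_wgt0.
apply: (@le_trans _ _ (\int[leb]_(x in ball a r) (f x)%:E)%E).
  apply: ge0_le_integral => //.
  - by move=> x _; rewrite lee_fin divr_ge0// ltW.
  - exact: (measurable_funS measurableT (@subsetT _ _) mf).
apply: (@ge0_subset_integral _ _ _ _ _ setT mB measurableT _ mf) => //.
by move=> x _; rewrite lee_fin.
Qed.

End positive_integral.

(** * Kernels with telescoping Laplacian *)

Section kernels.
Context {R : realType} {d : nat}.
Local Notation leb := (@lebesgue_rV R d).
Implicit Types F : nat -> R -> R.

(** The kernel on the right has the profile [-2 F'], which is nonnegative when [F] decreases. *)
Let radial_avg_lap F x : (0 < d)%N -> derseq F ->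
  lap (@radial R d (avg d 3 F)) x =
  - (2 ^+ d * radial (fun n t => - 2 * F n.+1 t) (2 *: x) -
     radial (fun n t => - 2 * F n.+1 t) x).
Proof.
move=> d0 dF; rewrite lap_radial; last exact: derseq_avg.
rewrite avg_laplacian// /radial sqnormZ exprS (_ : (2 : R) ^+ 2 = 4); last by ring.
by ring.
Qed.

(* The Laplacian of an average over dilations by [s] in [[1, 2]] of a radial
   profile is the difference of its values at the endpoints [s = 2] and [s = 1]. *)
Lemma telescoping_kernels : (0 < d)%N -> exists eta b beta : 'rV[R]_d -> R,
  [/\ [/\ smooth eta, smooth b & smooth beta],
    [/\ forall x, 0 <= eta x, forall x, 0 <= b x & forall x, 0 <= beta x],
    [/\ forall x, 2^-1 < `|x| -> eta x = 0, forall x, 2^-1 < `|x| -> b x = 0 &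
      forall x, 2^-1 < `|x| -> beta x = 0],
    (forall x, lap b x = - (2 ^+ d * eta (2 *: x) - eta x)) /\
    (forall x, lap beta x = - (2 ^+ d * b (2 *: x) - b x)) &
    0 < beta 0 /\ 0 < \int[leb]_x eta x].
Proof.
move=> d0.
(* The profile [flat 0 (1/4 - t)] decreases and vanishes for [t >= 1/4], that is, for Euclidean norm
   at least 1/2. As [1/4 < 1/2], its second derivative is nonnegative on [t >= 0], and so is the
   profile [h = 4 M''] of [eta]. *)
pose M n (t : R) := (-1) ^+ n * flat n (4^-1 - t).
have dM : derseq M by exact: derseq_shiftN (@derseq_flat R).
pose K1 n t := - 2 * M n.+1 t.
have dK1 : derseq K1 by apply: (@derseqZ _ _ (fun n t => M n.+1 t)); exact: derseqS.
pose h n t := - 2 * K1 n.+1 t.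
have dh : derseq h by apply: (@derseqZ _ _ (fun n t => K1 n.+1 t)); exact: derseqS.
(* The exponent 5 absorbs the factor [s^2] produced by one derivative, so that [-2 K2'] equals
   [avg d 3 K1], the profile of [b]. Hence the kernel belonging to [beta], the average of [K2], is
   [b] itself. *)
pose K2 := avg d 5 M.
have dK2 : derseq K2 by exact: derseq_avg.
have M0 t : 0 <= M 0%N t by rewrite /M expr0 mul1r flat0_ge0.
have K10 t : 0 <= K1 0%N t.
  by rewrite /K1 /M expr1 mulN1r mulrNN mulr_ge0// flat1_ge0.
have K20 t : 0 <= K2 0%N t by apply: avg_ge0.
have hE t : h 0%N t = 4 * flat 2 (4^-1 - t) by rewrite /h /K1 /M; ring.
have h0 t : 0 <= t -> 0 <= h 0%N t.
  move=> t0; rewrite hE mulr_ge0// flat2_ge0//; lra.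
have Mv n t : 4^-1 <= t -> M n t = 0.
  by move=> t4; rewrite /M flat_le0 ?mulr0// subr_le0.
have K1v n t : 4^-1 <= t -> K1 n t = 0 by move=> t4; rewrite /K1 Mv// mulr0.
have hv n t : 4^-1 <= t -> h n t = 0 by move=> t4; rewrite /h K1v// mulr0.
have K2v n t : 4^-1 <= t -> K2 n t = 0.
  by move=> t4; apply: (@avg_eq0 _ _ _ _ _ _ 4^-1) => // x; exact: Mv.
have bv n t : 4^-1 <= t -> avg d 3 K1 n t = 0.
  by move=> t4; apply: (@avg_eq0 _ _ _ _ _ _ 4^-1) => // x; exact: K1v.
have betav n t : 4^-1 <= t -> avg d 3 K2 n t = 0.
  by move=> t4; apply: (@avg_eq0 _ _ _ _ _ _ 4^-1) => // x; exact: K2v.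
have bE n t : - 2 * K2 n.+1 t = avg d 3 K1 n t.
  rewrite /K2 /avg -RintegralZl//; last first.
    by apply: avg_integrable; exact: derseq_continuous.
  apply: eq_Rintegral => s; rewrite inE/= in_itv/= => /andP[s1 _].
  have s0 : s != 0 by rewrite gt_eqF// (lt_le_trans ltr01).
  rewrite /K1 doubleS !addnS !exprS; field; exact: s0.
have vX (x : 'rV[R]_d) : 2^-1 < `|x| -> 4^-1 <= sqnorm x.
  move=> x2; apply: le_trans (ler_norm_sqnorm x).
  rewrite (_ : 4^-1 = 2^-1 ^+ 2 :> R); last by field.
  by rewrite lerXn2r ?nnegrE// ltW.
have bR x : radial (fun n t => - 2 * K2 n.+1 t) x = radial (avg d 3 K1) x :> R.
  by rewrite /radial bE.
have se : smooth (@radial R d h) by exact: smooth_radial.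
exists (radial h), (radial (avg d 3 K1)), (radial (avg d 3 K2)); split.
- by split=> //; apply: smooth_radial; exact: derseq_avg.
- split=> x; rewrite /radial ?avg_ge0//.
  by apply: h0; exact: sqnorm_ge0.
- by split=> x /vX x4; rewrite /radial ?hv ?bv ?betav.
- split=> x; first exact: radial_avg_lap.
  by rewrite radial_avg_lap// !bR.
- split.
    rewrite /radial sqnorm0; apply: avg_gt0 => // s _; rewrite mulr0.
    apply: avg_gt0 => // u _; rewrite mulr0 /M expr0 mul1r subr0 flat0_gt0//.
  apply: (@Rintegral_continuous_gt0 _ _ _ 0).
  + exact: smooth_continuous.
  + by move=> x; rewrite /radial h0// sqnorm_ge0.
  + by rewrite /radial sqnorm0 hE subr0 mulr_gt0// flat2_gt0//; apply/andP; split; lra.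
  + apply: (@compact_support_integrable _ _ _ 0 2^-1); first exact: smooth_continuous.
    by move=> x; rewrite subr0 => /vX x4; rewrite /radial hv.
Qed.

End kernels.

(** * Series of dilates over dyadic scales *)

Section dilated_series.
Context {R : realType} {d : nat}.
Local Notation leb := (@lebesgue_rV R d).
Local Notation N p f := ('N[leb]_(p%:E)[EFin \o f])%E.
Implicit Types (f : 'rV[R]_d -> R) (xi x : 'rV[R]_d).

(** The exponent [k] is [d] for dilates of constant mass, [d.-2] for the terms of the fundamental
    solution and [d.-1] for their gradients. *)
Definition scaled k (s : R) xi f x := s ^+ k * dilate s xi f x.

(** For [f] of bounded support only finitely many terms are nonzero at a point other than [xi]. At
    [xi] the sum may diverge, and the value 0 is assigned. *)
Definition scaled_series k (s : R) xi f x :=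
  if x == xi then 0 else
  limn (fun n => \sum_(0 <= j < n) scaled k (2 ^+ j * s) xi f x).

Lemma smooth_scaled k s xi f : smooth f -> smooth (scaled k s xi f).
Proof. by move=> sf; apply: smoothZ; exact: smooth_dilate. Qed.

Lemma scaled_support k (s r : R) xi f : 0 < s -> (forall x, r < `|x| -> f x = 0) ->
  forall x, r / s < `|x - xi| -> scaled k s xi f x = 0.
Proof. by move=> s0 f0 x xr; rewrite /scaled (dilate_support s0 f0)// mulr0. Qed.

Lemma partial_scaled k (s : R) xi f i x : smooth f ->
  partial i (scaled k s xi f) x = scaled k.+1 s xi (partial i f) x.
Proof.
move=> sf; rewrite /partial /scaled deriveZ_smooth; last exact: smooth_dilate.
by rewrite -/(partial i _ x) partial_dilate// exprSr mulrA.
Qed.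

Lemma lap_scaled k (s : R) xi f x : smooth f ->
  lap (scaled k s xi f) x = scaled k.+2 s xi (lap f) x.
Proof.
move=> sf; rewrite /scaled lapZ; last exact: smooth_dilate.
by rewrite lap_dilate// mulrA -exprD addn2.
Qed.

Lemma measurable_scaled k s xi f : measurable_fun setT f ->
  measurable_fun setT (scaled k s xi f).
Proof. by move=> mf; apply: measurable_funM => //; exact: measurable_dilate. Qed.

Lemma scaled_near0 k (s r : R) xi f x : 0 < s -> (forall x, r < `|x| -> f x = 0) ->
  x != xi -> \forall j \near \oo, scaled k (2 ^+ j * s) xi f x = 0.
Proof.
move=> s0 f0 xxi.
have n0 : 0 < s * `|x - xi| by rewrite mulr_gt0// normr_gt0 subr_eq0.
have c2 : geometric 1 (2^-1 : R) @ \oo --> (0 : R).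
  by apply: cvg_geometric; rewrite ger0_norm// invf_lt1// ltr1n.
have r1 : 0 < `|r| + 1 by rewrite ltr_wpDl.
have e0 : 0 < s * `|x - xi| / (`|r| + 1) by rewrite divr_gt0.
near=> j.
have H : 2^-1 ^+ j < s * `|x - xi| / (`|r| + 1).
  near: j; move/cvgrPdist_lt: c2 => /(_ _ e0); apply: filterS => j.
  by rewrite sub0r normrN /geometric/= mul1r; exact/le_lt_trans/ler_norm.
apply: (@scaled_support _ _ r) => //; first by rewrite mulr_gt0// exprn_gt0.
rewrite ltr_pdivrMr ?mulr_gt0 ?exprn_gt0//.
move: H; rewrite ltr_pdivlMr// exprVn mulrC ltr_pdivrMr ?exprn_gt0// => H.
rewrite mulrCA mulrC [`|_| * s]mulrC (le_lt_trans (ler_norm r))//.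
by apply: lt_trans H; rewrite ltrDl.
Unshelve. all: end_near. Qed.

Lemma scaled_series_cvg k (s r : R) xi f x : 0 < s -> (forall x, r < `|x| -> f x = 0) ->
  x != xi -> \sum_(0 <= j < n) scaled k (2 ^+ j * s) xi f x @[n --> \oo] -->
             scaled_series k s xi f x.
Proof.
move=> s0 f0 xxi; rewrite /scaled_series (negbTE xxi).
have [J _ HJ] := scaled_near0 k s0 f0 xxi.
suff c : \sum_(0 <= j < n) scaled k (2 ^+ j * s) xi f x @[n --> \oo] -->
    \sum_(0 <= j < J) scaled k (2 ^+ j * s) xi f x.
  by rewrite (cvg_lim _ c)//; exact: Rhausdorff.
apply: cvg_near_cst; exists J => // n /= Jn.
rewrite (@big_cat_nat _ _ _ J 0%N n)//= [X in _ + X]big_nat_cond [X in _ + X]big1 ?addr0//.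
by move=> j /andP[/andP[Jj _] _]; exact: HJ.
Qed.

Lemma Lnorm_scaled k (p s : R) xi f : 0 < p -> 0 < s -> measurable_fun setT f ->
  (N p (scaled k s xi f) = (s `^ (k%:R - d%:R / p))%:E * N p f)%E.
Proof.
move=> p0 s0 mf; rewrite Lnorm_scale//; last exact: measurable_dilate.
rewrite ger0_norm ?exprn_ge0 ?ltW// Lnorm_dilate// muleA -EFinM -powR_mulrn ?(ltW s0)//.
by rewrite -powRD// (gt_eqF s0) implybT.
Qed.

(** Doubling the scale multiplies the norm by [2^(k - d/p)], and [k p < d] says that this ratio is
    below 1. The bound is independent of the centre by translation invariance. *)
Lemma Lnorm_scaled_geometric k (p s : R) f : 0 < p -> 0 < s -> k%:R * p < d%:R ->
  measurable_fun setT f -> (N p f < +oo)%E ->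
  exists a rho : R, [/\ 0 <= a, 0 <= rho < 1 &
    forall xi j, (N p (scaled k (2 ^+ j * s) xi f) <= (a * rho ^+ j)%:E)%E].
Proof.
move=> p0 s0 kp mf foo.
have fN : N p f \is a fin_num by rewrite ge0_fin_numE// Lnorm_ge0.
pose t := k%:R - d%:R / p.
have t0 : t < 0 by rewrite subr_lt0 ltr_pdivlMr.
exists (s `^ t * fine (N p f)), (2 `^ t); split.
- by rewrite mulr_ge0 ?powR_ge0// fine_ge0// Lnorm_ge0.
- rewrite powR_ge0/=.
  by rewrite /powR pnatr_eq0/= expR_lt1 pmulr_llt0// ln_gt0// ltr1n.
move=> xi j; rewrite Lnorm_scaled ?mulr_gt0 ?exprn_gt0//.
rewrite -{1}(fineK fN) -EFinM lee_fin powRM ?exprn_ge0 ?(ltW s0)//.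
rewrite -(powR_mulrn j (powR_ge0 2 t)) -powRrM mulrC [t * _]mulrC powRrM powR_mulrn//.
by rewrite -/t mulrC [_ `^ t * s `^ t]mulrC mulrAC.
Qed.

Lemma scaled_series_Lnorm k (p s r : R) xi f : 1 <= p -> 0 < s -> (0 < d)%N ->
  k%:R * p < d%:R -> (forall x, r < `|x| -> f x = 0) ->
  measurable_fun setT f -> (N p f < +oo)%E ->
  [/\ measurable_fun setT (scaled_series k s xi f), (N p (scaled_series k s xi f) < +oo)%E &
   forall e : R, 0 < e -> \forall n \near \oo,
     (N p (fun x => (scaled_series k s xi f x -
        \sum_(0 <= j < n) scaled k (2 ^+ j * s) xi f x)%R) < e%:E)%E].
Proof.
move=> p1 s0 d0 kp fv mf foo; have p0 : 0 < p by rewrite (lt_le_trans ltr01).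
have [a [rho [a0 rho01 H]]] := Lnorm_scaled_geometric p0 s0 kp mf foo.
(* Killing the terms at [xi] makes the series converge at every point to [scaled_series]; only a
   null set is changed. *)
pose g j x := scaled k (2 ^+ j * s) xi f x * (x != xi)%:R.
have mxi := measurable_rV_set1 xi.
have mi : measurable_fun setT (fun x => (x != xi)%:R : R).
  rewrite (_ : (fun x => _) = \1_(~` [set xi])).
    by apply: measurable_indic; exact: measurableC.
  apply/funext => x; rewrite indicE; congr (_%:R); congr nat_of_bool.
  by apply/idP/idP => [xx|]; [rewrite inE /= => xe; rewrite xe eqxx in xx|
    rewrite inE/= => ?; exact/eqP].
have mS j : measurable_fun setT (scaled k (2 ^+ j * s) xi f) by exact: measurable_scaled.
have mg j : measurable_fun setT (g j) by exact: measurable_funM.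
have gN j : (N p (g j) <= (a * rho ^+ j)%:E)%E.
  apply: le_trans (H xi j); apply: Lnorm_le => // x.
  by rewrite normrM; case: eqP; rewrite ?normr0 ?mulr0 ?normr1 ?mulr1.
have gc x : \sum_(0 <= j < m) g j x @[m --> \oo] --> scaled_series k s xi f x.
  have [->|xxi] := eqVneq x xi.
    rewrite /scaled_series eqxx (_ : (fun m => _) = cst 0); first exact: cvg_cst.
    by apply/funext => m; rewrite big1// => j _; rewrite /g eqxx mulr0.
  rewrite (_ : (fun m => _) = (fun m => \sum_(0 <= j < m) scaled k (2 ^+ j * s) xi f x)).
    exact: (scaled_series_cvg s0 fv xxi).
  by apply/funext => m; apply: eq_bigr => j _; rewrite /g xxi mulr1.
have T n := Lnorm_series_tail n p1 a0 rho01 mg gN gc.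
have mw : measurable_fun setT (scaled_series k s xi f).
  by apply: (measurable_fun_cvg (h := fun m x => \sum_(0 <= j < m) g j x)) => [m|x _];
    [exact: measurable_sum | exact: gc].
split => //.
  have := T 0%N; rewrite (_ : (fun x => _) = scaled_series k s xi f); last first.
    by apply/funext => x; rewrite big_geq// subr0.
  by move=> /le_lt_trans; apply; rewrite ltry.
move=> e e0; have r1 : 0 < 1 - rho by rewrite subr_gt0; case/andP: rho01.
have c : a * rho ^+ n / (1 - rho) @[n --> \oo] --> (0 : R).
  rewrite -(mul0r (1 - rho)^-1); apply: cvgMl.
  by apply: cvg_geometric; case/andP: rho01 => ? ?; rewrite ger0_norm.
move/cvgrPdist_lt: c => /(_ _ e0); apply: filterS => n.
rewrite sub0r normrN => /(le_lt_trans (ler_norm _)) ne.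
rewrite (@Lnorm_ae_eq _ _ _ _ _ _ (fun x => scaled_series k s xi f x - \sum_(0 <= j < n) g j x)).
- by apply: (le_lt_trans (T n)); rewrite lte_fin.
- by apply: measurable_funB => //; exact: measurable_sum.
- by apply: measurable_funB => //; exact: measurable_sum.
- exists [set xi]; split => //; first exact: lebesgue_rV_set1.
  move=> x /=; case: (eqVneq x xi) => // xxi; case.
  by congr (_ - _); apply: eq_bigr => j _; rewrite /g xxi mulr1.
Qed.

End dilated_series.

(** * The Morrey inequality *)

Lemma Lnorm_sum_geometric d (T : measurableType d) (R : realType)
    (mu : {measure set T -> \bar R}) (p a rho : R) (h : nat -> T -> R) n :
  1 <= p -> 0 <= a -> 0 <= rho < 1 -> (forall j, measurable_fun setT (h j)) ->
  (forall j, ('N[mu]_(p%:E)[EFin \o h j] <= (a * rho ^+ j)%:E)%E) ->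
  ('N[mu]_(p%:E)[EFin \o (fun x => \sum_(0 <= j < n) h j x)%R] <= (a / (1 - rho))%:E)%E.
Proof.
move=> p1 a0 rho01 mh hN; have p0 : 0 < p by rewrite (lt_le_trans ltr01).
have r0 : 0 <= rho by case/andP: rho01.
(* The truncated series is eventually constant, so its tail from index 0 is the finite sum to be
   bounded. *)
pose g j := if (j < n)%N then h j else cst 0.
have := @Lnorm_series_tail _ _ _ mu p a rho g (fun x => \sum_(0 <= j < n) h j x) 0%N p1 a0 rho01.
rewrite expr0 mulr1 (_ : (fun x => _ - _) = fun x => \sum_(0 <= j < n) h j x); last first.
  by apply/funext => x; rewrite [X in _ - X]big_geq// subr0.
apply=> [j|j|x].
- by rewrite /g; case: ifP.
- rewrite /g; case: ifP => // _; rewrite (_ : EFin \o _ = cst 0%E) ?Lnorm0 ?eqe ?gt_eqF//.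
  by rewrite lee_fin mulr_ge0// exprn_ge0.
apply: cvg_near_cst; exists n => // m /= nm.
rewrite (@big_cat_nat _ _ _ n 0%N m)//= [X in _ + X]big_nat_cond [X in _ + X]big1 ?addr0//.
  by rewrite big_nat_cond [RHS]big_nat_cond; apply: eq_bigr => j /andP[/andP[_ jn] _]; rewrite /g jn.
by move=> j /andP[/andP[nj _] _]; rewrite /g ltnNge nj.
Qed.

Lemma cvg_norm_le (R : realType) (u : nat -> R) (l M : R) : u @ \oo --> l ->
  (forall n, `|u n| <= M) -> `|l| <= M.
Proof.
move=> ul H; apply/ler_addgt0Pr => e e0.
move/cvgrPdist_lt: ul => /(_ e e0)[N _ /(_ N (leqnn _))]/= uN.
by rewrite -(subrK (u N) l) (le_trans (ler_normD _ _))// addrC lerD// ltW.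
Qed.

Section green.
Context {R : realType} {d : nat}.
Local Notation leb := (@lebesgue_rV R d).
Variables (Om : set 'rV[R]_d) (oOm : open Om).
Implicit Types (v w g phi f : 'rV[R]_d -> R).
Let mOm : measurable Om := open_measurable_rV oOm.

Lemma smooth_mul_test_integrable f phi : smooth f -> test_function Om phi ->
  leb.-integrable Om (EFin \o (fun x => f x * phi x)).
Proof.
move=> sf tphi; apply: (loc_integrable_mul_test oOm) => //.
by apply: loc_integrable_continuous => //; exact: smooth_continuous.
Qed.

Lemma green_test f phi : smooth f -> test_function Om phi ->
  \sum_(i < d) \int[leb]_(x in Om) (partial i f x * partial i phi x) =
  - \int[leb]_(x in Om) (lap f x * phi x).
Proof.
move=> sf tphi.
have E i : \int[leb]_(x in Om) (partial i f x * partial i phi x) =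
    - \int[leb]_(x in Om) (partial i (partial i f) x * phi x).
  have sp : smooth (partial i f) by exact: smooth_derive.
  by have [_ _ /(_ _ tphi)] := is_weak_partial_smooth Om i sp.
rewrite (eq_bigr _ (fun i _ => E i)) sumrN; congr (- _).
have int i : leb.-integrable Om (EFin \o (fun x => partial i (partial i f) x * phi x)).
  by apply: smooth_mul_test_integrable => //; do 2 apply: smooth_derive.
rewrite /Rintegral.
under [in RHS]eq_integral do rewrite /lap mulr_suml -sumEFin.
rewrite (@integral_sum _ _ _ leb Om mOm _ (fun i x => (partial i (partial i f) x * phi x)%:E))//.
by rewrite sum_fine// => i _; apply: integrable_fin_num => //; exact: int.
Qed.

Lemma Lp_norm_le_Lnorm (p : R) f : 0 < p -> measurable_fun setT f ->
  (Lp_norm Om p f <= 'N[leb]_(p%:E)[EFin \o f])%E.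
Proof.
move=> p0 mf; apply: Lnorm_le => //.
  by apply: measurable_fun_restrict => //; exact: measurable_funTS.
by move=> x; rewrite patchE; case: ifP => // _; rewrite normr0.
Qed.

End green.

(** * Truncated fundamental solutions *)

Section fundamental_solution.
Context {R : realType} {d : nat}.
Local Notation leb := (@lebesgue_rV R d).
Variables (eta b : 'rV[R]_d -> R).
Hypotheses (seta : smooth eta) (sb : smooth b) (eta0 : forall x, 0 <= eta x).
Hypotheses (etav : forall x, 2^-1 < `|x| -> eta x = 0) (bv : forall x, 2^-1 < `|x| -> b x = 0).
Hypothesis lapb : forall x, lap b x = - (2 ^+ d * eta (2 *: x) - eta x).
Hypothesis d2 : (1 < d)%N.

Let d0 : (0 < d)%N. Proof. exact: ltnW. Qed.
Let dE : d.-2.+2 = d. Proof. by case: d d2 => [|[]]. Qed.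

(** Smooth, compactly supported approximation of the state of a point source at [xi], keeping [n]
    dyadic scales. *)
Definition potential s xi n (x : 'rV[R]_d) :=
  \sum_(0 <= j < n) scaled d.-2 (2 ^+ j * s) xi b x.

Lemma smooth_potential s xi n : smooth (potential s xi n).
Proof. by apply: smooth_sum => j; exact: smooth_scaled. Qed.

Lemma partial_potential s xi n i x : partial i (potential s xi n) x =
  \sum_(0 <= j < n) scaled d.-1 (2 ^+ j * s) xi (partial i b) x.
Proof.
rewrite /partial /potential derive_sum_smooth => [|j]; last exact: smooth_scaled.
apply: eq_bigr => j _; rewrite -/(partial i _ x) partial_scaled//.
by rewrite (_ : d.-2.+1 = d.-1)//; case: d d2 => [|[]].
Qed.

(** Two derivatives raise the exponent [d.-2] to [d], and [lapb] makes each term the difference of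
    the mass preserving kernels at consecutive dyadic scales; the sum telescopes. *)
Lemma lap_potential s xi n x : lap (potential s xi n) x =
  - (scaled d (2 ^+ n * s) xi eta x - scaled d s xi eta x).
Proof.
have lap_term t y : lap (scaled d.-2 t xi b) y =
    - (scaled d (2 * t) xi eta y - scaled d t xi eta y).
  rewrite lap_scaled// dE /scaled !dilateE lapb exprMn scalerA; ring.
have lapE y : lap (potential s xi n) y =
    \sum_(0 <= j < n) lap (scaled d.-2 (2 ^+ j * s) xi b) y.
  rewrite /lap exchange_big/=; apply: eq_bigr => i _.
  rewrite (_ : partial i (potential s xi n) =
    fun z => \sum_(0 <= j < n) partial i (scaled d.-2 (2 ^+ j * s) xi b) z); last first.
    apply/funext => z; rewrite /partial derive_sum_smooth// => j; exact: smooth_scaled.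
  rewrite {1}/partial derive_sum_smooth// => j; apply: smooth_derive; exact: smooth_scaled.
rewrite lapE; under eq_bigr do rewrite lap_term mulrA -exprS.
by rewrite sumrN telescope_sumr// expr0 mul1r.
Qed.

(** An approximate identity. Since [g] is controlled at [xi] only, integrability of the products is
    assumed separately. *)
Lemma scaled_mass_cvg s xi (g : 'rV[R]_d -> R) : 0 < s -> {for xi, continuous g} ->
  (forall n, leb.-integrable setT (EFin \o (fun x => scaled d (2 ^+ n * s) xi eta x * g x))) ->
  \int[leb]_x (scaled d (2 ^+ n * s) xi eta x * g x) @[n --> \oo] -->
  g xi * \int[leb]_x eta x.
Proof.
move=> s0 cg ig; set m := \int[leb]_x eta x.
have m0 : 0 <= m by apply: Rintegral_ge0.
apply/cvgrPdist_le => e e0.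
have e1 : 0 < e / (m + 1) by rewrite divr_gt0// ltr_wpDl.
have [r r0 rg] : exists2 r : R, 0 < r & forall x, ball xi r x -> `|g x - g xi| <= e / (m + 1).
  have : \forall x \near xi, `|g xi - g x| <= e / (m + 1).
    by move/cvgrPdist_le: cg => /(_ _ e1).
  by move=> /nbhs_ballP[r /= r0 rH]; exists r => // x /rH; rewrite distrC.
have c2 : geometric 1 (2^-1 : R) @ \oo --> (0 : R).
  by apply: cvg_geometric; rewrite ger0_norm// invf_lt1// ltr1n.
have rs : 0 < r * s by rewrite mulr_gt0.
near=> n.
have H : 2^-1 ^+ n < r * s.
  near: n; move/cvgrPdist_lt: c2 => /(_ _ rs); apply: filterS => j.
  by rewrite sub0r normrN /geometric/= mul1r; exact/le_lt_trans/ler_norm.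
have sn : 0 < 2 ^+ n * s by rewrite mulr_gt0// exprn_gt0.
rewrite distrC (le_trans (@dilate_concentrate _ _ _ (e / (m + 1)) _ 2^-1 _ _ _ _ _ _ etav _ _))//.
- exact: smooth_continuous.
- move=> x xr; apply: rg; rewrite -ball_normE/= distrC (le_lt_trans xr)//.
  rewrite ltr_pdivrMr// mulrCA -ltr_pdivrMl ?exprn_gt0// -exprVn.
  by apply: le_lt_trans H; rewrite ler_piMr ?exprn_ge0// invf_le1// ler1n.
- exact: ig.
- by rewrite -/m mulrAC ler_pdivrMr ?ltr_wpDl// ler_wpM2l ?(ltW e0)// lerDl.
Unshelve. all: end_near. Qed.

Section morrey.
Variables (Om : set 'rV[R]_d) (oOm : open Om) (p q : R).
Hypotheses (p1 : 1 < p) (q1 : 1 < q) (qp : q^-1 + p^-1 = 1) (dq : d.-1%:R * q < d%:R).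
Let p0 : 0 < p := lt_trans ltr01 p1.
Let q0 : 0 < q := lt_trans ltr01 q1.
Let mOm : measurable Om := open_measurable_rV oOm.

Let pbv i x : 2^-1 < `|x| -> partial i b x = 0.
Proof.
move=> xr; apply: (@derive_outside _ _ b _ 0 2^-1); last by rewrite subr0.
by move=> y; rewrite subr0; exact: bv.
Qed.

Let mpb i : measurable_fun setT (partial i b).
Proof. apply: continuous_measurable_rV; exact: (smooth_continuous (smooth_derive _ sb)). Qed.

Let pbN i : ('N[leb]_(q%:E)[EFin \o partial i b] < +oo)%E.
Proof.
apply: (compact_support_Lnorm (a := 0) (r := 2^-1)) => //.
  exact: (smooth_continuous (smooth_derive _ sb)).
by move=> x; rewrite subr0; exact: pbv.
Qed.

Lemma potential_green s xi n phi : test_function Om phi ->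
  \sum_(i < d) \int[leb]_(x in Om) (partial i (potential s xi n) x * partial i phi x) =
  \int[leb]_(x in Om) (scaled d (2 ^+ n * s) xi eta x * phi x) -
  \int[leb]_(x in Om) (scaled d s xi eta x * phi x).
Proof.
move=> tphi; rewrite green_test//; last exact: smooth_potential.
rewrite -RintegralB//; last 2 first.
- by apply: smooth_mul_test_integrable => //; exact: smooth_scaled.
- by apply: smooth_mul_test_integrable => //; exact: smooth_scaled.
rewrite -mulN1r -RintegralZl//; last first.
  by apply: smooth_mul_test_integrable => //; apply: smooth_lap; exact: smooth_potential.
by apply: eq_Rintegral => x _; rewrite lap_potential; ring.
Qed.

Lemma potential_green_cvg s xi phi : 0 < s -> test_function Om phi ->
  \sum_(i < d) \int[leb]_(x in Om) (partial i (potential s xi n) x * partial i phi x)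
    @[n --> \oo] -->
  phi xi * \int[leb]_x eta x - \int[leb]_(x in Om) (scaled d s xi eta x * phi x).
Proof.
move=> s0 tphi; under eq_fun do rewrite potential_green//.
have [sphi [K [cK KOm phiv _]]] := test_functionP tphi.
apply: cvgB; last exact: cvg_cst.
have phi0 n x : ~ Om x -> scaled d (2 ^+ n * s) xi eta x * phi x = 0.
  by move=> nx; rewrite phiv ?mulr0// => /KOm.
under eq_fun => n do rewrite (Rintegral_Om_support (phi0 n)).
apply: scaled_mass_cvg => //; first exact: smooth_continuous.
move=> n; have sn : 0 < 2 ^+ n * s by rewrite mulr_gt0// exprn_gt0.
apply: (@compact_support_integrable _ _ _ xi (2^-1 / (2 ^+ n * s))).
  by apply: smooth_continuous; apply: smoothM => //; exact: smooth_scaled.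
by move=> x xr; rewrite (scaled_support _ sn etav)// mul0r.
Qed.

(** By [(d - 1) q < d] the gradients of the terms decay geometrically in [L^q], so the bound is
    uniform in the number of scales and in the centre. *)
Lemma potential_gradient_bound s : 0 < s -> exists2 C : R, 0 <= C & forall xi n,
  (\sum_(i < d) Lp_norm Om q (partial i (potential s xi n)) <= C%:E)%E.
Proof.
move=> s0.
have H i : exists C : R, 0 <= C /\ forall xi n,
    (Lp_norm Om q (partial i (potential s xi n)) <= C%:E)%E.
  have [a [rho [a0 rho01 H]]] := Lnorm_scaled_geometric q0 s0 dq (mpb i) (pbN i).
  exists (a / (1 - rho)); split.
    by rewrite divr_ge0// subr_ge0 ltW//; case/andP: rho01.
  move=> xi n; rewrite (_ : partial i _ = fun x =>
    \sum_(0 <= j < n) scaled d.-1 (2 ^+ j * s) xi (partial i b) x); last first.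
    by apply/funext => x; exact: partial_potential.
  have ms j : measurable_fun setT (scaled d.-1 (2 ^+ j * s) xi (partial i b)).
    exact: (measurable_scaled _ _ _ (mpb i)).
  apply: (le_trans (Lp_norm_le_Lnorm oOm q0 _)); first exact: measurable_sum.
  by apply: Lnorm_sum_geometric => //; exact: ltW.
have [C HC] := choice H.
exists (\sum_(i < d) C i); first by apply: sumr_ge0 => i _; have [] := HC i.
by move=> xi n; rewrite -sumEFin; apply: lee_sum => i _; have [_] := HC i.
Qed.

Hypothesis meta : 0 < \int[leb]_x eta x.

(* As [n] tends to infinity, the Green identity for [potential b s xi n] expresses
   [phi xi] through [phi] and its gradient, integrated against [L^q] functions. *)
Lemma morrey_test : exists2 C : R, 0 <= C & forall phi x, test_function Om phi ->
  `|phi x| <= C * fine (W1p_norm Om p phi).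
Proof.
have [C C0 HC] := potential_gradient_bound ltr01.
set m := \int[leb]_x eta x.
have etaN : ('N[leb]_(q%:E)[EFin \o eta] < +oo)%E.
  apply: (compact_support_Lnorm (a := 0) (r := 2^-1)) => //; first exact: smooth_continuous.
  by move=> x; rewrite subr0; exact: etav.
have eN0 : (0 <= 'N[leb]_(q%:E)[EFin \o eta])%E by exact: Lnorm_ge0.
have eNf : 'N[leb]_(q%:E)[EFin \o eta]%E \is a fin_num by rewrite ge0_fin_numE.
set D := fine 'N[leb]_(q%:E)[EFin \o eta]%E.
have D0 : 0 <= D by exact: fine_ge0.
(* [C] bounds the gradient term and [D] the integral of [phi] against the coarse kernel; the point
   value appears multiplied by the mass [m]. *)
exists ((C + D) / m); first by rewrite divr_ge0 ?addr_ge0// ltW.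
move=> phi x tphi; set W := fine _.
have Wp := in_W1p_test p0 tphi.
have WE : W%:E = W1p_norm Om p phi by rewrite fineK// W1p_norm_fin_num.
have W0 : 0 <= W by rewrite fine_ge0// W1p_norm_ge0.
have Lphi := in_Lp_test p0 tphi.
have A : `|phi x * m - \int[leb]_(y in Om) (scaled d 1 x eta y * phi y)| <= C * W.
  apply: (cvg_norm_le (potential_green_cvg ltr01 tphi)) => n; rewrite -lee_fin.
  apply: (@le_trans _ _ (\sum_(i < d) `|\int[leb]_(y in Om)
      (partial i (potential 1 x n) y * partial i phi y)|%:E)%E).
    by rewrite sumEFin lee_fin ler_norm_sum.
  apply: (@le_trans _ _ (\sum_(i < d) Lp_norm Om q (partial i (potential 1 x n)) * W%:E)%E).
    apply: lee_sum => i _.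
    have sp : smooth (partial i (potential 1 x n)).
      by apply: smooth_derive; exact: smooth_potential.
    have tdphi := test_function_derive (delta_mx ord0 i) tphi.
    have L1 : in_Lp Om q (partial i (potential 1 x n)).
      apply/in_LpP => //; split.
        apply: measurable_fun_restrict => //; apply: measurable_funTS.
        by apply: continuous_measurable_rV; exact: smooth_continuous.
      apply: (@le_lt_trans _ _ C%:E); last exact: ltry.
      apply: le_trans (HC x n); rewrite (bigD1 i)//= leeDl// sume_ge0// => j _.
      exact: Lp_norm_ge0.
    have [_ /le_trans] := hoelder_Om oOm q0 p0 qp L1 (in_Lp_test p0 tdphi).
    apply; rewrite lee_wpmul2l ?Lp_norm_ge0// WE.
    rewrite -(Lp_norm_weak_partial oOm p (is_weak_partial_smooth Om i (proj1 (test_functionP tphi)))).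
    exact: Lp_weak_partial_le_W1p_norm.
  rewrite -ge0_sume_distrl => [|i _]; last exact: Lp_norm_ge0.
  by rewrite EFinM lee_wpmul2r// lee_fin.
have B : `|\int[leb]_(y in Om) (scaled d 1 x eta y * phi y)| <= D * W.
  have ms : measurable_fun setT (scaled d 1 x eta).
    by apply: measurable_scaled; apply: continuous_measurable_rV; exact: smooth_continuous.
  have N1 : (Lp_norm Om q (scaled d 1 x eta) <= D%:E)%E.
    rewrite (le_trans (Lp_norm_le_Lnorm oOm q0 ms))// Lnorm_scaled//.
      by rewrite powR1 mul1e fineK.
    by apply: continuous_measurable_rV; exact: smooth_continuous.
  have L1 : in_Lp Om q (scaled d 1 x eta).
    apply/in_LpP => //; split.
      by apply: measurable_fun_restrict => //; exact: measurable_funTS.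
    by rewrite (le_lt_trans N1)// ltry.
  have [_ H] := hoelder_Om oOm q0 p0 qp L1 Lphi.
  rewrite -lee_fin (le_trans H)// EFinM WE lee_pmul ?Lp_norm_ge0//.
  exact: Lp_le_W1p_norm.
have mN : `|m| = m by exact: gtr0_norm.
rewrite mulrAC ler_pdivlMr// -[X in _ * X <= _]mN -normrM mulrDl.
rewrite -(subrK (\int[leb]_(y in Om) (scaled d 1 x eta y * phi y)) (phi x * _)).
by rewrite (le_trans (ler_normD _ _))// lerD.
Qed.

End morrey.
End fundamental_solution.

(** * The embedding into C_0 *)

Section conjugate_exponents.
Context {R : realType}.
Implicit Types q p : R.

Lemma conjexpE q : q != 0 -> q != 1 -> conjexp q = q / (q - 1).
Proof.
move=> q0 q1; rewrite /conjexp /hoelder_conjugate/= eqe (negbTE q0).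
by rewrite -EFinB inver subr_eq0 (negbTE q1).
Qed.

(** At 0 and 1 the value of [conjexp] is 0, and for the other [q < 1] the formula [q / (q - 1)]
    gives less than 2. The bound on the conjugate exponent thus recovers the range of [q]. *)
Lemma conjexp_gt2 q : 2 < conjexp q ->
  [/\ 1 < q, q < 2, q^-1 + (conjexp q)^-1 = 1 & conjexp q = q / (q - 1)].
Proof.
have [->|q0] := eqVneq q 0.
  by rewrite /conjexp hoelder_conjugate0/= => /(lt_trans (ltr0Sn R 1)); rewrite ltxx.
have [->|q1] := eqVneq q 1.
  by rewrite /conjexp hoelder_conjugate1/= => /(lt_trans (ltr0Sn R 1)); rewrite ltxx.
rewrite conjexpE// => h.
have d0 : q - 1 != 0 by rewrite subr_eq0.
have q_gt1 : 1 < q.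
  rewrite ltNge; apply/negP => qle; have qn : q - 1 < 0 by rewrite subr_lt0 lt_neqAle q1.
  by move: h; rewrite ltr_ndivlMr// => h; lra.
split => //; last by field; rewrite q0 d0.
by move: h; rewrite ltr_pdivlMr ?subr_gt0// => h; lra.
Qed.

Lemma conjexp2 : conjexp 2 = 2 :> R.
Proof. by rewrite /conjexp hoelder_conjugate2. Qed.

Lemma conjexp_lt q p : 1 < q -> q < p -> conjexp p < conjexp q.
Proof.
move=> q1 qp; have p1 := lt_trans q1 qp.
have nz (t : R) : 1 < t -> t != 0 /\ t != 1 by move=> t1; rewrite !gt_eqF// (lt_trans ltr01).
have [[a1 a2] [b1 b2]] := (nz _ q1, nz _ p1).
rewrite !conjexpE// ltr_pdivrMr ?subr_gt0// mulrAC ltr_pdivlMr ?subr_gt0//; lra.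
Qed.

Lemma conjexpK q : 1 < q -> conjexp (conjexp q) = q.
Proof.
move=> q1; rewrite /conjexp; have nz : q != 0 /\ q != 1 by rewrite !gt_eqF// (lt_trans ltr01).
have -> : (fine (hoelder_conjugate q%:E))%:E = hoelder_conjugate q%:E.
  rewrite fineK// /hoelder_conjugate/= eqe (negbTE nz.1).
  by rewrite -EFinB inver subr_eq0 (negbTE nz.2).
by rewrite hoelder_conjugateK.
Qed.

End conjugate_exponents.

Section c0_embedding.
Context {R : realType} {d : nat}.
Local Notation leb := (@lebesgue_rV R d).
Implicit Types (v w phi : 'rV[R]_d -> R).

Lemma within_continuous_measurable_rV (A : set 'rV[R]_d) v : measurable A ->
  {within A, continuous v} -> measurable_fun A v.
Proof.
move=> mA /continuousP cv; apply: (measurability _ (RGenOpens.measurableE R)) => //.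
move=> _ [_ [a [b ->]] <-].
have /open_subspaceP[V oV VA] := cv _ (@interval_open R (BRight a) (BLeft b) isT isT).
rewrite setIC -VA; apply: measurableI => //; exact: open_measurable_rV.
Qed.

Variables (Om : set 'rV[R]_d) (oOm : open Om).
Let mOm : measurable Om := open_measurable_rV oOm.

Lemma in_C0_lin (a : R) v w : in_C0 Om v -> in_C0 Om w ->
  in_C0 Om (fun x => a * v x + w x).
Proof.
move=> [cv v0] [cw w0]; split=> [x|x cx nx]; last by rewrite v0// w0// mulr0 addr0.
apply: (@cvgD _ _ _ _ _ (fun x => a * v x) w); last exact: cw.
by apply: cvgMr; exact: cv.
Qed.

(** Two continuous functions that differ at a point of [Om] differ on a ball, which has positive
    measure; elsewhere on the closure both are 0. *)
Lemma in_C0_ae_unique v w : in_C0 Om v -> in_C0 Om w ->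
  {ae leb, forall x, Om x -> v x = w x} ->
  forall x : 'rV[R]_d, closure Om x -> v x = w x.
Proof.
move=> [cv v0] [cw w0] [N [mN N0 HN]] x cx.
have [Ox|nx] := pselect (Om x); last by rewrite v0// w0.
have cont (u : 'rV[R]_d -> R) : {within closure Om, continuous u} -> {for x, continuous u}.
  move=> cu; have := @continuous_subspaceW _ _ Om _ u (@subset_closure _ Om) cu.
  by rewrite continuous_open_subspace// => /(_ x); rewrite inE; exact.
apply/eqP; rewrite -subr_eq0; apply/negPn/negP => vw.
have cf : {for x, continuous (fun y => `|v y - w y|)}.
  have vw' : v y - w y @[y --> x] --> v x - w x.
    have cv' : v y @[y --> x] --> v x by exact: cont.
    have cw' : w y @[y --> x] --> w x by exact: cont.
    exact: (cvgB cv' cw').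
  exact: cvg_norm vw'.
have : \forall y \near x, Om y /\ 0 < `|v y - w y|.
  apply: filterI; first exact: open_nbhs_nbhs.
  by apply: (cvgr_gt _ cf); rewrite normr_gt0.
move=> /nbhs_ballP[r /= r0 rH].
have : (leb (ball x r) <= leb N)%E.
  apply: le_measure; rewrite ?inE//; first by apply: open_measurable_rV; exact: ball_open.
  move=> y /rH[Oy vwy]; apply: HN => /= /(_ Oy) E.
  by move: vwy; rewrite E subrr normr0 ltxx.
by rewrite N0 lebesgue_rV_ball// lee_fin leNgt exprn_gt0// mulrn_wgt0.
Qed.

Variables (p C : R) (p1 : 1 < p) (C0 : 0 <= C).
Hypothesis morrey : forall phi x, test_function Om phi ->
  `|phi x| <= C * fine (W1p_norm Om p phi).
Let p0 : 0 < p := lt_trans ltr01 p1.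

Lemma le_add_harmonic (a b c : R) : (forall n, a <= b + c * n.+1%:R^-1) -> a <= b.
Proof.
move=> H; have [c0|c0] := leP c 0.
  by rewrite (le_trans (H 0%N))// gerDl invr1 mulr1.
apply/ler_addgt0Pr => e e0; have ec : 0 < e / c by rewrite divr_gt0.
have [n _ /(_ n (leqnn _))/= nec] := near_infty_natSinv_lt (PosNum ec).
by rewrite (le_trans (H n))// lerD2l mulrC -ler_pdivlMr// ltW.
Qed.

Let fine_W_lin (a : R) v w : in_W1p Om p v -> in_W1p Om p w ->
  fine (W1p_norm Om p (fun x => a * v x + w x)) <=
  `|a| * fine (W1p_norm Om p v) + fine (W1p_norm Om p w).
Proof.
move=> hv hw; have hvw := in_W1p_lin oOm a (ltW p1) hv hw.
rewrite -lee_fin EFinD EFinM !fineK ?(W1p_norm_fin_num oOm)//.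
exact: W1p_norm_lin (ltW p1) hv hw.
Qed.

(** By the Morrey bound an approximating sequence of test functions is uniformly Cauchy. Its uniform
    limit is continuous and vanishes off [Om], and it agrees with [v] almost everywhere because the
    [L^p] distance is 0 by [Lnorm_cvg_le]. *)
Lemma C0_representative v : in_W1p0 Om p v -> exists w, [/\ in_C0 Om w,
  {ae leb, forall x, Om x -> w x = v x} &
  forall x, `|w x| <= C * fine (W1p_norm Om p v)].
Proof.
move=> [hv happrox]; pose e n : R := n.+1%:R^-1.
have e0 n : 0 < e n by rewrite invr_gt0.
have emono n m : (n <= m)%N -> e m <= e n.
  by move=> nm; rewrite lef_pV2 ?posrE// ler_nat ltnS.
have [phi tphi phiv] : exists2 phi : nat -> 'rV[R]_d -> R,
    forall n, test_function Om (phi n) &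
    forall n, (W1p_norm Om p (v \- phi n)%R < (e n)%:E)%E.
  have /choice[phi H] : forall n, exists phi,
      test_function Om phi /\ (W1p_norm Om p (v \- phi)%R < (e n)%:E)%E.
    by move=> n; have [phi] := happrox _ (e0 n); exists phi.
  by exists phi => n; have [] := H n.
have hphi n := in_W1p_test p0 (tphi n).
have hd n : in_W1p Om p (v \- phi n).
  rewrite (_ : v \- phi n = fun x => -1 * phi n x + v x); last first.
    by apply/funext => x; rewrite mulN1r addrC.
  exact: in_W1p_lin (ltW p1) (hphi n) hv.
have hdN n : fine (W1p_norm Om p (v \- phi n)) <= e n.
  by rewrite -lee_fin fineK ?(W1p_norm_fin_num oOm)// ltW.
have diff n m x : `|phi n x - phi m x| <= C * (e n + e m).
  have t : test_function Om (fun x => -1 * phi m x + phi n x) by exact: test_function_lin.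
  have := morrey x t; rewrite mulN1r addrC => /le_trans; apply; rewrite ler_wpM2l//.
  rewrite (_ : (fun x => _) = (fun x => -1 * (v \- phi n) x + (v \- phi m) x)); last first.
    by apply/funext => y /=; ring.
  rewrite (le_trans (fine_W_lin _ (hd n) (hd m)))// normrN1 mul1r lerD//.
have cau x : cvgn (fun n => phi n x).
  apply: cauchy_cvg; apply: cauchy_exP => r r0.
  have r1 : 0 < r / (2 * C + 1) by rewrite divr_gt0// ltr_wpDl// mulr_ge0.
  have [N _ /(_ N (leqnn _))/= eN] := near_infty_natSinv_lt (PosNum r1).
  exists (phi N x); exists N => // n /= Nn.
  rewrite /ball/= (le_lt_trans (diff N n x))//.
  apply: (@le_lt_trans _ _ ((2 * C + 1) * e N)); last by rewrite mulrC -ltr_pdivlMr// ltr_wpDl// mulr_ge0.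
  have := emono _ _ Nn; have := e0 N; have := C0; nra.
pose w x := limn (fun n => phi n x).
have wc x : phi n x @[n --> \oo] --> w x by exact: cau.
(* The limit is taken over indices [m + n >= n], for which [e (m + n) <= e n]. *)
have wd n x : `|phi n x - w x| <= 2 * C * e n.
  apply: (@cvg_norm_le _ (fun m => phi n x - phi (m + n)%N x)).
    by apply: cvgB; [exact: cvg_cst|rewrite (cvg_shiftn n (fun m => phi m x)); exact: wc].
  move=> m; rewrite (le_trans (diff _ _ _))//.
  have := emono _ _ (leq_addl m n); have := C0; nra.
have cw : continuous w.
  move=> x; apply/(@cvgrPdist_le _ _ _ (nbhs x)) => r r0.
  have r1 : 0 < r / (4 * C + 1) by rewrite divr_gt0// ltr_wpDl// mulr_ge0.
  have [N _ /(_ N (leqnn _))/=] := near_infty_natSinv_lt (PosNum r1); rewrite -/(e N) ltr_pdivlMr ?ltr_wpDl ?mulr_ge0// => eN.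
  have cphi := smooth_continuous (proj1 (test_functionP (tphi N))).
  move/cvgrPdist_le: (cphi x) => /(_ _ (e0 N)); apply: filterS => y Hy.
  rewrite (_ : w x - w y = - (phi N x - w x) + (phi N x - phi N y) + (phi N y - w y)); last by ring.
  rewrite (le_trans (ler_normD _ _))// (le_trans (lerD (ler_normD _ _) (lexx _)))// normrN.
  have := wd N x; have := wd N y; move: eN Hy; lra.
have w0 x : ~ Om x -> w x = 0.
  move=> nx; apply: cvg_lim => //.
  rewrite (_ : (fun n => _) = cst 0); first exact: cvg_cst.
  apply/funext => n; have [_ [K [_ KOm phi0 _]]] := test_functionP (tphi n).
  by apply: phi0 => /KOm.
exists w; split.
- split; first exact: continuous_subspaceT.
  by move=> x _; exact: w0.
- have mv : measurable_fun Om v by exact: (in_Lp_measurable oOm (proj1 hv)).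
  have mw : measurable_fun Om w by apply: measurable_funTS; exact: continuous_measurable_rV.
  have mvw : measurable_fun setT ((fun x => v x - w x) \_ Om).
    by apply: (measurable_fun_restrict oOm); exact: measurable_funB.
  have N0 : Lp_norm Om p (fun x => v x - w x) = 0%E.
    apply/eqP; rewrite eq_le Lp_norm_ge0 andbT.
    have H k : (Lp_norm Om p (fun x => v x - w x)%R <= (e k)%:E)%E.
      apply: (@Lnorm_cvg_le _ _ _ leb p (e k) (fun n => (v \- phi (n + k)%N) \_ Om)) => //.
      - exact: ltW.
      - move=> n; apply: (measurable_fun_restrict oOm).
        exact: (in_Lp_measurable oOm (proj1 (hd (n + k)%N))).
      - move=> x; under eq_fun do rewrite patchE; rewrite patchE.
        case: ifP => _; last exact: cvg_cst.
        by apply: cvgB; [exact: cvg_cst|rewrite (cvg_shiftn k (fun n => phi n x)); exact: wc].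
      - move=> n; apply: (le_trans (Lp_le_W1p_norm _ _ _)).
        by rewrite (le_trans (ltW (phiv _)))// lee_fin emono// leq_addl.
    have fN : Lp_norm Om p (fun x => v x - w x)%R \is a fin_num.
      by rewrite ge0_fin_numE ?Lp_norm_ge0// (le_lt_trans (H 0%N))// ltry.
    rewrite -(fineK fN) lee_fin; apply: (@le_add_harmonic _ _ 1) => n.
    by rewrite add0r mul1r -lee_fin fineK//; exact: H.
  have mE : measurable_fun setT (EFin \o ((fun x => v x - w x) \_ Om)) by exact/measurable_EFinP.
  have p0E : (0 < p%:E)%E by rewrite lte_fin.
  have := Lnorm_eq0_eq0 mE p0E N0.
  apply: filterS => x /(_ I) /= [] + Ox; rewrite patchE mem_set// => /eqP.
  by rewrite subr_eq0 => /eqP.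
(* One [C] comes from the Morrey bound for [phi n], two from the distance of [phi n] to its
   limit. *)
- move=> x; apply: (@le_add_harmonic _ _ (3 * C)) => n; rewrite -/(e n).
  have H1 : `|phi n x| <= C * (e n + fine (W1p_norm Om p v)).
    rewrite (le_trans (morrey _ (tphi n)))// ler_wpM2l//.
    rewrite (_ : phi n = (fun x => -1 * (v \- phi n) x + v x)); last first.
      by apply/funext => y /=; ring.
    by rewrite (le_trans (fine_W_lin _ (hd n) hv))// normrN1 mul1r lerD2r.
  have := wd n x; have := ler_normB (phi n x) (phi n x - w x).
  rewrite subKr; move: H1; lra.
Qed.

(** [C0_embedding] is a choice among representatives; uniqueness on the closure carries the bound
    from the constructed one to the chosen one. *)
Lemma C0_embeddingP v : in_W1p0 Om p v -> [/\ in_C0 Om (C0_embedding Om v),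
  {ae leb, forall x, Om x -> C0_embedding Om v x = v x} &
  forall x, closure Om x -> `|C0_embedding Om v x| <= C * fine (W1p_norm Om p v)].
Proof.
move=> hv; have [w [cw wv wb]] := C0_representative hv.
have [cE Ev] : in_C0 Om (C0_embedding Om v) /\
    {ae leb, forall x, Om x -> C0_embedding Om v x = v x}.
  by rewrite /C0_embedding; apply: (@xgetPex _ (cst 0) [set w | in_C0 Om w /\
    {ae leb, forall x, Om x -> w x = v x}]); exists w.
split => // x cx; rewrite (in_C0_ae_unique cE cw _ cx)//.
by apply: filterS2 Ev wv => y H1 H2 Oy; rewrite H1// H2.
Qed.

Lemma C0_embedding_lin (a : R) v w x : in_W1p0 Om p v -> in_W1p0 Om p w -> closure Om x ->
  C0_embedding Om (fun x => a * v x + w x) x =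
  a * C0_embedding Om v x + C0_embedding Om w x.
Proof.
move=> hv hw; have [c1 e1 _] := C0_embeddingP hv; have [c2 e2 _] := C0_embeddingP hw.
have [c3 e3 _] := C0_embeddingP (in_W1p0_lin oOm a (ltW p1) hv hw).
apply: (in_C0_ae_unique c3 (in_C0_lin a c1 c2)).
apply: filterS3 e1 e2 e3 => y H1 H2 H3 Oy.
by rewrite H1// H2// H3.
Qed.

Lemma C0_embedding_test phi x : test_function Om phi -> closure Om x ->
  C0_embedding Om phi x = phi x.
Proof.
move=> tphi; have [c1 e1 _] := C0_embeddingP (in_W1p0_test oOm p0 tphi).
have [sphi [K [_ KOm phi0 _]]] := test_functionP tphi.
apply: (in_C0_ae_unique c1) => //; split.
  by apply: continuous_subspaceT; exact: smooth_continuous.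
by move=> y _ ny; apply: phi0 => /KOm.
Qed.

Section measure_functional.
Variables (mu : {finite_measure set 'rV[R]_d -> \bar R}) (X : set 'rV[R]_d).
Hypotheses (cX : compact X) (XOm : X `<=` closure Om).

Lemma C0_embedding_integrable v : in_W1p0 Om p v ->
  mu.-integrable X (EFin \o C0_embedding Om v).
Proof.
move=> hv; have [[cE _] _ bE] := C0_embeddingP hv.
have mX := compact_measurable_rV cX.
apply: (@measurable_bounded_integrable _ _ _ mu _ X) => //.
- by rewrite -ge0_fin_numE//; exact: fin_num_measure.
- apply: within_continuous_measurable_rV => //; exact: continuous_subspaceW XOm cE.
- exists (C * fine (W1p_norm Om p v)); split; first exact: num_real.
  by move=> M HM; rewrite /globally/= => x /XOm /bE /le_trans; apply; exact: ltW.
Qed.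

(** By the Morrey bound the norm is at most [C mu(X)]; this is the right-hand side of the state
    equation for a nonnegative control. *)
Lemma measure_functional (q : R) : conjexp q = p ->
  in_Wm1p Om q (fun v => \int[mu]_(x in X) C0_embedding Om v x).
Proof.
move=> qp; rewrite /in_Wm1p qp.
have mX := compact_measurable_rV cX.
split.
  move=> a v w hv hw.
  have iv := C0_embedding_integrable hv; have iw := C0_embedding_integrable hw.
  rewrite -RintegralZl// -RintegralD//.
    by apply: eq_Rintegral => x; rewrite inE => Xx; rewrite C0_embedding_lin//; exact: XOm.
  by have := integrableZl mX a iv; apply: eq_integrable => // x _; rewrite /= EFinM.
have muX : mu X \is a fin_num by exact: fin_num_measure.
exists (C * fine (mu X)) => v hv.
have [_ _ bE] := C0_embeddingP hv; have iv := C0_embedding_integrable hv.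
have fW : W1p_norm Om p v \is a fin_num by exact: (W1p_norm_fin_num oOm (proj1 hv)).
rewrite -(fineK fW) lee_fin.
apply: (le_trans (le_normr_Rintegral mX iv)).
apply: (@le_trans _ _ (\int[mu]_(x in X) (C * fine (W1p_norm Om p v)))).
  apply: le_Rintegral => //.
  - exact: integrable_norm.
  - by apply: finite_measure_integrable_cst.
  - by move=> x /XOm; exact: bE.
by rewrite Rintegral_cst// mulrAC.
Qed.

End measure_functional.

End c0_embedding.

(** * The state of a point source *)

Section point_source.
Context {R : realType} {d : nat}.
Local Notation leb := (@lebesgue_rV R d).
Variables (eta b : 'rV[R]_d -> R).
Hypotheses (seta : smooth eta) (sb : smooth b) (eta0 : forall x, 0 <= eta x).
Hypotheses (etav : forall x, 2^-1 < `|x| -> eta x = 0) (bv : forall x, 2^-1 < `|x| -> b x = 0).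
Hypothesis lapb : forall x, lap b x = - (2 ^+ d * eta (2 *: x) - eta x).
Hypothesis d2 : (1 < d)%N.
Variables (Om : set 'rV[R]_d) (oOm : open Om) (p q : R).
Hypotheses (p1 : 1 < p) (q1 : 1 < q) (qp : q^-1 + p^-1 = 1) (dq : d.-1%:R * q < d%:R).
Variables (s : R) (xi : 'rV[R]_d).
Hypotheses (s0 : 0 < s) (xiOm : [set x | `|x - xi| <= 2^-1 / s] `<=` Om).
Let d0 : (0 < d)%N. Proof. exact: ltnW. Qed.
Let p0 : 0 < p := lt_trans ltr01 p1.
Let q0 : 0 < q := lt_trans ltr01 q1.
Let mOm : measurable Om := open_measurable_rV oOm.

(** The truncated fundamental solution around [xi]: its source is the mass of [eta] at [xi] minus
    the dilate of [eta]. *)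
Definition point_source_state := scaled_series d.-2 s xi b.
Local Notation w := point_source_state.
Local Notation S := (potential b s xi).

Lemma potential_support n x : 2^-1 / s < `|x - xi| -> S n x = 0.
Proof.
move=> xr; rewrite /potential big1// => j _.
apply: (@scaled_support _ _ _ _ 2^-1) => //; first by rewrite mulr_gt0// exprn_gt0.
apply: le_lt_trans xr.
rewrite ler_wpM2l// lef_pV2 ?posrE ?mulr_gt0 ?exprn_gt0// ler_peMl ?(ltW s0)//.
by rewrite exprn_ege1// ler1n.
Qed.

Lemma test_potential n : test_function Om (S n).
Proof.
apply: (test_function_cball _ _ xiOm); first exact: smooth_potential.
exact: potential_support.
Qed.

Let mb : measurable_fun setT b.
Proof. by apply: continuous_measurable_rV; exact: smooth_continuous. Qed.

Let cpb i : continuous (partial i b : 'rV[R]_d -> R).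
Proof. exact: (smooth_continuous (smooth_derive _ sb)). Qed.

Let mpb i : measurable_fun setT (partial i b).
Proof. by apply: continuous_measurable_rV; exact: cpb. Qed.

Let pbv i x : 2^-1 < `|x| -> partial i b x = 0.
Proof.
move=> xr; apply: (@derive_outside _ _ b _ 0 2^-1); last by rewrite subr0.
by move=> y; rewrite subr0; exact: bv.
Qed.

Let fin_N (r : R) f : 0 < r -> continuous f -> (forall x : 'rV[R]_d, 2^-1 < `|x| -> f x = 0) ->
  ('N[leb]_(r%:E)[EFin \o f] < +oo)%E.
Proof.
move=> r0 cf fv; apply: (compact_support_Lnorm (a := 0) (r := 2^-1)) => //.
by move=> x; rewrite subr0; exact: fv.
Qed.

Lemma point_source_Lnorm (r : R) : 1 <= r -> d.-2%:R * r < d%:R ->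
  [/\ measurable_fun setT w, ('N[leb]_(r%:E)[EFin \o w] < +oo)%E &
   forall e : R, 0 < e -> \forall n \near \oo,
     ('N[leb]_(r%:E)[EFin \o (fun x => w x - S n x)%R] < e%:E)%E].
Proof.
move=> r1 dr; apply: (scaled_series_Lnorm xi r1 s0 d0 dr bv mb).
by apply: fin_N => //; [exact: lt_le_trans r1|exact: smooth_continuous].
Qed.

Lemma in_Lp_point_source (r : R) : 1 <= r -> d.-2%:R * r < d%:R -> in_Lp Om r w.
Proof.
move=> r1 dr; have [mw Nw _] := point_source_Lnorm r1 dr.
apply/in_LpP; split; first by apply: (measurable_fun_restrict oOm); exact: measurable_funTS.
by apply: le_lt_trans (Lp_norm_le_Lnorm oOm _ mw) Nw; exact: lt_le_trans r1.
Qed.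

Let d2q : d.-2%:R * q < d%:R.
Proof.
by apply: le_lt_trans dq; rewrite ler_wpM2r ?(ltW q0)// ler_nat -subn2 -subn1 leq_sub2l.
Qed.

Let g i := scaled_series d.-1 s xi (partial i b).

Let gL i : [/\ measurable_fun setT (g i), ('N[leb]_(q%:E)[EFin \o g i] < +oo)%E &
   forall e : R, 0 < e -> \forall n \near \oo,
     ('N[leb]_(q%:E)[EFin \o (fun x => g i x - partial i (S n) x)%R] < e%:E)%E].
Proof.
have [mg Ng cg] := scaled_series_Lnorm xi (ltW q1) s0 d0 dq (@pbv i) (@mpb i) (fin_N q0 (@cpb i) (@pbv i)).
split => // e /cg; apply: filterS => n; congr (is_true (_ < _)%E); congr Lnorm.
by apply/funext => x /=; rewrite partial_potential.
Qed.

Let LpN r f : 0 < r -> measurable_fun setT f -> forall e : R,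
  ('N[leb]_(r%:E)[EFin \o f] < e%:E)%E -> (Lp_norm Om r f < e%:E)%E.
Proof. by move=> r0 mf e; apply: le_lt_trans; exact: Lp_norm_le_Lnorm. Qed.

Let mS n : measurable_fun setT (S n).
Proof. by apply: continuous_measurable_rV; apply: smooth_continuous; exact: smooth_potential. Qed.

Let mpS i n : measurable_fun setT (partial i (S n)).
Proof.
apply: continuous_measurable_rV; apply: smooth_continuous.
by apply: smooth_derive; exact: smooth_potential.
Qed.

(** The truncations [S n] are smooth, and they and their gradients converge in [L^q]; weak
    derivatives pass to the limit. *)
Let wg i : is_weak_partial Om i w (g i).
Proof.
have [mw Nw cw] := point_source_Lnorm (ltW q1) d2q; have [mg Ng cg] := gL i.
have tdS n : test_function Om (partial i (S n)).
  by apply: test_function_derive; exact: test_potential.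
apply: (is_weak_partial_lim oOm q1 p1 qp (V := S) (G := fun n => partial i (S n))).
- by move=> n; apply: is_weak_partial_smooth; exact: smooth_potential.
- by move=> n; apply: in_Lp_test => //; exact: test_potential.
- by move=> n; apply: in_Lp_test.
- exact: in_Lp_point_source (ltW q1) d2q.
- apply/in_LpP; split; first by apply: (measurable_fun_restrict oOm); exact: measurable_funTS.
  by apply: le_lt_trans (Lp_norm_le_Lnorm oOm q0 mg) Ng.
move=> e e0; have [n _ /(_ n (leqnn _))[H1 H2]] := filterI (cw _ e0) (cg _ e0).
exists n; split; apply: LpN => //; exact: measurable_funB.
Qed.

Lemma in_W1p_point_source : in_W1p Om q w.
Proof.
split; first exact: in_Lp_point_source (ltW q1) d2q.
move=> i; exists (g i) => //; have [mg Ng cg] := gL i.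
apply/in_LpP; split; first by apply: (measurable_fun_restrict oOm); exact: measurable_funTS.
by apply: le_lt_trans (Lp_norm_le_Lnorm oOm q0 mg) Ng.
Qed.

Lemma point_source_W1p_cvg (e : R) : 0 < e -> \forall n \near \oo,
  (W1p_norm Om q (w \- S n)%R < e%:E)%E.
Proof.
move=> e0; have [mw _ cw] := point_source_Lnorm (ltW q1) d2q.
pose t := e / d.+2%:R; have t0 : 0 < t by rewrite divr_gt0.
have H2 : \forall n \near \oo, forall i, (Lp_norm Om q (fun x => g i x - partial i (S n) x)%R < t%:E)%E.
  apply: filter_forall => i; have [mg _ cg] := gL i.
  apply: filterS (cg _ t0) => n; apply: LpN => //; exact: measurable_funB.
have H1 := cw _ t0.
apply: filterS2 H1 H2 => n H1 H2; rewrite /W1p_norm.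
apply: (@le_lt_trans _ _ (t%:E + \sum_(i < d) t%:E)%E).
  apply: leeD; first by apply/ltW/LpN => //; exact: measurable_funB.
  apply: lee_sum => i _; apply/ltW; apply: le_lt_trans (H2 i).
  have wp : is_weak_partial Om i (w \- S n) (fun x => -1 * partial i (S n) x + g i x).
    rewrite (_ : w \- S n = fun x => -1 * S n x + w x); last first.
      by apply/funext => x /=; rewrite mulN1r addrC.
    apply: (is_weak_partial_lin oOm) => //; apply: is_weak_partial_smooth; exact: smooth_potential.
  rewrite (Lp_norm_weak_partial oOm q wp) le_eqVlt; apply/orP; left; apply/eqP.
  by congr (Lp_norm Om q _); apply/funext => x; rewrite mulN1r addrC.
rewrite sumEFin -EFinD lte_fin sumr_const card_ord -mulrS -mulr_natr.
by rewrite /t -mulrA gtr_pMr// mulrC ltr_pdivrMr// mul1r ltr_nat.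
Qed.

Lemma in_W1p0_point_source : in_W1p0 Om q w.
Proof.
split; first exact: in_W1p_point_source.
move=> e /point_source_W1p_cvg [n _ /(_ n (leqnn _)) H].
by exists (S n) => //; exact: test_potential.
Qed.

Variables (C : R) (C0 : 0 <= C).
Hypothesis morrey : forall phi x, test_function Om phi ->
  `|phi x| <= C * fine (W1p_norm Om p phi).

Let source v := C0_embedding Om v xi * \int[leb]_x eta x -
  \int[leb]_(x in Om) (scaled d s xi eta x * v x).

Let xi_in : Om xi.
Proof. by apply: xiOm; rewrite /= subrr normr0 divr_ge0// ltW. Qed.

Let th : test_function Om (scaled d s xi eta).
Proof.
apply: (test_function_cball _ _ xiOm); first exact: smooth_scaled.
exact: scaled_support.
Qed.

Let grad_pairing_sym y z : grad_pairing Om y z = grad_pairing Om z y.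
Proof.
by apply: eq_Rintegral => x _; apply: eq_bigr => i _; rewrite mulrC.
Qed.

Let grad_pairing_linr (a : R) y v z : in_W1p Om q y -> in_W1p Om p v -> in_W1p Om p z ->
  grad_pairing Om y (fun x => a * v x + z x) = a * grad_pairing Om y v + grad_pairing Om y z.
Proof.
move=> hy hv hz; have pq : p^-1 + q^-1 = 1 by rewrite addrC.
have := grad_pairing_linl oOm p1 q1 pq a hv hz hy.
rewrite (grad_pairing_sym (fun x => a * v x + z x) y).
by rewrite (grad_pairing_sym v y) (grad_pairing_sym z y).
Qed.

(** The equation for [w] is proved by density: [defect] is linear, bounded by the [W^{1,p}] norm,
    and zero on test functions, hence zero on [W_0^{1,p}]. *)
Let defect v := grad_pairing Om w v - source v.

Let defect_lin (a : R) v z : in_W1p0 Om p v -> in_W1p0 Om p z ->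
  defect (fun x => a * v x + z x) = a * defect v + defect z.
Proof.
move=> hv hz; have hw := in_W1p_point_source.
have E1 : grad_pairing Om w (fun x => a * v x + z x) =
    a * grad_pairing Om w v + grad_pairing Om w z.
  exact: (grad_pairing_linr a hw (proj1 hv) (proj1 hz)).
have E2 := C0_embedding_lin oOm p1 C0 morrey a hv hz (subset_closure xi_in).
have Lh := in_Lp_test q0 th.
have iv := (hoelder_Om oOm q0 p0 qp Lh (proj1 (proj1 hv))).1.
have iz := (hoelder_Om oOm q0 p0 qp Lh (proj1 (proj1 hz))).1.
have iav : leb.-integrable Om (EFin \o (fun x => a * (scaled d s xi eta x * v x))).
  by have := integrableZl mOm a iv; apply: eq_integrable => // x _; rewrite /= EFinM.
have E3 : \int[leb]_(x in Om) (scaled d s xi eta x * (a * v x + z x)) =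
    a * \int[leb]_(x in Om) (scaled d s xi eta x * v x) +
    \int[leb]_(x in Om) (scaled d s xi eta x * z x).
  rewrite -RintegralZl// -RintegralD//.
  by apply: eq_Rintegral => x _; rewrite mulrDr mulrCA.
rewrite /defect /source E1 E2 E3.
move: (grad_pairing _ _ _) (grad_pairing _ _ _) (C0_embedding _ _ _) (C0_embedding _ _ _)
  (Rintegral _ _ _) (Rintegral _ _ _) (Rintegral _ _ _).
by move=> *; ring.
Qed.

Let defect_bound : exists2 K : R, 0 <= K & forall v, in_W1p0 Om p v ->
  `|defect v| <= K * fine (W1p_norm Om p v).
Proof.
set m := \int[leb]_x eta x.
have Lh := in_Lp_test q0 th.
set D := fine (Lp_norm Om q (scaled d s xi eta)).
have D0 : 0 <= D by rewrite fine_ge0// Lp_norm_ge0.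
set W := fine (W1p_norm Om q w).
have W0 : 0 <= W by rewrite fine_ge0// W1p_norm_ge0.
exists (W + (C * `|m| + D)) => [|v hv]; first by rewrite !addr_ge0 ?mulr_ge0.
have fv := W1p_norm_fin_num oOm (proj1 hv).
set V := fine (W1p_norm Om p v).
have VE : V%:E = W1p_norm Om p v by rewrite fineK.
have B1 : `|grad_pairing Om w v| <= W * V.
  rewrite -lee_fin EFinM VE /W fineK ?(W1p_norm_fin_num oOm)//; last exact: in_W1p_point_source.
  by apply: (grad_pairing_bound oOm q1 p1 qp) => //; [exact: in_W1p_point_source|exact: (proj1 hv)].
have B2 : `|C0_embedding Om v xi| <= C * V.
  by have [_ _] := C0_embeddingP oOm p1 C0 morrey hv; apply; exact: subset_closure.
have B3 : `|\int[leb]_(x in Om) (scaled d s xi eta x * v x)| <= D * V.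
  have [_] := hoelder_Om oOm q0 p0 qp Lh (proj1 (proj1 hv)).
  rewrite -lee_fin => /le_trans; apply; rewrite EFinM /D fineK ?in_Lp_fin_num//.
  by rewrite lee_wpmul2l ?Lp_norm_ge0// VE Lp_le_W1p_norm.
rewrite /defect /source (le_trans (ler_normB _ _))// mulrDl lerD//.
rewrite (le_trans (ler_normB _ _))// mulrDl lerD//.
by rewrite normrM mulrAC ler_wpM2r.
Qed.

(** The pairings of the truncations [S n] with [phi] have two limits: the source, by the Green
    identity, and the pairing with [w], by convergence in [W^{1,q}]. *)
Let defect_test phi : test_function Om phi -> defect phi = 0.
Proof.
move=> tphi; have [sphi _] := test_functionP tphi.
have hphi := in_W1p_test p0 tphi.
have c1 : grad_pairing Om (S n) phi @[n --> \oo] --> source phi.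
  rewrite /source (C0_embedding_test oOm p1 C0 morrey)//; last exact: subset_closure.
  have := potential_green_cvg seta sb eta0 etav lapb d2 oOm s0 tphi (xi := xi).
  apply: cvg_trans; apply: near_eq_cvg; apply: nearW => n.
  have hS := in_W1p_test q0 (test_potential n).
  rewrite (grad_pairingE oOm q1 p1 qp)//; apply: eq_bigr => i _.
  have sS := @smooth_potential _ _ _ sb s xi n.
  have a1 := weak_partial_ae oOm (is_weak_partial_smooth Om i sS).
  have a2 := weak_partial_ae oOm (is_weak_partial_smooth Om i sphi).
  have int1 := grad_pairing_integrable oOm q1 p1 qp i hS hphi.
  congr fine; apply: ae_eq_integral => //.
  - apply/measurable_EFinP; apply: measurable_funTS; apply: continuous_measurable_rV.
    by apply: smooth_continuous; apply: smoothM; exact: smooth_derive.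
  - by case/integrableP: int1.
  - by apply: filterS2 a1 a2 => x H1 H2 Ox; rewrite /= H1// H2.
have c2 : grad_pairing Om (S n) phi @[n --> \oo] --> grad_pairing Om w phi.
  set V := fine (W1p_norm Om p phi).
  have V0 : 0 <= V by rewrite fine_ge0// W1p_norm_ge0.
  have VE : V%:E = W1p_norm Om p phi by rewrite fineK// (W1p_norm_fin_num oOm).
  apply/cvgrPdist_le => e e0.
  have e1 : 0 < e / (V + 1) by rewrite divr_gt0// ltr_wpDl.
  apply: filterS (point_source_W1p_cvg e1) => n H.
  have hS := in_W1p_test q0 (test_potential n).
  have hd : in_W1p Om q (w \- S n).
    rewrite (_ : w \- S n = fun x => -1 * S n x + w x); last first.
      by apply/funext => x /=; rewrite mulN1r addrC.
    by apply: (in_W1p_lin oOm) => //; [exact: ltW|exact: in_W1p_point_source].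
  have -> : grad_pairing Om w phi - grad_pairing Om (S n) phi = grad_pairing Om (w \- S n) phi.
    rewrite (_ : w \- S n = fun x => -1 * S n x + w x); last first.
      by apply/funext => x /=; rewrite mulN1r addrC.
    rewrite (grad_pairing_linl oOm q1 p1 qp)//; last exact: in_W1p_point_source.
    by rewrite mulN1r addrC.
  rewrite -lee_fin (le_trans (grad_pairing_bound oOm q1 p1 qp hd hphi))// -VE.
  rewrite (@le_trans _ _ ((e / (V + 1))%:E * V%:E)%E)//.
    by rewrite lee_wpmul2r ?lee_fin// ltW.
  by rewrite -EFinM lee_fin mulrAC ler_pdivrMr ?ltr_wpDl// ler_wpM2l ?(ltW e0)// lerDl.
by rewrite /defect (cvg_unique (@Rhausdorff R) c2 c1) subrr.
Qed.

Lemma grad_pairing_point_source v : in_W1p0 Om p v ->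
  grad_pairing Om w v = C0_embedding Om v xi * \int[leb]_x eta x -
    \int[leb]_(x in Om) (scaled d s xi eta x * v x).
Proof.
move=> hv; apply/eqP; rewrite -subr_eq0 -/(source v) -/(defect v) -normr_eq0 eq_le normr_ge0 andbT.
have [K K0 HK] := defect_bound.
apply/ler_addgt0Pr => e e0; rewrite add0r.
have e1 : 0 < e / (K + 1) by rewrite divr_gt0// ltr_wpDl.
have [phi tphi H] := (proj2 hv) _ e1.
have hphi := in_W1p0_test oOm p0 tphi.
have hd : in_W1p0 Om p (v \- phi).
  rewrite (_ : v \- phi = fun x => -1 * phi x + v x); last first.
    by apply/funext => x /=; rewrite mulN1r addrC.
  by apply: (in_W1p0_lin oOm) => //; exact: ltW.
rewrite (_ : v = fun x => 1 * (v \- phi) x + phi x); last by apply/funext => x /=; ring.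
rewrite (defect_lin 1 hd hphi) (defect_test tphi) addr0 mul1r (le_trans (HK _ hd))//.
have H' : fine (W1p_norm Om p (v \- phi)) <= e / (K + 1).
  by rewrite -lee_fin fineK ?(W1p_norm_fin_num oOm)// ?ltW//; exact: (proj1 hd).
rewrite (le_trans (ler_wpM2l K0 H'))// mulrC mulrAC ler_pdivrMr ?ltr_wpDl//.
by rewrite ler_wpM2l ?(ltW e0)// lerDl.
Qed.

End point_source.

(** * Lipschitz domains and finite measures *)

Section lipschitz_domains.
Context {R : realType} {d : nat}.
Implicit Types (x v : 'rV[R]_d).

Lemma ler_norm_rV n (v : 'rV[R]_n) (M : R) : 0 <= M ->
  (forall i, `|v ord0 i| <= M) -> `|v| <= M.
Proof.
move=> M0 H; have [->//|/mx_norm_neq0] := eqVneq (`|v|) 0.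
by move=> [[i j] /=]; rewrite -[mx_norm v]/(`|v|) => ->; rewrite (ord1 i).
Qed.

Lemma ler_norm_mulmx (A : 'M[R]_d) : exists2 c : R, 0 <= c & forall v, `|v *m A| <= c * `|v|.
Proof.
exists (\sum_(j < d) \sum_(i < d) `|A i j|).
  by apply: sumr_ge0 => j _; apply: sumr_ge0.
move=> v; apply: ler_norm_rV => [|j].
  by rewrite mulr_ge0//; apply: sumr_ge0 => j _; apply: sumr_ge0.
rewrite mxE (le_trans (ler_norm_sum _ _ _))//.
apply: (@le_trans _ _ (\sum_(i < d) `|A i j| * `|v|)).
  by apply: ler_sum => i _; rewrite normrM mulrC ler_wpM2l// ler_coord_norm.
rewrite -mulr_suml ler_wpM2r// [leRHS](bigD1 j)//= lerDl.
by apply: sumr_ge0 => k _; apply: sumr_ge0.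
Qed.

(** At a boundary point, moving a little downwards in the graph coordinate leads to a point strictly
    below the graph, which has a neighbourhood free of points of [Om]. So a boundary point is not
    interior to the closure. *)
Lemma lipschitz_interior_closure (Om : set 'rV[R]_d) : lipschitz_domain Om ->
  interior (closure Om) `<=` Om.
Proof.
move=> [_ _ _ charts] x ixc; have cx : closure Om x := interior_subset ixc.
apply: contrapT => nx; have [A [j [g [L [r [AAT gL r0 HOm]]]]]] := charts x cx nx.
have ATA : A^T *m A = 1%:M by exact: mulmx1C.
move: ixc => /nbhs_ballP[e /= e0 He].
have [c c0 Hc] := ler_norm_mulmx A.
(* In the rotated coordinates [u] is the unit vector of the graph direction, so [x - t u] lies at
   depth at least [t] below the graph. *)
pose u : 'rV[R]_d := delta_mx ord0 j *m A^T.
pose t := Num.min e r / 2 / (`|u| + 1).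
have er0 : 0 < Num.min e r by rewrite lt_min e0.
have u1 : 0 < `|u| + 1 by rewrite ltr_wpDl.
have t0 : 0 < t by rewrite !divr_gt0.
have tu : t * `|u| <= Num.min e r / 2.
  by rewrite /t mulrAC ler_pdivrMr// ler_wpM2l ?lerDl// divr_ge0// ltW.
pose y := x - t *: u.
have yx : `|x - y| <= Num.min e r / 2.
  by rewrite /y opprB addrC subrK normrZ ger0_norm// ltW.
have half : Num.min e r / 2 < Num.min e r by rewrite ltr_pdivrMr// ltr_pMr// ltr1n.
have cy : closure Om y.
  apply: He; rewrite -ball_normE/=; apply: le_lt_trans yx _.
  by apply: lt_le_trans half _; rewrite ge_min lexx.
pose K := (1 + `|L|) * c; have K0 : 0 <= K by rewrite mulr_ge0// addr_ge0.
(* [r / 2] keeps a point of [Om] near [y] inside the chart. As [K] collects the Lipschitz constants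
   of the graph and of [A], [K dl < t] says that an error [dl] cannot compensate the drop [t]. *)
pose dl := Num.min (r / 2) (t / (K + 1)).
have dl0 : 0 < dl by rewrite lt_min !divr_gt0// ltr_wpDl.
have [z [Oz yz]] := cy _ (nbhsx_ballx y dl dl0).
rewrite -ball_normE/= in yz.
have xz : ball x r z.
  rewrite -ball_normE/= (_ : x - z = (x - y) + (y - z)); last by rewrite addrA subrK.
  rewrite (le_lt_trans (ler_normD _ _))//.
  rewrite [ltRHS]splitr ler_ltD//.
    by rewrite (le_trans yx)// ler_wpM2r// ge_min lexx orbT.
  by rewrite (lt_le_trans yz)// ge_min lexx.
have gz := (HOm _ xz).1 Oz.
have gx : (x *m A) ord0 j <= g (col' j (x *m A)).
  by rewrite leNgt; apply/negP => /(HOm _ (ballxx _ r0)).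
have yA : y *m A = x *m A - t *: delta_mx ord0 j.
  by rewrite mulmxBl -scalemxAl -mulmxA ATA mulmx1.
have ycol : col' j (y *m A) = col' j (x *m A).
  apply/rowP => i; rewrite yA !mxE eqxx/= eq_sym (negbTE (neq_lift j i)).
  by rewrite mulr0 subr0.
have yj : (y *m A) ord0 j = (x *m A) ord0 j - t.
  by rewrite yA !mxE !eqxx mulr1.
have dzy : `|z *m A - y *m A| <= c * dl.
  by rewrite -mulmxBl (le_trans (Hc _))// ler_wpM2l// distrC ltW.
have zj : (z *m A) ord0 j <= (y *m A) ord0 j + c * dl.
  rewrite -lerBlDl (le_trans (ler_norm _))// (le_trans _ dzy)//.
  have := ler_coord_norm (z *m A - y *m A) j.
  by rewrite !mxE.
have gzy : g (col' j (x *m A)) <= g (col' j (z *m A)) + `|L| * (c * dl).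
  rewrite -lerBlDl (le_trans (ler_norm _))// -ycol (le_trans (gL _ _))//.
  apply: (@le_trans _ _ (`|L| * `|col' j (y *m A) - col' j (z *m A)|)).
    by rewrite ler_wpM2r// ler_norm.
  rewrite ler_wpM2l//; apply: ler_norm_rV; first by rewrite mulr_ge0// ltW.
  move=> i; apply: le_trans dzy; rewrite distrC.
  have := ler_coord_norm (y *m A - z *m A) (lift j i).
  by rewrite !mxE.
have dlt : K * dl < t.
  apply: (@lt_le_trans _ _ ((K + 1) * dl)); first by rewrite ltr_pM2r// ltrDl.
  rewrite mulrC -ler_pdivlMr ?ltr_wpDl//.
  by rewrite ge_min lexx orbT.
have KE : K * dl = c * dl + `|L| * (c * dl) by rewrite /K; ring.
by move: dlt; rewrite KE; move: gz gx yj zj gzy; lra.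
Qed.

End lipschitz_domains.

(** * Operations on finite measures *)

Section finite_measures.
Context d (T : measurableType d) {R : realType}.

Lemma finite_measure_of (m : {measure set T -> \bar R}) : (m setT < +oo)%E ->
  exists rho : {finite_measure set T -> \bar R}, forall A, rho A = m A.
Proof.
by move=> moo; exists (mfrestr measurableT moo) => A; rewrite /= /mfrestr /mrestr setIT.
Qed.

Lemma finite_pushforward d' (T' : measurableType d') (f : T -> T')
    (m : {measure set T -> \bar R}) : (m setT < +oo)%E -> measurable_fun setT f ->
  exists rho : {finite_measure set T' -> \bar R}, forall A, rho A = m (f @^-1` A).
Proof.
move=> moo mf; pose pm : {measure set T' -> \bar R} := pushforward m f.
have pmoo : (pm mf setT < +oo)%E by rewrite /pm/= /pushforward preimage_setT.
by exists (mfrestr measurableT pmoo) => A; rewrite /= /mfrestr /mrestr setIT.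
Qed.

(* Stated additively, measures having no subtraction. *)
Lemma shift_mass (mu nu : {finite_measure set T -> \bar R}) (X : set T) (t : R) :
  measurable X -> 0 <= t <= 1 ->
  exists rho : {finite_measure set T -> \bar R}, forall A, measurable A ->
    (rho A + t%:E * mu (A `&` X) = mu A + t%:E * nu A)%E.
Proof.
move=> mX /andP[t0 t1]; have s0 : 0 <= 1 - t by rewrite subr_ge0.
have mXC : measurable (~` X) by exact: measurableC.
pose m := measure_add (measure_add (mscale (NngNum s0) mu)
  (mscale (NngNum t0) (mrestr mu mXC))) (mscale (NngNum t0) nu).
have fin (m' : {finite_measure set T -> \bar R}) A : measurable A -> m' A \is a fin_num.
  by move=> mA; exact: fin_num_measure.
have mE A : m A = ((1 - t)%:E * mu A + t%:E * mu (A `&` ~` X) + t%:E * nu A)%E.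
  rewrite /m; apply: etrans (measure_addE _ _ _) _; congr (_ + _)%E.
  exact: measure_addE.
have moo : (m setT < +oo)%E.
  rewrite mE setTI -ge0_fin_numE; last first.
    by rewrite !adde_ge0// mule_ge0// lee_fin.
  by rewrite !fin_numD !fin_numM// fin.
have [rho rhoE] := finite_measure_of moo.
exists rho => A mA; rewrite (rhoE A : _ = m A) mE.
have mAX : measurable (A `&` X) by exact: measurableI.
have mAXC : measurable (A `&` ~` X) by exact: measurableI.
have AE : mu A = (mu (A `&` X) + mu (A `&` ~` X))%E.
  have disj : (A `&` X) `&` (A `&` ~` X) = set0 by rewrite setIACA setICr setI0.
  rewrite -(measureU mu mAX mAXC disj); congr (mu _).
  by rewrite -setIUr setUCr setIT.
rewrite AE.
rewrite -(fineK (fin mu _ mAX)) -(fineK (fin mu _ mAXC)) -(fineK (fin nu _ mA)).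
move: (fine _) (fine _) (fine _) => x y z.
by rewrite -?(EFinD, EFinM); congr EFin; ring.
Qed.

Lemma bounded_integrable (mu : {finite_measure set T -> \bar R}) D (f : T -> R) (M : R) :
  measurable D -> measurable_fun D f -> (forall x, D x -> `|f x| <= M) ->
  mu.-integrable D (EFin \o f).
Proof.
move=> mD mf fM; apply: (@measurable_bounded_integrable _ _ _ mu _ D) => //.
  by rewrite -ge0_fin_numE//; exact: fin_num_measure.
exists M; split; first exact: num_real.
by move=> N MN; rewrite /globally/= => x /fM /le_trans; apply; exact: ltW.
Qed.

Lemma ge0_integral_measure_rel (m1 m2 n1 n2 : {measure set T -> \bar R}) (a : R) D
    (f : T -> \bar R) : 0 <= a -> measurable D -> measurable_fun D f ->
  (forall x, D x -> (0 <= f x)%E) ->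
  (forall A, measurable A -> (m1 A + a%:E * n1 A = m2 A + a%:E * n2 A)%E) ->
  (\int[m1]_(x in D) f x + a%:E * \int[n1]_(x in D) f x =
   \int[m2]_(x in D) f x + a%:E * \int[n2]_(x in D) f x)%E.
Proof.
move=> a0 mD mf f0 H.
have E (m n : {measure set T -> \bar R}) :
    (\int[m]_(x in D) f x + a%:E * \int[n]_(x in D) f x =
     \int[measure_add m (mscale (NngNum a0) n)]_(x in D) f x)%E.
  by rewrite ge0_integral_measure_add// ge0_integral_mscale.
rewrite !E; apply: eq_measure_integral => A mA _.
have AE (m n : {measure set T -> \bar R}) : measure_add m (mscale (NngNum a0) n) A =
    (m A + a%:E * n A)%E by exact: measure_addE.
by apply: (etrans (AE m1 n1)); rewrite H//; exact: esym (AE m2 n2).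
Qed.

(** The relation is integrated for the positive and the negative part of [f]; boundedness makes all
    terms finite, so they can be recombined. *)
Lemma Rintegral_measure_rel (m1 m2 n1 n2 : {finite_measure set T -> \bar R}) (a M : R) D
    (f : T -> R) : 0 <= a -> measurable D -> measurable_fun D f ->
  (forall x, D x -> `|f x| <= M) ->
  (forall A, measurable A -> (m1 A + a%:E * n1 A = m2 A + a%:E * n2 A)%E) ->
  \int[m1]_(x in D) f x + a * \int[n1]_(x in D) f x =
  \int[m2]_(x in D) f x + a * \int[n2]_(x in D) f x.
Proof.
move=> a0 mD mf fM H.
have mE : measurable_fun D (EFin \o f) by exact/measurable_EFinP.
have := ge0_integral_measure_rel a0 mD (measurable_funepos mE) (fun x _ => funepos_ge0 _ x) H.
have := ge0_integral_measure_rel a0 mD (measurable_funeneg mE) (fun x _ => funeneg_ge0 _ x) H.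
have ip (m : {finite_measure set T -> \bar R}) :
    (\int[m]_(x in D) ((EFin \o f)^\+ x))%E \is a fin_num.
  by apply: integral_fune_fin_num => //; apply: integrable_funepos => //; exact: bounded_integrable fM.
have im (m : {finite_measure set T -> \bar R}) :
    (\int[m]_(x in D) ((EFin \o f)^\- x))%E \is a fin_num.
  by apply: integral_fune_fin_num => //; apply: integrable_funeneg => //; exact: bounded_integrable fM.
have RE (m : {finite_measure set T -> \bar R}) : \int[m]_(x in D) f x =
    fine (\int[m]_(x in D) ((EFin \o f)^\+ x)) - fine (\int[m]_(x in D) ((EFin \o f)^\- x)).
  by rewrite /Rintegral integralE fineB//; [exact: ip|exact: im].
rewrite !RE.
rewrite -(fineK (ip m1)) -(fineK (ip m2)) -(fineK (ip n1)) -(fineK (ip n2)).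
rewrite -(fineK (im m1)) -(fineK (im m2)) -(fineK (im n1)) -(fineK (im n2)).
rewrite -!EFinM -!EFinD => -[E1] [E2] /=; lra.
Qed.

(** For any Hahn decomposition the negative set is null when the charge is nonnegative, so the
    choice made in [charge_integral] does not matter. *)
Lemma jordan_integral_ge0 (u : {charge set T -> \bar R}) (mu : {measure set T -> \bar R})
    P N (uPN : hahn_decomposition u P N) D (f : T -> R) :
  measurable D -> (forall A, measurable A -> u A = mu A) ->
  \int[jordan_pos uPN]_(x in D) f x - \int[jordan_neg uPN]_(x in D) f x =
  \int[mu]_(x in D) f x.
Proof.
move=> mD uE.
have [pP nN _ _] := uPN; have mN : measurable N by case: nN.
have neg0 A : measurable A -> jordan_neg uPN A = 0%E.
  move=> mA; rewrite jordan_negE cjordan_negE /crestr0 mem_set// /crestr.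
  have mAN : measurable (A `&` N) by exact: measurableI.
  apply/eqP; rewrite oppe_eq0 eq_le; apply/andP; split.
    by case: nN => _; apply => //; exact: subIsetr.
  by rewrite uE.
have pos A : measurable A -> jordan_pos uPN A = mu A.
  move=> mA; rewrite -uE// (jordan_decomp uPN mA) /cadd/= cscaleN1.
  by have := neg0 _ mA; rewrite /= => ->; rewrite oppe0 adde0.
rewrite /Rintegral [X in fine X - _](eq_measure_integral mu); last by move=> A mA _; exact: pos.
rewrite [X in _ - fine X](eq_measure_integral mzero); last by move=> A mA _; exact: neg0.
by rewrite integral_measure_zero subr0.
Qed.

Lemma charge_integral_ge0 (u : {charge set T -> \bar R}) (mu : {measure set T -> \bar R}) D
    (f : T -> R) : measurable D -> (forall A, measurable A -> u A = mu A) ->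
  charge_integral u D f = \int[mu]_(x in D) f x.
Proof. exact: jordan_integral_ge0. Qed.

End finite_measures.

(** * Spreading an atom of a coupling *)

Section product_borel.
Context {R : realType} {m n : nat}.

(** Concatenation is measurable for the product sigma-algebra and splitting is continuous on row
    vectors of length [m + n], where open sets are measurable by definition. *)
Lemma open_measurable_rV_prod (U : set ('rV[R]_m * 'rV[R]_n)) : open U -> measurable U.
Proof.
move=> oU; pose cat (z : 'rV[R]_m * 'rV[R]_n) : 'rV[R]_(m + n) := row_mx z.1 z.2.
pose sub (v : 'rV[R]_(m + n)) := (lsubmx v, rsubmx v).
have mcat : measurable_fun setT cat.
  apply: measurable_fun_rV => i; case: (split_ordP i) => j ->.
    apply: (eq_measurable_fun (fun z : 'rV[R]_m * 'rV[R]_n => z.1 ord0 j)) => [z _|].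
      by rewrite row_mxEl.
    exact: (measurableT_comp (measurable_coord j) measurable_fst).
  apply: (eq_measurable_fun (fun z : 'rV[R]_m * 'rV[R]_n => z.2 ord0 j)) => [z _|].
    by rewrite row_mxEr.
  exact: (measurableT_comp (measurable_coord j) measurable_snd).
have lip k (f : 'rV[R]_(m + n) -> 'rV[R]_k) : (forall v w, `|f v - f w| <= `|v - w|) ->
    continuous f.
  move=> H v; apply/(@cvgrPdist_lt _ _ _ (nbhs v)) => e e0.
  apply/nbhs_ballP; exists e => //= w; rewrite -ball_normE/=.
  exact: le_lt_trans (H v w).
have csub : continuous sub.
  have cl : continuous (@lsubmx R 1 m n).
    apply: lip => v w; apply: ler_norm_rV => // i.
    by have := ler_coord_norm (v - w) (lshift n i); rewrite !mxE.
  have cr : continuous (@rsubmx R 1 m n).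
    apply: lip => v w; apply: ler_norm_rV => // i.
    by have := ler_coord_norm (v - w) (rshift m i); rewrite !mxE.
  move=> v; exact: (cvg_pair (cl v) (cr v)).
have -> : U = cat @^-1` (sub @^-1` U).
  by apply/seteqP; split => -[x y]; rewrite /preimage/= /sub row_mxKl row_mxKr.
rewrite -[X in measurable X]setTI; apply: mcat => //; apply: open_measurable_rV.
by move/continuousP: csub; apply.
Qed.

Lemma within_continuous_measurable_prod (A : set ('rV[R]_m * 'rV[R]_n)) v : measurable A ->
  {within A, continuous v} -> measurable_fun A (v : _ -> R).
Proof.
move=> mA /continuousP cv; apply: (measurability _ (RGenOpens.measurableE R)) => //.
move=> _ [_ [a [b ->]] <-].
have /open_subspaceP[V oV VA] := cv _ (@interval_open R (BRight a) (BLeft b) isT isT).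
by rewrite setIC -VA; apply: measurableI => //; exact: open_measurable_rV_prod.
Qed.

End product_borel.

Lemma compact_bounded_fun (R : realType) (T : topologicalType) (K : set T) (f : T -> R) :
  compact K -> {within K, continuous f} ->
  exists2 M : R, 0 <= M & forall x, K x -> `|f x| <= M.
Proof.
move=> cK cf; have [M [_ HM]] := compact_bounded (continuous_compact cf cK).
exists (`|M| + 1); first by rewrite addr_ge0.
move=> x Kx; apply: (HM (`|M| + 1)); last by exists x.
by rewrite (le_lt_trans (ler_norm M))// ltrDl.
Qed.

Section couplings.
Context {R : realType} {d0 d1 : nat}.
Variables (om0 : set 'rV[R]_d0) (om1 : set 'rV[R]_d1).
Hypotheses (mom0 : measurable om0) (mom1 : measurable om1).
Local Notation XY := ('rV[R]_d0 * 'rV[R]_d1)%type.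

(* The part [t nu \x \d_xi] of [pi] is replaced by [t nu \x eta]. *)
Lemma spread_coupling (pi : {finite_measure set XY -> \bar R})
    (eta : {finite_measure set 'rV[R]_d1 -> \bar R}) (xi : 'rV[R]_d1) (t : R) :
  carried_by (om0 `*` om1) pi -> carried_by om1 eta -> eta setT = 1%E -> 0 <= t <= 1 ->
  exists (nu : {finite_measure set 'rV[R]_d0 -> \bar R})
    (pit : {finite_measure set XY -> \bar R}),
    [/\ carried_by om0 nu /\ nu setT = pi (snd @^-1` [set xi]),
      carried_by (om0 `*` om1) pit,
      forall B, measurable B -> pit (fst @^-1` B) = pi (fst @^-1` B),
      forall A, measurable A -> (pit (snd @^-1` A) + t%:E * (nu setT * \d_xi A) =
        pi (snd @^-1` A) + t%:E * (nu setT * eta A))%E &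
      forall A, measurable A -> (pit A + t%:E * nu [set x | A (x, xi)] =
        pi A + t%:E * (nu \x eta) A)%E].
Proof.
move=> cpi ceta eta1 t01.
have mxi := measurable_rV_set1 xi.
(* The fibre over the atom. Below, [nu] is the first marginal of [pi] restricted to it, so that this
   restriction is the product of [nu] with the point mass at [xi]. *)
pose X : set XY := snd @^-1` [set xi].
have mX : measurable X.
  by rewrite -[X]setTI; exact: (@measurable_snd _ _ 'rV[R]_d0 'rV[R]_d1).
have mfst B : measurable B -> measurable (fst @^-1` B : set XY).
  by move=> mB; rewrite -[_ @^-1` _]setTI; exact: (@measurable_fst _ _ 'rV[R]_d0 'rV[R]_d1).
have msnd B : measurable B -> measurable (snd @^-1` B : set XY).
  by move=> mB; rewrite -[_ @^-1` _]setTI; exact: (@measurable_snd _ _ 'rV[R]_d0 'rV[R]_d1).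
have mf := @measurable_fst _ _ 'rV[R]_d0 'rV[R]_d1.
have poo : (mrestr pi mX setT < +oo)%E.
  by rewrite /mrestr setTI -ge0_fin_numE//; exact: fin_num_measure.
have [nu nuE'] := finite_pushforward poo mf.
have nuE B : nu B = pi (fst @^-1` B `&` X) by rewrite nuE'.
have nuT : nu setT = pi X by rewrite nuE preimage_setT setTI.
have prodE A B : measurable A -> measurable B -> ((nu \x eta) (A `*` B) = nu A * eta B)%E.
  exact: product_measure1E.
have noo : ((nu \x eta) setT < +oo)%E.
  rewrite -setXTT prodE// eta1 mule1 -ge0_fin_numE//; exact: fin_num_measure.
have [ne neE] := finite_measure_of noo.
have npE A B : measurable A -> measurable B -> (ne (A `*` B) = nu A * eta B)%E.
  by move=> mA mB; rewrite neE; exact: product_measure1E.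
have [rho rhoE] := shift_mass pi ne mX t01.
have t0 : 0 <= t by case/andP: t01.
have cnu : carried_by om0 nu.
  move=> B mB B0; rewrite nuE; apply: cpi; first by apply: measurableI => //; exact: mfst.
  apply/seteqP; split => // -[x y] [[/= Bx _] [/= ox _]].
  by have : (B `&` om0) x by []; rewrite B0.
have secE A : pi (A `&` X) = nu [set x | A (x, xi)].
  rewrite nuE; congr (pi _); apply/seteqP; split => -[x y] [/= H yx]; split => //=.
  - by rewrite -yx.
  - by rewrite /X /= in yx; rewrite yx.
have fin (mu : {finite_measure set XY -> \bar R}) A : measurable A -> mu A \is a fin_num.
  by move=> mA; exact: fin_num_measure.
exists nu, rho; split => //.
- move=> A mA A0; have := rhoE A mA; rewrite (cpi _ mA A0) add0e.
  have -> : ne A = 0%E.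
    apply/eqP; rewrite eq_le measure_ge0 andbT.
    have mN0 : measurable (~` om0 `*` [set: 'rV[R]_d1]).
      by apply: measurableX => //; exact: measurableC.
    have mN1 : measurable ([set: 'rV[R]_d0] `*` ~` om1).
      by apply: measurableX => //; exact: measurableC.
    apply: (@le_trans _ _ (ne ((~` om0 `*` setT) `|` (setT `*` ~` om1)))).
      apply: le_measure; rewrite ?inE//; first exact: measurableU.
      move=> [x y] Axy; have [ox|nx] := pselect (om0 x); last by left.
      have [oy|ny] := pselect (om1 y); last by right.
      by have : (A `&` om0 `*` om1) (x, y) by []; rewrite A0.
    have E0 : ne (~` om0 `*` setT) = 0%E.
      rewrite npE//; last exact: measurableC.
      by rewrite (cnu (~` om0)) ?mul0e ?setICl//; exact: measurableC.
    have E1 : ne (setT `*` ~` om1) = 0%E.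
      rewrite npE//; last exact: measurableC.
      by rewrite (ceta (~` om1)) ?mule0 ?setICl//; exact: measurableC.
    apply: (le_trans (measureU2 ne mN0 mN1)).
    apply: (@le_trans _ _ (0 + 0)%E); last by rewrite adde0.
    by apply: leeD; rewrite le_eqVlt; apply/orP; left; apply/eqP; [exact: E0|exact: E1].
  rewrite mule0 => /eqP; rewrite padde_eq0//; first by case/andP => /eqP.
  by rewrite mule_ge0// lee_fin.
- move=> B mB; have := rhoE _ (mfst B mB); rewrite secE/=.
  have -> : ne (fst @^-1` B) = nu B.
    rewrite (_ : fst @^-1` B = B `*` setT); first by rewrite npE// eta1 mule1.
    by apply/seteqP; split => -[x y]/=; [|case].
  have f1 : (t%:E * nu B)%E \is a fin_num by rewrite fin_numM//; exact: fin_num_measure.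
  by move/(congr1 (fun z => z - t%:E * nu B)%E); rewrite !addeK.
- move=> A mA; have := rhoE _ (msnd A mA).
  have -> : (ne (snd @^-1` A) = nu setT * eta A)%E.
    rewrite (_ : snd @^-1` A = setT `*` A); first by rewrite npE.
    by apply/seteqP; split => -[x y]/=; [|case].
  move=> <-; congr (_ + _ * _)%E; rewrite nuT diracE.
  have [xA|xA] := boolP (xi \in A).
    rewrite mule1; congr (pi _); apply/seteqP; split => [z Xz|z []//]; split => //.
    by rewrite /X/= in Xz *; rewrite Xz; rewrite inE in xA.
  rewrite mule0 (_ : _ `&` _ = set0) ?measure0//.
  by apply/seteqP; split => // z [/= Az Xz]; rewrite /X/= in Xz; rewrite notin_setE in xA; apply: xA; rewrite -Xz.
- by move=> A mA; have := rhoE A mA; rewrite secE neE.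
Qed.

End couplings.

(** * Second-order estimate of the transport cost *)

Section density_integral.
Context d (T : measurableType d) {R : realType} (mu : {measure set T -> \bar R}).
Variables (rho : T -> R) (mrho : measurable_fun setT rho) (rho0 : forall x, 0 <= rho x).
Local Notation nu := (density mu mrho rho0).
Import HBNNSimple.

Let integral_density_nnsfun (h : {nnsfun T >-> R}) :
  (\int[nu]_x (h x)%:E = \int[mu]_x ((rho x)%:E * (h x)%:E))%E.
Proof.
under [LHS]eq_integral do rewrite fimfunE -fsumEFin//.
under [RHS]eq_integral => x _.
  rewrite fimfunE -fsumEFin// ge0_mule_fsumr; last first.
    by move=> r; rewrite EFinM nnfun_muleindic_ge0.
  over.
rewrite !ge0_integral_fsum//; last 4 first.
- move=> r; apply: emeasurable_funM; first exact/measurable_EFinP.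
  by apply/measurable_EFinP; apply: measurable_funM => //; exact: measurable_indic.
- move=> n x _; apply: mule_ge0; first by rewrite lee_fin.
  by rewrite EFinM nnfun_muleindic_ge0.
- by move=> r; apply/measurable_EFinP; apply: measurable_funM => //; exact: measurable_indic.
- by move=> n x _; rewrite EFinM nnfun_muleindic_ge0.
apply: eq_fsbigr => r _.
have mh : measurable (h @^-1` [set r]) by exact: measurable_sfunP.
have [r0|r0] := ltP r 0.
  have -> : h @^-1` [set r] = set0.
    by apply/seteqP; split => // x /= hx; move: r0; rewrite -hx ltNge fun_ge0.
  rewrite [LHS]integral0_eq; last by move=> x _; rewrite indic0 mulr0.
  by rewrite integral0_eq// => x _; rewrite indic0 mulr0 mule0.
under [LHS]eq_integral do rewrite EFinM.
under [RHS]eq_integral do rewrite EFinM muleCA.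
have mi : measurable_fun setT (fun x => (\1_(h @^-1` [set r]) x)%:E : \bar R).
  by apply/measurable_EFinP; exact: measurable_indic.
have mri : measurable_fun setT (fun x => (rho x)%:E * (\1_(h @^-1` [set r]) x)%:E)%E.
  by apply: emeasurable_funM => //; exact/measurable_EFinP.
rewrite (ge0_integralZl _ measurableT mi)//.
rewrite (ge0_integralZl _ measurableT mri)//; last first.
  by move=> x _; rewrite mule_ge0// lee_fin.
congr (_ * _)%E; rewrite integral_indic// setIT.
rewrite [LHS]integral_mkcond; apply: eq_integral => x _.
by rewrite patchE indicE; case: ifP => _; rewrite ?mule1 ?mule0.
Qed.

Lemma ge0_integral_density (f : T -> \bar R) : measurable_fun setT f ->
  (forall x, (0 <= f x)%E) ->
  (\int[nu]_x f x = \int[mu]_x ((rho x)%:E * f x))%E.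
Proof.
move=> mf f0; pose f_ := nnsfun_approx measurableT mf.
have mfn n : measurable_fun setT (fun x => (f_ n x)%:E) by exact/measurable_EFinP.
have f_c x : (f_ n x)%:E @[n --> \oo] --> f x by exact: (cvg_nnsfun_approx measurableT mf).
have nd x a b : (a <= b)%N -> f_ a x <= f_ b x.
  by move=> ab; exact/lefP/nd_nnsfun_approx.
transitivity (limn (fun n => \int[nu]_x (f_ n x)%:E))%E.
  rewrite -monotone_convergence//=.
  - by apply: eq_integral => x _; apply/esym/cvg_lim => //; exact: f_c.
  - by move=> n x _; rewrite lee_fin.
  - by move=> x _ a b ab; rewrite lee_fin nd.
transitivity (limn (fun n => \int[mu]_x ((rho x)%:E * (f_ n x)%:E)))%E.
  by congr (limn _); apply/funext => n; exact: integral_density_nnsfun.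
rewrite -monotone_convergence//=.
- apply: eq_integral => x _; apply: cvg_lim => //.
  by apply: cvgeZl => //; exact: f_c.
- by move=> n; apply: emeasurable_funM => //; exact/measurable_EFinP.
- by move=> n x _; rewrite mule_ge0// lee_fin.
- by move=> x _ a b ab; rewrite lee_wpmul2l ?lee_fin// nd.
Qed.

End density_integral.

Section kernel_measure.
Context {R : realType} {d : nat}.
Local Notation leb := (@lebesgue_rV R d).
Implicit Types (f h : 'rV[R]_d -> R).

(** Turns a bump into an admissible control; the ball carrying [h] lies in [D], so the values of [f]
    outside [D] do not enter. *)
Lemma kernel_measure h (a : 'rV[R]_d) (r : R) : continuous h -> (forall x, 0 <= h x) ->
  (forall x, r < `|x - a| -> h x = 0) ->
  exists nu : {finite_measure set 'rV[R]_d -> \bar R},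
  [/\ nu setT = (\int[leb]_x h x)%:E,
    forall X, [set x | `|x - a| <= r] `<=` X -> carried_by X nu &
    forall D f (M : R), measurable D -> [set x | `|x - a| <= r] `<=` D -> measurable_fun D f ->
      (forall x, D x -> `|f x| <= M) ->
      \int[nu]_(x in D) f x = \int[leb]_x (h x * f x)].
Proof.
move=> ch h0 hv; have mh := continuous_measurable_rV ch.
have ih : leb.-integrable setT (EFin \o h) by exact: compact_support_integrable hv.
have noo : (density leb mh h0 setT < +oo)%E.
  by rewrite /density integrable_Rintegral_EFin// ltry.
have [nu nuE] := finite_measure_of noo.
exists nu; split.
- by rewrite nuE /= /density integrable_Rintegral_EFin.
- move=> X BX A mA AX; rewrite nuE /= /density integral0_eq// => x Ax.
  rewrite hv// ltNge; apply/negP => /BX Xx.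
  by have : (A `&` X) x by []; rewrite AX.
move=> D f M mD BD mf fM.
have mg : measurable_fun setT (f \_ D) by apply/(measurable_restrictT _ mD).
have gM x : `|(f \_ D) x| <= `|M|.
  rewrite patchE; case: ifPn => [|_]; last by rewrite normr0.
  by rewrite inE => /fM /le_trans; apply; exact: ler_norm.
rewrite Rintegral_mkcond.
have -> : \int[leb]_x (h x * f x) = \int[leb]_x (h x * (f \_ D) x).
  apply: eq_Rintegral => x _; rewrite patchE; case: ifPn => // xD.
  rewrite hv ?mul0r// ltNge; apply/negP => /BD Dx.
  by move: xD; rewrite notin_setE.
have mgE : measurable_fun setT (EFin \o (f \_ D)) by exact/measurable_EFinP.
have mhg : measurable_fun setT (EFin \o (fun x => h x * (f \_ D) x)).
  by apply/measurable_EFinP; exact: measurable_funM.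
have E (u : 'rV[R]_d -> \bar R) : measurable_fun setT u -> (forall x, (0 <= u x)%E) ->
    (\int[nu]_x u x = \int[leb]_x ((h x)%:E * u x))%E.
  move=> mu u0; rewrite -(ge0_integral_density leb mh h0 mu u0).
  by apply: eq_measure_integral => A mA _; exact: nuE.
rewrite /Rintegral integralE [in RHS]integralE; congr (fine (_ - _)).
  rewrite (E _ (measurable_funepos mgE) (fun x => funepos_ge0 _ x)).
  apply: eq_integral => x _.
  by rewrite !funeposE/= EFinM maxe_pMr ?mule0// lee_fin.
rewrite (E _ (measurable_funeneg mgE) (fun x => funeneg_ge0 _ x)).
apply: eq_integral => x _.
by rewrite !funenegE/= -mulrN EFinM maxe_pMr ?mule0// lee_fin.
Qed.

End kernel_measure.

Section second_order.
Context {R : realType} {d : nat}.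
Local Notation leb := (@lebesgue_rV R d).
Variables (eta b : 'rV[R]_d -> R).
Hypotheses (seta : smooth eta) (sb : smooth b) (eta0 : forall x, 0 <= eta x).
Hypothesis b0 : forall x, 0 <= b x.
Hypotheses (etav : forall x, 2^-1 < `|x| -> eta x = 0) (bv : forall x, 2^-1 < `|x| -> b x = 0).
Hypothesis lapb : forall x, lap b x = - (2 ^+ d * eta (2 *: x) - eta x).
Hypothesis d2 : (1 < d)%N.
Let dE : d.-2.+2 = d. Proof. by case: d d2 => [|[]]. Qed.

Lemma scaled_ge0 k (s : R) (xi : 'rV[R]_d) f x : 0 < s -> (forall x, 0 <= f x) ->
  0 <= scaled k s xi f x :> R.
Proof. by move=> s0 f0; apply: mulr_ge0; [exact/exprn_ge0/ltW|exact: f0]. Qed.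

Lemma integrable_scaled k (s : R) (xi : 'rV[R]_d) f : 0 < s -> continuous f ->
  (forall x, 2^-1 < `|x| -> f x = 0) -> leb.-integrable setT (EFin \o scaled k s xi f).
Proof.
move=> s0 cf fv; apply: integrable_dilate => //.
by apply: (@compact_support_integrable _ _ _ 0 2^-1) => // x; rewrite subr0; exact: fv.
Qed.

Lemma Rintegral_scaled (s : R) (xi : 'rV[R]_d) : 0 < s ->
  \int[leb]_x scaled d.-2 s xi b x = s^-1 ^+ 2 * \int[leb]_x b x.
Proof.
move=> s0.
have ib : leb.-integrable setT (EFin \o b).
  apply: (@compact_support_integrable _ _ _ 0 2^-1); first exact: smooth_continuous.
  by move=> x; rewrite subr0; exact: bv.
rewrite -(Rintegral_dilate xi s0 ib) -RintegralZl//; last first.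
  apply: (@integrable_scaled d) => //; exact: smooth_continuous.
apply: eq_Rintegral => x _; rewrite /scaled mulrA -[in s ^+ d]dE !exprS; field.
by rewrite gt_eqF.
Qed.

Lemma Rintegral_potential (s : R) (xi : 'rV[R]_d) n : 0 < s ->
  \int[leb]_x potential b s xi n x <= 2 * s^-1 ^+ 2 * \int[leb]_x b x.
Proof.
move=> s0; set m := \int[leb]_x b x.
have m0 : 0 <= m by apply: Rintegral_ge0.
have cb : continuous b := smooth_continuous sb.
suff -> : \int[leb]_x potential b s xi n x = (\sum_(0 <= j < n) 4^-1 ^+ j) * (s^-1 ^+ 2 * m).
  rewrite -mulrA ler_wpM2r// ?mulr_ge0 ?exprn_ge0 ?invr_ge0 ?(ltW s0)//.
  (* Strengthened for the induction; the scale [2^j s] contributes [4^-j], and the full series has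
     sum 4/3. *)
  suff : \sum_(0 <= j < n) 4^-1 ^+ j <= 2 - 2 * 4^-1 ^+ n :> R.
    by move/le_trans; apply; rewrite gerBl mulr_ge0// exprn_ge0.
  elim: n => [|n IH]; first by rewrite big_geq// expr0; lra.
  rewrite big_nat_recr//= exprS; have : 0 <= 4^-1 ^+ n :> R by rewrite exprn_ge0.
  by move: IH; lra.
have iS k : leb.-integrable setT (EFin \o potential b s xi k).
  apply: (@compact_support_integrable _ _ _ xi (2^-1 / s)).
    by apply: smooth_continuous; exact: smooth_potential.
  exact: potential_support.
elim: n => [|n IH].
  rewrite big_geq// mul0r /Rintegral integral0_eq// => x _.
  by rewrite /potential big_geq.
rewrite big_nat_recr//= mulrDl -IH.
have sn : 0 < 2 ^+ n * s by rewrite mulr_gt0// exprn_gt0.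
have -> : 4^-1 ^+ n * (s^-1 ^+ 2 * m) = (2 ^+ n * s)^-1 ^+ 2 * m.
  rewrite invfM exprMn mulrA; congr (_ * _ * _).
  by rewrite -(exprVn 2) -exprM mulnC exprM; congr (_ ^+ n); field.
rewrite -(Rintegral_scaled xi sn) -RintegralD//; last exact: integrable_scaled.
by apply: eq_Rintegral => x _; rewrite /potential big_nat_recr.
Qed.

(* [- lap] of the limit of [potential b s xi n] is a point mass minus the kernel,
   so that the difference is the integral of [lap k] against this limit. *)
Lemma second_order_kernel (U : set 'rV[R]_d) (k : 'rV[R]_d -> R) (s H : R) xi :
  0 < s -> open U -> [set x | `|x - xi| <= 2^-1 / s] `<=` U ->
  (forall i, C1_on U (delta_mx ord0 i) k) ->
  (forall i, C1_on U (delta_mx ord0 i) (partial i k)) ->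
  (forall x, `|x - xi| <= 2^-1 / s -> `|lap k x| <= H) ->
  `|\int[leb]_x (scaled d s xi eta x * k x) - k xi * \int[leb]_x eta x| <=
  H * (2 * s^-1 ^+ 2 * \int[leb]_x b x).
Proof.
move=> s0 oU BU k1 k2 kH; set m := \int[leb]_x eta x.
have sS n : smooth (potential b s xi n) by exact: smooth_potential.
have Sv n := @potential_support _ _ _ bv s xi s0 n.
have H0 : 0 <= H.
  apply: le_trans (kH xi _); first exact: normr_ge0.
  by rewrite subrr normr0 divr_ge0// ltW.
have Uxi : U xi by apply: BU; rewrite /= subrr normr0 divr_ge0// ltW.
have ck x : U x -> {for x, continuous k}.
  have i : 'I_d by exact: Ordinal (ltnW d2).
  by move=> Ux; case: (k1 i _ Ux).
have chk n : continuous (fun x => k x * scaled d (2 ^+ n * s) xi eta x).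
  apply: (continuous_mul_supported (a := xi) (r := 2^-1 / s) BU ck).
    by apply: smooth_continuous; exact: smooth_scaled.
  move=> x xr; apply: (@scaled_support _ _ d _ 2^-1) => //; first by rewrite mulr_gt0// exprn_gt0.
  apply: le_lt_trans xr.
  rewrite ler_wpM2l// lef_pV2 ?posrE ?mulr_gt0 ?exprn_gt0// ler_peMl ?(ltW s0)//.
  by rewrite exprn_ege1// ler1n.
have hkv n x : 2^-1 / s < `|x - xi| -> k x * scaled d (2 ^+ n * s) xi eta x = 0.
  move=> xr; rewrite (@scaled_support _ _ d _ 2^-1) ?mulr0//; first by rewrite mulr_gt0// exprn_gt0.
  apply: le_lt_trans xr.
  rewrite ler_wpM2l// lef_pV2 ?posrE ?mulr_gt0 ?exprn_gt0// ler_peMl ?(ltW s0)//.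
  by rewrite exprn_ege1// ler1n.
have ihk n : leb.-integrable setT (EFin \o (fun x => k x * scaled d (2 ^+ n * s) xi eta x)).
  exact: compact_support_integrable (hkv n).
have ibp n : \int[leb]_x (k x * lap (potential b s xi n) x) =
    \int[leb]_x (lap k x * potential b s xi n x) /\
    leb.-integrable setT (EFin \o (fun x => lap k x * potential b s xi n x)).
  have P i : [/\ leb.-integrable setT (EFin \o (fun x => k x * partial i (partial i (potential b s xi n)) x)),
      leb.-integrable setT (EFin \o (fun x => partial i (partial i k) x * potential b s xi n x)) &
      \int[leb]_x (k x * partial i (partial i (potential b s xi n)) x) =
      \int[leb]_x (partial i (partial i k) x * potential b s xi n x)].
    have sdS : smooth (partial i (potential b s xi n)) by exact: smooth_derive.
    have dSv := derive_outside (delta_mx ord0 i) (Sv n).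
    have ddSv := derive_outside (delta_mx ord0 i) dSv.
    have [c1 _ E1] := Rintegral_by_parts oU BU (k1 i) sdS dSv.
    have [_ c2 E2] := Rintegral_by_parts oU BU (k2 i) (sS n) (Sv n).
    split.
    - by apply: (compact_support_integrable (a := xi) (r := 2^-1 / s)) => // x /ddSv E; rewrite [X in _ * X]E mulr0.
    - by apply: (compact_support_integrable (a := xi) (r := 2^-1 / s)) => // x /Sv ->; rewrite mulr0.
    - by rewrite E1; apply/eqP; rewrite eqr_oppLR; apply/eqP; rewrite -E2.
  have sumE (g : 'I_d -> 'rV[R]_d -> R) : (forall i, leb.-integrable setT (EFin \o g i)) ->
      \int[leb]_x (\sum_(i < d) g i x) = \sum_(i < d) \int[leb]_x g i x /\
      leb.-integrable setT (EFin \o (fun x => \sum_(i < d) g i x)).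
    move=> ig; split.
      rewrite /Rintegral; under eq_integral do rewrite -sumEFin.
      rewrite (@integral_sum _ _ _ leb setT measurableT _ (fun i x => (g i x)%:E))//.
      by rewrite sum_fine// => i _; apply: integrable_fin_num => //; exact: ig.
    have HI := integrable_sum measurableT (index_enum 'I_d) (P := xpredT)
      (h := fun i x => (g i x)%:E) (fun i _ => ig i).
    by apply: eq_integrable HI => // x _; rewrite /= sumEFin.
  have P1 i : leb.-integrable setT
      (EFin \o (fun x => k x * partial i (partial i (potential b s xi n)) x)) by have [] := P i.
  have P2 i : leb.-integrable setT
      (EFin \o (fun x => partial i (partial i k) x * potential b s xi n x)) by have [] := P i.
  have [E1 _] := sumE _ P1; have [E2 I2] := sumE _ P2.
  split.
    transitivity (\sum_(i < d) \int[leb]_x (k x * partial i (partial i (potential b s xi n)) x)).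
      by rewrite -E1; apply: eq_Rintegral => x _; rewrite /lap mulr_sumr.
    transitivity (\sum_(i < d) \int[leb]_x (partial i (partial i k) x * potential b s xi n x)).
      by apply: eq_bigr => i _; have [] := P i.
    by rewrite -E2; apply: eq_Rintegral => x _; rewrite /lap mulr_suml.
  by apply: eq_integrable I2 => // x _; rewrite /= /lap mulr_suml.
have bound n : `|\int[leb]_x (k x * scaled d (2 ^+ n * s) xi eta x) -
    \int[leb]_x (k x * scaled d s xi eta x)| <= H * (2 * s^-1 ^+ 2 * \int[leb]_x b x).
  have i0 : leb.-integrable setT (EFin \o (fun x => k x * scaled d s xi eta x)).
    by have := ihk 0%N; rewrite expr0 mul1r.
  rewrite -RintegralB//.
  have -> : \int[leb]_x (k x * scaled d (2 ^+ n * s) xi eta x - k x * scaled d s xi eta x) =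
      \int[leb]_x (- 1 * (k x * lap (potential b s xi n) x)).
    apply: eq_Rintegral => x _; rewrite (lap_potential sb lapb d2); ring.
  have [E I2] := ibp n.
  have E' : \int[leb]_x (- 1 * (k x * lap (potential b s xi n) x)) =
      - \int[leb]_x (k x * lap (potential b s xi n) x).
    rewrite RintegralZl ?mulN1r//.
    have := integrableB measurableT i0 (ihk n).
    apply: eq_integrable => // x _ /=; rewrite (lap_potential sb lapb d2) -EFinB; congr EFin; ring.
  rewrite E' normrN E (le_trans (le_normr_Rintegral measurableT I2))//.
  (* Nonnegativity of [b] enters here: the bound for [|lap k|] can be taken out, and what remains is
     the integral of the potential itself, of order [s^-2]. *)
  have S0 x : 0 <= potential b s xi n x.
    by apply: sumr_ge0 => j _; apply: scaled_ge0 => //; rewrite mulr_gt0// exprn_gt0.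
  have iS : leb.-integrable setT (EFin \o potential b s xi n).
    by apply: compact_support_integrable (Sv n); exact: smooth_continuous.
  apply: (@le_trans _ _ (\int[leb]_x (H * potential b s xi n x))).
    apply: le_Rintegral => //.
    - exact: integrable_norm.
    - by have := integrableZl measurableT H iS; apply: eq_integrable => // x _; rewrite /= EFinM.
    - move=> x _; rewrite normrM (ger0_norm (S0 x)).
      have [xr|xr] := leP (`|x - xi|) (2^-1 / s); first by rewrite ler_wpM2r// kH.
      by rewrite Sv// !mulr0.
  by rewrite RintegralZl// ler_wpM2l// Rintegral_potential.
have cv : \int[leb]_x (k x * scaled d (2 ^+ n * s) xi eta x) -
    \int[leb]_x (k x * scaled d s xi eta x) @[n --> \oo] -->
    k xi * m - \int[leb]_x (k x * scaled d s xi eta x).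
  apply: cvgB; last exact: cvg_cst.
  have swap n : \int[leb]_x (k x * scaled d (2 ^+ n * s) xi eta x) =
      \int[leb]_x (scaled d (2 ^+ n * s) xi eta x * k x).
    by apply: eq_Rintegral => x _; rewrite mulrC.
  under eq_fun do rewrite swap.
  apply: scaled_mass_cvg => //; first exact: ck.
  move=> n; have := ihk n; apply: eq_integrable => // x _.
  by rewrite /= mulrC.
rewrite distrC; apply: cvg_norm_le (bound).
have -> : \int[leb]_x (scaled d s xi eta x * k x) = \int[leb]_x (k x * scaled d s xi eta x).
  by apply: eq_Rintegral => x _; rewrite mulrC.
exact: cv.
Qed.

End second_order.

(** * Slices of a function of two variables *)

Section slices.
Context {R : realType} {d0 d1 : nat}.
Local Notation XY := ('rV[R]_d0 * 'rV[R]_d1)%type.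
Implicit Types (c : XY -> R) (x : 'rV[R]_d0) (z v : 'rV[R]_d1).

Let slice_line (x : 'rV[R]_d0) (z v : 'rV[R]_d1) (h : R) :
  h *: ((0, v) : XY) + (x, z) = (x, h *: v + z).
Proof. by congr pair => /=; rewrite scaler0 add0r. Qed.

Lemma derivable_slice c x z v : derivable c (x, z) (0, v) ->
  derivable (fun z => c (x, z)) z v.
Proof.
rewrite /derivable; set f1 := fun h => _; set f2 := fun h => _.
suff -> : f1 = f2 by [].
apply/funext => h; rewrite /f1 /f2 /shift/=; congr (h^-1 *: (c _ - _)).
exact: slice_line.
Qed.

Lemma derive_slice c x v :
  'D_v (fun z => c (x, z)) = (fun z => 'D_((0, v) : XY) c (x, z)).
Proof.
apply/funext => z; rewrite /derive; set f1 := fun h => _; set f2 := fun h => _.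
suff -> : f1 = f2 by [].
apply/funext => h; rewrite /f1 /f2 /shift/=; congr (h^-1 *: (c _ - _)).
exact/esym/slice_line.
Qed.

Lemma continuous_pairl x z : {for z, continuous (fun z : 'rV[R]_d1 => (x, z))}.
Proof.
move=> A [[P Q]/= [xP zQ] PQA]; apply: filterS zQ => y Qy; apply: PQA; split => //=.
exact: nbhs_singleton.
Qed.

Lemma continuous_slice c x z : {for (x, z), continuous c} ->
  {for z, continuous (fun z => c (x, z))}.
Proof.
move=> cc; apply: (@continuous_comp _ _ _ (fun z => (x, z)) c z) => //.
exact: continuous_pairl.
Qed.

Lemma C1_on_slice (U : set XY) c x v : Ck U 1 c ->
  C1_on [set z | U (x, z)] v (fun z => c (x, z)).
Proof.
move=> [cc dc] z /= Uz; have [der [cD _]] := dc (0, v); split.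
- exact: derivable_slice (der _ Uz).
- exact: continuous_slice (cc _ Uz).
- by rewrite derive_slice; exact: continuous_slice (cD _ Uz).
Qed.

Lemma open_slice (U : set XY) x : open U -> open [set z | U (x, z)].
Proof.
move=> oU; rewrite (_ : [set z | _] = (fun z => (x, z)) @^-1` U)//.
have /continuousP : continuous (fun z : 'rV[R]_d1 => (x, z)).
  by move=> z; exact: continuous_pairl.
by apply.
Qed.

End slices.

Lemma cvg_sumr (R : realType) (T : Type) (F : set_system T) {FF : Filter F} (I : Type)
    (s : seq I) (h : I -> T -> R) (l : I -> R) :
  (forall i, h i x @[x --> F] --> l i) ->
  \sum_(i <- s) h i x @[x --> F] --> \sum_(i <- s) l i.
Proof.
move=> H; elim: s => [|i s IH].
  by rewrite big_nil; under eq_fun do rewrite big_nil; exact: cvg_cst.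
by rewrite big_cons; under eq_fun do rewrite big_cons; exact: cvgD.
Qed.

(** * Cost of spreading an atom *)

Section kernel_cost.
Context {R : realType} {d0 d : nat}.
Local Notation leb := (@lebesgue_rV R d).
Local Notation XY := ('rV[R]_d0 * 'rV[R]_d)%type.
Variables (eta b : 'rV[R]_d -> R).
Hypotheses (seta : smooth eta) (sb : smooth b) (eta0 : forall x, 0 <= eta x).
Hypothesis b0 : forall x, 0 <= b x.
Hypotheses (etav : forall x, 2^-1 < `|x| -> eta x = 0) (bv : forall x, 2^-1 < `|x| -> b x = 0).
Hypothesis lapb : forall x, lap b x = - (2 ^+ d * eta (2 *: x) - eta x).
Hypothesis d2 : (1 < d)%N.
Variables (om0 : set 'rV[R]_d0) (om1 : set 'rV[R]_d).
Hypotheses (com0 : compact om0) (com1 : compact om1).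

(** The constant is a bound on the compact product for the Laplacian in the second variable of a
    [C^2] extension of [c], hence uniform in [x], [xi] and [s]. The ball must lie in [om1], where
    this bound holds. *)
Lemma kernel_cost (c : XY -> R) : Ck_on_compact (om0 `*` om1) 2 c ->
  exists2 H : R, 0 <= H & forall x xi s, om0 x -> 0 < s ->
    [set z | `|z - xi| <= 2^-1 / s] `<=` om1 ->
    `|\int[leb]_z (scaled d s xi eta z * c (x, z)) - c (x, xi) * \int[leb]_z eta z| <=
    H * (2 * s^-1 ^+ 2 * \int[leb]_z b z).
Proof.
move=> [U [g [oU KU Cg cg]]].
pose e (i : 'I_d) : XY := (0, delta_mx ord0 i).
pose f (w : XY) := \sum_(i < d) 'D_(e i) ('D_(e i) g) w.
have cf w : U w -> {for w, continuous f}.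
  move=> Uw; apply: (@cvg_sumr _ _ (nbhs w)) => i.
  have [_ /(_ (e i))[_ [_ /(_ (e i))[_ [cD _]]]]] := Cg.
  exact: cD.
have [H H0 HH] : exists2 H : R, 0 <= H & forall w, (om0 `*` om1) w -> `|f w| <= H.
  apply: compact_bounded_fun; first exact: compact_setX.
  by apply: continuous_in_subspaceT => w; rewrite inE => /KU; exact: cf.
exists H => // x xi s ox s0 Bom.
have xiom : om1 xi by apply: Bom; rewrite /= subrr normr0 divr_ge0// ltW.
have E : \int[leb]_z (scaled d s xi eta z * c (x, z)) =
    \int[leb]_z (scaled d s xi eta z * g (x, z)).
  apply: eq_Rintegral => z _; have [zr|zr] := leP (`|z - xi|) (2^-1 / s).
    by rewrite cg// inE; split => //; exact: Bom.
  by rewrite (scaled_support d s0 etav zr) !mul0r.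
rewrite E cg; last by rewrite inE; split.
have C1g : Ck U 1 g.
  by exact: CkW Cg.
have BU : [set z | `|z - xi| <= 2^-1 / s] `<=` [set z | U (x, z)].
  by move=> z /Bom oz; apply: KU.
have := @second_order_kernel _ _ eta b seta sb eta0 b0 etav bv lapb d2
  [set z | U (x, z)] (fun z => g (x, z)) s H xi s0 (open_slice oU) BU.
apply.
- by move=> i; exact: C1_on_slice.
- move=> i; rewrite /partial derive_slice; have [_ /(_ (e i))[_ C1]] := Cg.
  exact: (@C1_on_slice _ _ _ U ('D_(e i) g) x (delta_mx ord0 i) C1).
- move=> z /Bom oz; have Hz := HH (x, z) (conj ox oz).
  suff -> : lap (fun z => g (x, z)) z = f (x, z) by exact: Hz.
  apply: eq_bigr => i _.
  have E1 : partial i (fun z => g (x, z)) = fun z => 'D_(e i) g (x, z) by exact: derive_slice.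
  by rewrite E1; exact: (congr1 (fun h => h z) (derive_slice ('D_(e i) g) x (delta_mx ord0 i))).
Qed.

Variables (c : XY -> R) (cc : {within om0 `*` om1, continuous c}).
Let mom0 := compact_measurable_rV com0.
Let mom1 := compact_measurable_rV com1.
Let mD : measurable (om0 `*` om1) := measurableX mom0 mom1.
Let mc : measurable_fun (om0 `*` om1) c.
Proof. exact: within_continuous_measurable_prod. Qed.

Lemma cost_bounded : exists2 M : R, 0 <= M & forall w, (om0 `*` om1) w -> `|c w| <= M.
Proof. by apply: compact_bounded_fun => //; exact: compact_setX. Qed.

(** Integrating [c] against the relation between [pi] and [pit] leaves [t] times the [nu]-integral
    of the change of cost in each fibre, which is at most [K]. *)
Lemma spread_cost (pi pit : {finite_measure set XY -> \bar R})
    (nu : {finite_measure set 'rV[R]_d0 -> \bar R})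
    (eta_ : {finite_measure set 'rV[R]_d -> \bar R}) (xi : 'rV[R]_d) (t K : R) :
  0 <= t -> om1 xi -> carried_by om0 nu ->
  (forall A, measurable A -> (pit A + t%:E * nu [set x | A (x, xi)] =
    pi A + t%:E * (nu \x eta_) A)%E) ->
  (forall x, om0 x -> \int[eta_]_(z in om1) c (x, z) <= c (x, xi) + K) ->
  \int[pit]_(z in om0 `*` om1) c z <=
  \int[pi]_(z in om0 `*` om1) c z + t * (K * fine (nu setT)).
Proof.
move=> t0 oxi cnu H HK; have [M M0 cM] := cost_bounded.
have mpair : measurable_fun setT (fun x : 'rV[R]_d0 => (x, xi)).
  by apply: measurable_fun_pair => //; exact: measurable_cst.
have nuoo : (nu setT < +oo)%E by rewrite -ge0_fin_numE//; exact: fin_num_measure.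
have [n1 n1E] := finite_pushforward nuoo mpair.
have poo : ((nu \x eta_) setT < +oo)%E.
  rewrite -setXTT product_measure1E// lte_mul_pinfty//; first by rewrite ge0_fin_numE.
  by rewrite -ge0_fin_numE//; exact: fin_num_measure.
have [n2 n2E] := finite_measure_of poo.
have rel A : measurable A -> (pit A + t%:E * n1 A = pi A + t%:E * n2 A)%E.
  by move=> mA; rewrite n1E n2E H.
have := Rintegral_measure_rel t0 mD mc cM rel.
pose cx (x : 'rV[R]_d0) := c (x, xi).
have preD : (fun x : 'rV[R]_d0 => (x, xi)) @^-1` (om0 `*` om1) = om0.
  by apply/seteqP; split => x /= => [[]|].
have mcx : measurable_fun om0 cx.
  apply: (@measurable_comp _ _ _ _ _ _ (om0 `*` om1) c om0 (fun x : 'rV[R]_d0 => (x, xi))) => //.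
    by move=> _ [x ox <-].
  exact: measurable_funTS.
have cxM x : om0 x -> `|cx x| <= M by move=> ox; apply: cM.
have icx : nu.-integrable om0 (EFin \o cx) by exact: bounded_integrable cxM.
have I1 : (\int[n1]_(z in om0 `*` om1) (c z)%:E = \int[nu]_(x in om0) (cx x)%:E)%E.
  have gE : (fun x : 'rV[R]_d0 => (c \_ (om0 `*` om1)) (x, xi)) = cx \_ om0.
    apply/funext => x; rewrite !patchE; have -> : ((x, xi) \in om0 `*` om1) = (x \in om0).
      by apply/idP/idP; rewrite !inE; [case|].
    by case: ifP.
  have -> : (\int[n1]_(z in om0 `*` om1) (c z)%:E =
      \int[pushforward nu (fun x : 'rV[R]_d0 => (x, xi))]_z ((c \_ (om0 `*` om1)) z)%:E)%E.
    rewrite integral_mkcond; transitivity (\int[n1]_z ((c \_ (om0 `*` om1)) z)%:E)%E.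
      by apply: eq_integral => z _; rewrite !patchE; case: ifP.
    by apply: eq_measure_integral => A mA _; exact: n1E.
  rewrite (integral_pushforward mpair) ?preimage_setT//.
  - rewrite [RHS]integral_mkcond; apply: eq_integral => x _.
    rewrite /= (congr1 (fun f => f x) gE) !patchE; by case: ifP.
  - by apply/measurable_EFinP; exact/(measurable_restrictT _ mD).
  - apply: (@bounded_integrable _ _ _ _ _ _ M) => //.
      by rewrite gE; apply/(measurable_restrictT _ mom0).
    move=> x _; rewrite (congr1 (fun f => f x) gE) patchE.
    by case: ifP => [|_]; [rewrite inE => /cxM|rewrite normr0].
pose F (x : 'rV[R]_d0) := (\int[eta_]_z ((c \_ (om0 `*` om1)) (x, z))%:E)%E.
have mcD : measurable_fun setT (c \_ (om0 `*` om1)) by apply/(measurable_restrictT _ mD).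
have icD : (nu \x eta_)%E.-integrable setT (EFin \o (c \_ (om0 `*` om1))).
  have i2 : n2.-integrable setT (EFin \o (c \_ (om0 `*` om1))).
    apply: (@bounded_integrable _ _ _ _ _ _ M) => // w _.
    by rewrite patchE; case: ifP => [|_]; [rewrite inE => /cM|rewrite normr0].
  move: i2 => /integrableP[mi ioo]; apply/integrableP; split => //.
  move: ioo; apply: le_lt_trans; rewrite le_eqVlt; apply/orP; left; apply/eqP.
  by apply: eq_measure_integral => A mA _; exact/esym/n2E.
have I2 : (\int[n2]_(z in om0 `*` om1) (c z)%:E = \int[nu]_x F x)%E.
  rewrite /F (integral12_prod_meas1 icD) integral_mkcond.
  transitivity (\int[n2]_z ((c \_ (om0 `*` om1)) z)%:E)%E.
    by apply: eq_integral => z _; rewrite !patchE; case: ifP.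
  by apply: eq_measure_integral => A mA _; exact: n2E.
have iF : nu.-integrable setT F by exact: integrable_fubini_F icD.
have F0 x : ~ om0 x -> F x = 0%E.
  move=> nx; rewrite /F integral0_eq// => z _; rewrite patchE memNset//.
  by move=> [].
have F1 x : om0 x -> (F x <= (cx x + K)%:E)%E.
  move=> ox; have mcz : measurable_fun om1 (fun z => c (x, z)).
    have mp : measurable_fun setT (fun z : 'rV[R]_d => (x, z)).
      by apply: measurable_fun_pair => //; exact: measurable_cst.
    apply: (@measurable_comp _ _ _ _ _ _ (om0 `*` om1) c om1 (fun z : 'rV[R]_d => (x, z))) => //.
      by move=> _ [z oz <-].
    exact: measurable_funTS.
  have icz : eta_.-integrable om1 (EFin \o (fun z => c (x, z))).
    by apply: (@bounded_integrable _ _ _ _ _ _ M) => // z oz; apply: cM.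
  have -> : F x = (\int[eta_]_(z in om1) (c (x, z))%:E)%E.
    rewrite [RHS]integral_mkcond; apply: eq_integral => z _; rewrite !patchE.
    have -> : ((x, z) \in om0 `*` om1) = (z \in om1).
      by apply/idP/idP; rewrite !inE; [case|].
    by case: ifP.
  have fn : (\int[eta_]_(z in om1) (c (x, z))%:E)%E \is a fin_num.
    exact: integrable_fin_num.
  by rewrite -(fineK fn) lee_fin; exact: HK.
have I2le : (\int[nu]_x F x <= (\int[nu]_(x in om0) cx x + K * fine (nu setT))%:E)%E.
  have -> : (\int[nu]_x F x = \int[nu]_(x in om0) F x)%E.
    rewrite [RHS]integral_mkcond; apply: eq_integral => x _; rewrite patchE.
    by case: ifPn => //; rewrite notin_setE => /F0.
  have iK : nu.-integrable om0 (EFin \o cst K) by exact: finite_measure_integrable_cst.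
  apply: (@le_trans _ _ (\int[nu]_(x in om0) ((cx x)%:E + K%:E))%E).
    apply: le_integral => //.
    - exact: integrableS iF.
    - by have := integrableD mom0 icx iK; apply: eq_integrable.
    - by move=> x; rewrite inE => /F1.
  rewrite (integralD mom0 icx iK) EFinD.
  have -> : (\int[nu]_(x in om0) (EFin \o cst K) x = K%:E * nu om0)%E.
    by rewrite -(integral_cst nu mom0).
  have nuE : nu om0 = nu setT.
    have -> : nu setT = (nu om0 + nu (~` om0))%E.
      by rewrite -measureU ?setUCr ?setICr//; exact: measurableC.
    by rewrite (cnu (~` om0)) ?adde0 ?setICl//; exact: measurableC.
  have nuf : nu setT \is a fin_num by exact: fin_num_measure.
  have icf : (\int[nu]_(x in om0) (EFin \o cx) x)%E \is a fin_num by exact: integrable_fin_num.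
  have -> : (\int[nu]_(x in om0) cx x)%:E = (\int[nu]_(x in om0) (EFin \o cx) x)%E by exact: fineK icf.
  by rewrite nuE EFinM (fineK nuf).
have E1 : \int[n1]_(z in om0 `*` om1) c z = \int[nu]_(x in om0) cx x by rewrite /Rintegral I1.
have E2 : \int[n2]_(z in om0 `*` om1) c z <= \int[nu]_(x in om0) cx x + K * fine (nu setT).
  rewrite /Rintegral I2 -lee_fin fineK//.
  exact: integrable_fin_num.
rewrite E1 => E; rewrite -(lerD2r (t * \int[nu]_(x in om0) cx x)) E.
by rewrite -addrA lerD2l -mulrDr ler_wpM2l// addrC.
Qed.

End kernel_cost.

(** * Optimality *)

Section square_norms.
Context {R : realType} {d : nat}.
Local Notation leb := (@lebesgue_rV R d).
Variables (Om : set 'rV[R]_d) (oOm : open Om).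
Let mOm : measurable Om := open_measurable_rV oOm.
Let half2 : (2 : R)^-1 + 2^-1 = 1. Proof. by rewrite -mulr2n -[_ *+ 2]mulr_natl divff. Qed.

Lemma Lp_norm2_sq f : in_Lp Om 2 f ->
  (Lp_norm Om 2 f ^+ 2 = (\int[leb]_(x in Om) (f x * f x))%:E)%E.
Proof.
move=> Lf; have [i2 _] := hoelder_Om oOm (ltr0Sn R 1) (ltr0Sn R 1) half2 Lf Lf.
have I0 : (0 <= \int[leb]_(x in Om) (f x * f x)%:E)%E.
  by apply: integral_ge0 => x _; rewrite lee_fin -expr2 sqr_ge0.
have fin : (\int[leb]_(x in Om) (f x * f x)%:E)%E \is a fin_num by exact: integrable_fin_num.
have -> : (\int[leb]_(x in Om) (f x * f x))%:E = (\int[leb]_(x in Om) (f x * f x)%:E)%E.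
  exact: fineK.
rewrite /Lp_norm LnormE.
have -> : (\int[leb]_x (`|(f \_ Om) x| `^ 2)%:E = \int[leb]_(x in Om) (f x * f x)%:E)%E.
  rewrite [RHS]integral_mkcond; apply: eq_integral => x _; rewrite !patchE.
  case: ifP => _; last by rewrite normr0 powR0.
  by rewrite (powR_mulrn 2)// real_normK ?num_real// expr2.
rewrite -(fineK fin) poweR_EFin -EFin_expe -powR_mulrn ?powR_ge0// -powRrM mulVf//.
by rewrite powRr1// fine_ge0.
Qed.

Lemma in_Lp2_mul f g : in_Lp Om 2 f -> in_Lp Om 2 g ->
  leb.-integrable Om (EFin \o (fun x => f x * g x)) /\
  `|\int[leb]_(x in Om) (f x * g x)| <= fine (Lp_norm Om 2 f) * fine (Lp_norm Om 2 g).
Proof.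
move=> Lf Lg; have [i2 B] := hoelder_Om oOm (ltr0Sn R 1) (ltr0Sn R 1) half2 Lf Lg.
by split => //; rewrite -lee_fin EFinM !fineK// in_Lp_fin_num.
Qed.

Lemma Rintegral_square_lin (t : R) f g : in_Lp Om 2 f -> in_Lp Om 2 g ->
  \int[leb]_(x in Om) ((t * g x + f x) * (t * g x + f x)) =
  \int[leb]_(x in Om) (f x * f x) + 2 * t * \int[leb]_(x in Om) (f x * g x) +
  t ^+ 2 * \int[leb]_(x in Om) (g x * g x).
Proof.
move=> Lf Lg; have [iff _] := in_Lp2_mul Lf Lf; have [ifg _] := in_Lp2_mul Lf Lg.
have [igg _] := in_Lp2_mul Lg Lg.
have iZ (a : R) h : leb.-integrable Om (EFin \o h) -> leb.-integrable Om (EFin \o (fun x => a * h x)).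
  by move=> ih; have := integrableZl mOm a ih; apply: eq_integrable => // x _; rewrite /= EFinM.
have i1 := iZ (2 * t) _ ifg; have i2 := iZ (t ^+ 2) _ igg.
have i3 : leb.-integrable Om (EFin \o (fun x => f x * f x + 2 * t * (f x * g x))).
  by have := integrableD mOm iff i1; apply: eq_integrable => // x _; rewrite /= EFinD.
rewrite -!RintegralZl// -RintegralD// -RintegralD//.
by apply: eq_Rintegral => x _; ring.
Qed.

(** All derivatives are moved to [phi], so that the state equation becomes a statement about
    integrals of [y] itself. *)
Lemma grad_pairing_test (p q : R) y phi : 1 < p -> 1 < q -> q^-1 + p^-1 = 1 ->
  in_W1p Om q y -> test_function Om phi ->
  grad_pairing Om y phi = - (\int[leb]_(x in Om) (y x * lap phi x)) /\
  leb.-integrable Om (EFin \o (fun x => y x * lap phi x)).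
Proof.
move=> p1 q1 qp hy tphi; have p0 := lt_trans ltr01 p1.
have hphi := in_W1p_test p0 tphi; have [sphi _] := test_functionP tphi.
have td i : test_function Om (partial i phi) by exact: test_function_derive.
have tdd i : test_function Om (partial i (partial i phi)) by apply: test_function_derive; exact: td.
have ly : loc_integrable Om y by apply: (in_Lp_loc_integrable oOm q1); exact: (proj1 hy).
have iy i := loc_integrable_mul_test oOm ly (tdd i).
have lapE x : y x * lap phi x = \sum_(i < d) y x * partial i (partial i phi) x.
  by rewrite /lap mulr_sumr.
have ilap : leb.-integrable Om (EFin \o (fun x => y x * lap phi x)).
  have HI := integrable_sum mOm (index_enum 'I_d) (P := xpredT)
    (h := fun i x => (y x * partial i (partial i phi) x)%:E) (fun i _ => iy i).
  by apply: eq_integrable HI => // x _; rewrite /= lapE sumEFin.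
split => //; rewrite (grad_pairingE oOm q1 p1 qp hy hphi).
have -> : \int[leb]_(x in Om) (y x * lap phi x) =
    \sum_(i < d) \int[leb]_(x in Om) (y x * partial i (partial i phi) x).
  rewrite /Rintegral; under eq_integral do rewrite lapE -sumEFin.
  rewrite (@integral_sum _ _ _ leb Om mOm _ (fun i x => (y x * partial i (partial i phi) x)%:E))//.
  by rewrite sum_fine// => i _; apply: integrable_fin_num => //; exact: iy.
rewrite -sumrN; apply: eq_bigr => i _.
have [wy Lwy] := in_W1p_weak_partial oOm i hy.
have [_ lw /(_ _ (td i)) ->] := wy; rewrite opprK.
have a1 := weak_partial_ae oOm (is_weak_partial_smooth Om i sphi).
have i1 := grad_pairing_integrable oOm q1 p1 qp i hy hphi.
have i2 := loc_integrable_mul_test oOm lw (td i).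
congr fine; apply: ae_eq_integral => //.
- by case/integrableP: i1.
- by case/integrableP: i2.
- by apply: filterS a1 => x H Ox; rewrite /= H.
Qed.

End square_norms.

Section optimality.
Context {R : realType} {d0 d : nat}.
Local Notation leb := (@lebesgue_rV R d).
Local Notation XY := ('rV[R]_d0 * 'rV[R]_d)%type.
Variables (eta b : 'rV[R]_d -> R).
Hypotheses (seta : smooth eta) (sb : smooth b).
Hypothesis eta0 : forall x, 0 <= eta x.
Hypotheses (etav : forall x, 2^-1 < `|x| -> eta x = 0) (bv : forall x, 2^-1 < `|x| -> b x = 0).
Hypothesis lapb : forall x, lap b x = - (2 ^+ d * eta (2 *: x) - eta x).
Hypothesis (M_gt0 : 0 < \int[leb]_x eta x).
Local Notation M := (\int[leb]_x eta x).

Variables (Om om1 : set 'rV[R]_d) (om0 : set 'rV[R]_d0).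
Variables (u0 : {finite_measure set 'rV[R]_d0 -> \bar R}) (c : XY -> R).
Variables (alpha q : R) (yd : 'rV[R]_d -> R).
Hypotheses (d23 : d = 2%N \/ d = 3%N) (oOm : open Om) (Omoo : (leb Om < +oo)%E).
Hypotheses (com0 : compact om0) (com1 : compact om1) (om1Om : om1 `<=` closure Om).
Hypothesis cu0 : carried_by om0 u0.
Hypothesis cc : {within om0 `*` om1, continuous c}.
Hypothesis alpha0 : 0 < alpha.
Hypothesis solvable_q : forall F, in_Wm1p Om q F -> (exists y, poisson_solution Om q F y) /\
  forall y1 y2, poisson_solution Om q F y1 -> poisson_solution Om q F y2 ->
    {ae leb, forall x, Om x -> y1 x = y2 x}.
Hypothesis solvable_2 : forall F, in_Wm1p Om 2 F -> exists y, poisson_solution Om 2 F y.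
Local Notation p := (conjexp q).
Hypotheses (p1 : 1 < p) (q1 : 1 < q) (q2 : q < 2) (p2 : 2 < p).
Hypotheses (qp : q^-1 + p^-1 = 1) (dq : d.-1%:R * q < d%:R).
Hypothesis hyd : in_Lp Om 2 yd.
Variables (C : R) (C0 : 0 <= C).
Hypothesis morrey : forall phi x, test_function Om phi ->
  `|phi x| <= C * fine (W1p_norm Om p phi).

Let mOm : measurable Om := open_measurable_rV oOm.
Let mom0 := compact_measurable_rV com0.
Let mom1 := compact_measurable_rV com1.
Let d2 : (1 < d)%N. Proof. by case: d23 => ->. Qed.
Let d22 : d.-2%:R * 2 < d%:R :> R.
Proof. by rewrite -natrM ltr_nat; case: d23 => ->. Qed.

Local Notation embed := (C0_embedding Om).
Local Notation functional mu := (fun v => \int[mu]_(x in om1) embed v x).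

Lemma functional_Wm1p (mu : {finite_measure set 'rV[R]_d -> \bar R}) :
  in_Wm1p Om q (functional mu).
Proof. exact: (measure_functional oOm p1 C0 morrey mu com1 om1Om erefl). Qed.

Lemma control_to_state_solution (u : {charge set 'rV[R]_d -> \bar R})
    (mu : {finite_measure set 'rV[R]_d -> \bar R}) :
  (forall A, measurable A -> u A = mu A) ->
  poisson_solution Om q (functional mu) (control_to_state Om om1 q u).
Proof.
move=> uE; have FE : adjoint_embedding Om om1 u = functional mu.
  by apply/funext => v; exact: charge_integral_ge0.
have [ex _] := solvable_q (functional_Wm1p mu).
rewrite /control_to_state FE.
exact: (xgetPex (cst 0) (P := [set y | poisson_solution Om q (functional mu) y]) ex).
Qed.

Lemma solution_in_W1p F y : poisson_solution Om q F y -> in_W1p Om q y.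
Proof. by case=> -[]. Qed.

Lemma tracking_ae y z : in_W1p Om q y -> in_W1p Om q z ->
  {ae leb, forall x, Om x -> y x = z x} -> tracking Om yd y = tracking Om yd z.
Proof.
move=> hy hz yz; have my := in_Lp_measurable oOm (proj1 hy); have mz := in_Lp_measurable oOm (proj1 hz).
have md := in_Lp_measurable oOm hyd.
rewrite /tracking; congr (_ * _ ^+ 2)%E; apply: Lp_norm_ae => //; try exact: measurable_funB.
by apply: filterS yz => x H Ox; rewrite /= H.
Qed.

Lemma tracking_fin y : in_Lp Om 2 (y \- yd)%R ->
  tracking Om yd y = (2^-1 * \int[leb]_(x in Om) ((y x - yd x) * (y x - yd x)))%:E.
Proof. by move=> L; rewrite /tracking (Lp_norm2_sq oOm L). Qed.

Lemma tracking_ge0 y : (0 <= tracking Om yd y)%E.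
Proof. by rewrite /tracking mule_ge0// ?lee_fin ?invr_ge0// expe_ge0// Lp_norm_ge0. Qed.

(** Square integrability of the misfit is read off from the finiteness of the objective rather than
    from an embedding. *)
Lemma tracking_lty y : in_W1p Om q y -> (tracking Om yd y < +oo)%E -> in_Lp Om 2 (y \- yd)%R.
Proof.
move=> hy; apply: contraPP => nL; apply/negP; rewrite -leNgt leye_eq; apply/eqP.
have md : measurable_fun Om (y \- yd)%R.
  by apply: measurable_funB; [exact: (in_Lp_measurable oOm (proj1 hy))|exact: (in_Lp_measurable oOm hyd)].
have : Lp_norm Om 2 (y \- yd)%R = +oo%E.
  apply/eqP; rewrite -leye_eq leNgt; apply/negP => H; apply: nL; apply/in_LpP; split => //.
  exact: measurable_fun_restrict.
by rewrite /tracking => ->; rewrite expe2 mulyy gt0_muley// lte_fin invr_gt0.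
Qed.

Lemma coupling_integral (pi : {finite_measure set XY -> \bar R}) :
  (\int[pi]_(z in om0 `*` om1) (c z)%:E = (\int[pi]_(z in om0 `*` om1) c z)%:E)%E.
Proof.
have [K _ cK] := cost_bounded com0 com1 cc.
have i : pi.-integrable (om0 `*` om1) (EFin \o c).
  apply: bounded_integrable cK; first exact: measurableX.
  by apply: within_continuous_measurable_prod => //; exact: measurableX.
by rewrite /Rintegral fineK//; apply: integrable_fin_num => //; exact: measurableX.
Qed.

Lemma transport_cost_coupling u (pi : {finite_measure set XY -> \bar R}) :
  is_coupling om0 om1 u0 u pi ->
  (transport_cost om0 om1 c u0 u <= (\int[pi]_(z in om0 `*` om1) c z)%:E)%E.
Proof.
by move=> cpi; rewrite -coupling_integral; apply: ereal_inf_lbound; exists pi.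
Qed.

(** Every coupling has the mass of [u0] and [c] is bounded on the product. The bound excludes the
    value [-oo], so that a finite objective forces a finite cost. *)
Lemma transport_cost_lower u : exists L : R, (L%:E <= transport_cost om0 om1 c u0 u)%E.
Proof.
have [K K0 cK] := cost_bounded com0 com1 cc.
exists (- (K * fine (u0 setT))); apply: le_ereal_inf_tmp => _ [pi [cpi fpi _] <-].
have mD : measurable (om0 `*` om1) by exact: measurableX.
rewrite coupling_integral lee_fin lerNl.
have mc : measurable_fun (om0 `*` om1) c by exact: within_continuous_measurable_prod.
have i : pi.-integrable (om0 `*` om1) (EFin \o c) by exact: bounded_integrable cK.
rewrite (le_trans (ler_norm _))// normrN (le_trans (le_normr_Rintegral mD i))//.
apply: (@le_trans _ _ (\int[pi]_(z in om0 `*` om1) K)).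
  apply: le_Rintegral => //; first exact: integrable_norm.
  exact: finite_measure_integrable_cst.
have fin A : measurable A -> pi A \is a fin_num by move=> mA; exact: fin_num_measure.
rewrite Rintegral_cst// ler_wpM2l// fine_le ?fin//; first exact: fin_num_measure.
by rewrite -fpi// /pushforward preimage_setT le_measure// inE.
Qed.

Variable (xi : 'rV[R]_d).

(** The kernel is divided by its mass [M], so that replacing a point mass by it preserves mass. *)
Lemma point_kernel_measure s : 0 < s -> [set x | `|x - xi| <= 2^-1 / s] `<=` om1 ->
  exists nu : {finite_measure set 'rV[R]_d -> \bar R},
  [/\ nu setT = 1%E, carried_by om1 nu &
    forall (f : 'rV[R]_d -> R) (K : R), measurable_fun om1 f ->
      (forall x, om1 x -> `|f x| <= K) ->
      M * \int[nu]_(x in om1) f x = \int[leb]_x (scaled d s xi eta x * f x)].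
Proof.
move=> s0 Bom; pose h x := M^-1 * scaled d s xi eta x.
have ch : continuous h by apply: smooth_continuous; apply: smoothZ; exact: smooth_scaled.
have h0 x : 0 <= h x by rewrite mulr_ge0 ?invr_ge0 ?(ltW M_gt0)// scaled_ge0.
have hv x : 2^-1 / s < `|x - xi| -> h x = 0.
  by move=> xr; rewrite /h (scaled_support d s0 etav xr) mulr0.
have ce := smooth_continuous seta.
have ie : leb.-integrable setT (EFin \o eta).
  by apply: (@compact_support_integrable _ _ _ 0 2^-1) => // x; rewrite subr0; exact: etav.
have is_ := integrable_scaled d xi s0 ce etav.
have [nu [nuT cnu nuI]] := kernel_measure ch h0 hv.
exists nu; split.
- rewrite nuT RintegralZl// Rintegral_dilate// mulVf// gt_eqF//.
- exact: cnu.
move=> f K mf fK; rewrite (nuI _ _ K mom1 Bom mf fK).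
pose g := f \_ om1.
have E k : (forall x, 2^-1 / s < `|x - xi| -> k x = 0) ->
    \int[leb]_x (k x * f x) = \int[leb]_x (k x * g x).
  move=> kv; apply: eq_Rintegral => x _; rewrite /g patchE; case: ifPn => // xD.
  rewrite kv ?mul0r// ltNge; apply/negP => /Bom Dx.
  by move: xD; rewrite notin_setE.
rewrite !E//; last exact: scaled_support.
have gK x : `|g x| <= `|K|.
  rewrite /g patchE; case: ifP => [|_]; last by rewrite normr0.
  by rewrite inE => /fK /le_trans; apply; exact: ler_norm.
have mg : measurable_fun setT g by apply/(measurable_restrictT _ mom1).
have cs : continuous (scaled d s xi eta) by apply: smooth_continuous; exact: smooth_scaled.
have ihg : leb.-integrable setT (EFin \o (fun x => h x * g x)).
  have [N N0 hN] := compact_support_bounded ch hv.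
  apply: (@bounded_support_integrable _ _ _ (N * `|K|) xi (2^-1 / s)).
  - by apply: measurable_funM => //; exact: continuous_measurable_rV.
  - by move=> x; rewrite normrM ler_pM.
  - by move=> x /hv ->; rewrite mul0r.
rewrite -RintegralZl//; apply: eq_Rintegral => x _.
by rewrite /h !mulrA mulfV ?mul1r// gt_eqF.
Qed.

Lemma embed_kernel s v : 0 < s -> [set x | `|x - xi| <= 2^-1 / s] `<=` Om ->
  in_W1p0 Om p v ->
  \int[leb]_x (scaled d s xi eta x * embed v x) =
  \int[leb]_(x in Om) (scaled d s xi eta x * v x).
Proof.
move=> s0 BOm hv; have [[cE _] Ev _] := C0_embeddingP oOm p1 C0 morrey hv.
rewrite -(Rintegral_Om_support (Om := Om)); last first.
  move=> x nx; rewrite (scaled_support d s0 etav) ?mul0r// ltNge.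
  by apply/negP => /BOm.
have ms : measurable_fun Om (scaled d s xi eta).
  by apply: measurable_funTS; apply: continuous_measurable_rV; apply: smooth_continuous; exact: smooth_scaled.
congr fine; apply: ae_eq_integral => //.
- apply/measurable_EFinP; apply: measurable_funM => //.
  apply: within_continuous_measurable_rV => //.
  by apply: continuous_subspaceW cE; exact: subset_closure.
- apply/measurable_EFinP; apply: measurable_funM => //.
  exact: (in_Lp_measurable oOm (proj1 (proj1 hv))).
- by apply: filterS Ev => x H Ox; rewrite /= H.
Qed.

Lemma embed_bounded v : in_W1p0 Om p v ->
  measurable_fun om1 (embed v) /\
  forall x, om1 x -> `|embed v x| <= C * fine (W1p_norm Om p v).
Proof.
move=> hv; have [[cE _] _ bE] := C0_embeddingP oOm p1 C0 morrey hv; split.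
  by apply: within_continuous_measurable_rV => //; exact: continuous_subspaceW om1Om cE.
by move=> x /om1Om; exact: bE.
Qed.

Lemma marginal_carried (pi : {finite_measure set XY -> \bar R}) A :
  carried_by (om0 `*` om1) pi -> measurable A -> A `&` om1 = set0 ->
  pi (snd @^-1` A) = 0%E.
Proof.
move=> cpi mA A0; apply: cpi.
  by rewrite -[_ @^-1` _]setTI; exact: (@measurable_snd _ _ 'rV[R]_d0 'rV[R]_d).
apply/seteqP; split => // -[x y] [/= Ay [_ /= oy]].
by have : (A `&` om1) y by []; rewrite A0.
Qed.

Lemma snd_marginal (pi : {finite_measure set XY -> \bar R}) :
  exists mu : {finite_measure set 'rV[R]_d -> \bar R}, forall A, mu A = pi (snd @^-1` A).
Proof.
apply: finite_pushforward; last exact: measurable_snd.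
by rewrite -ge0_fin_numE//; exact: fin_num_measure.
Qed.

Lemma functional_rel (m1 m2 nu : {finite_measure set 'rV[R]_d -> \bar R}) (a : R) v :
  om1 xi -> 0 <= a -> in_W1p0 Om p v ->
  (forall A, measurable A -> (m1 A + a%:E * \d_xi A = m2 A + a%:E * nu A)%E) ->
  \int[m1]_(x in om1) embed v x + a * embed v xi =
  \int[m2]_(x in om1) embed v x + a * \int[nu]_(x in om1) embed v x.
Proof.
move=> oxi a0 hv H; have [mE bE] := embed_bounded hv.
have doo : ((\d_xi : {measure set 'rV[R]_d -> \bar R}) setT < +oo)%E.
  by rewrite /= diracT ltry.
have [dl dlE] := finite_measure_of doo.
have H' A : measurable A -> (m1 A + a%:E * dl A = m2 A + a%:E * nu A)%E.
  by move=> mA; rewrite dlE; exact: H.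
rewrite -(Rintegral_measure_rel a0 mom1 mE bE H'); congr (_ + a * _).
have -> : \int[dl]_(x in om1) embed v x = \int[\d_xi]_(x in om1) embed v x.
  by congr fine; apply: eq_measure_integral => A mA _; exact: dlE.
rewrite /Rintegral integral_dirac//; last exact/measurable_EFinP.
by rewrite diracE mem_set// mul1e.
Qed.

(** * Competitors near an interior point *)

Section local_ball.
Variable s : R.
Hypotheses (s0 : 0 < s) (Bom : [set x | `|x - xi| <= 2^-1 / s] `<=` om1).
Hypothesis BOm : [set x | `|x - xi| <= 2^-1 / s] `<=` Om.

Let oxi : om1 xi.
Proof. by apply: Bom; rewrite /= subrr normr0 divr_ge0// ltW. Qed.

Let th : test_function Om (scaled d s xi eta).
Proof.
apply: (test_function_cball _ _ BOm); first exact: smooth_scaled.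
exact: scaled_support.
Qed.

Let Lh r : 0 < r -> in_Lp Om r (scaled d s xi eta).
Proof. by move=> r0; exact: in_Lp_test. Qed.

(* Witness: all the mass of [u0] is sent to the smooth kernel around [xi]. *)
Lemma finite_competitor : exists u : {charge set 'rV[R]_d -> \bar R},
  carried_by om1 u /\ (objective Om om1 q om0 c u0 alpha (tracking Om yd) u < +oo)%E.
Proof.
have [nu [nuT cnu nuI]] := point_kernel_measure s0 Bom.
have mpair : measurable_fun setT (fun x : 'rV[R]_d0 => (x, xi)).
  by apply: measurable_fun_pair => //; exact: measurable_cst.
have u0oo : (u0 setT < +oo)%E by rewrite -ge0_fin_numE//; exact: fin_num_measure.
have [pi0 pi0E] := finite_pushforward u0oo mpair.
have cpi0 : carried_by (om0 `*` om1) pi0.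
  move=> A mA A0; rewrite pi0E; apply: cu0.
    by rewrite -[_ @^-1` _]setTI; exact: mpair.
  apply/seteqP; split => // x [/= Ax ox].
  by have : (A `&` om0 `*` om1) (x, xi) by []; rewrite A0.
have t01 : 0 <= (1 : R) <= 1 by rewrite ler01 lexx.
(* [pi0] couples [u0] with its whole mass placed at [xi]; with [t = 1] all of it is spread. *)
have [nu0 [pit [[cnu0 nu0T] cpit fpit spit _]]] :=
  spread_coupling mom0 mom1 xi cpi0 cnu nuT t01.
have [mut mutE] := snd_marginal pit.
have nu0E : nu0 setT = u0 setT.
  by rewrite nu0T pi0E; congr (u0 _); apply/seteqP; split => x.
pose k := fine (u0 setT).
have kE : k%:E = u0 setT by rewrite fineK//; exact: fin_num_measure.
have k0 : 0 <= k by rewrite fine_ge0.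
have mutnu A : measurable A -> mut A = (k%:E * nu A)%E.
  move=> mA; have := spit A mA; rewrite mul1e nu0E -kE -mutE.
  have -> : pi0 (snd @^-1` A) = (k%:E * \d_xi A)%E.
    rewrite pi0E diracE kE; have [xA|xA] := boolP (xi \in A).
      rewrite mule1; congr (u0 _); apply/seteqP; split => // x _ /=.
      by rewrite inE in xA.
    rewrite mule0 (_ : _ @^-1` _ = set0) ?measure0//.
    by apply/seteqP; split => // x /= Ax; move: xA; rewrite notin_setE.
  have fd : (k%:E * \d_xi A)%E \is a fin_num by rewrite diracE fin_numM.
  by rewrite mul1e [RHS]addeC => /(congr1 (fun z => z - k%:E * \d_xi A)%E); rewrite !addeK.
have FE v : in_W1p0 Om p v -> functional mut v =
    k * M^-1 * \int[leb]_(x in Om) (scaled d s xi eta x * v x).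
  move=> hv; have [mE bE] := embed_bounded hv.
  have zoo : ((mzero : {measure set 'rV[R]_d -> \bar R}) setT < +oo)%E by exact: ltry.
  have [z zE] := finite_measure_of zoo.
  have rel A : measurable A -> (mut A + k%:E * z A = z A + k%:E * nu A)%E.
    by move=> mA; rewrite !zE /= mule0 adde0 add0e mutnu.
  have := Rintegral_measure_rel k0 mom1 mE bE rel.
  have -> : \int[z]_(x in om1) embed v x = 0.
    rewrite /Rintegral (eq_measure_integral mzero); last by move=> A mA _; exact: zE.
    by rewrite integral_measure_zero.
  rewrite mulr0 addr0 add0r => ->; rewrite -mulrA; congr (_ * _).
  by rewrite -embed_kernel// -(nuI _ _ mE bE) mulrA mulVf ?mul1r// gt_eqF.
(* This source has an [L^2] density, so the equation is solvable for the exponent 2. The solution is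
   square integrable and, as [q < 2 < p], also solves the equation for [q]. *)
pose G v := k * M^-1 * \int[leb]_(x in Om) (scaled d s xi eta x * v x).
have half2 : (2 : R)^-1 + 2^-1 = 1 by rewrite -mulr2n -[_ *+ 2]mulr_natl divff.
have h2 := Lh (ltr0Sn R 1).
have GW : in_Wm1p Om 2 G.
  rewrite /in_Wm1p conjexp2; split.
    move=> a v w hv hw; have [iv _] := in_Lp2_mul oOm h2 (proj1 (proj1 hv)).
    have [iw _] := in_Lp2_mul oOm h2 (proj1 (proj1 hw)).
    have iav : leb.-integrable Om (EFin \o (fun x => a * (scaled d s xi eta x * v x))).
      by have := integrableZl mOm a iv; apply: eq_integrable => // x _; rewrite /= EFinM.
    rewrite /G.
    have -> : \int[leb]_(x in Om) (scaled d s xi eta x * (a * v x + w x)) =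
        a * \int[leb]_(x in Om) (scaled d s xi eta x * v x) +
        \int[leb]_(x in Om) (scaled d s xi eta x * w x).
      rewrite -RintegralZl// -RintegralD//.
      by apply: eq_Rintegral => x _; rewrite mulrDr mulrCA.
    by move: (Rintegral _ _ _) (Rintegral _ _ _) => *; ring.
  exists (k * M^-1 * fine (Lp_norm Om 2 (scaled d s xi eta))) => v hv.
  have [_ B] := in_Lp2_mul oOm h2 (proj1 (proj1 hv)).
  have Wf := W1p_norm_fin_num oOm (proj1 hv).
  rewrite -(fineK Wf) lee_fin /G normrM ger0_norm ?mulr_ge0 ?invr_ge0 ?(ltW M_gt0)//.
  rewrite -!mulrA ler_wpM2l// ler_wpM2l ?invr_ge0 ?(ltW M_gt0)//.
  apply: le_trans B _; rewrite ler_wpM2l ?fine_ge0 ?Lp_norm_ge0// fine_le//.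
  - exact: in_Lp_fin_num (proj1 (proj1 hv)).
  - exact: Lp_le_W1p_norm.
have [y2 [hy2 y2E]] := solvable_2 GW.
have sol2 : poisson_solution Om q (functional mut) y2.
  split; first exact: (in_W1p0_le oOm (ltW q1) q2 Omoo hy2).
  move=> v hv; rewrite FE// y2E// conjexp2.
  by apply: (in_W1p0_le oOm _ p2 Omoo hv); rewrite ler1n.
pose u : {charge set 'rV[R]_d -> \bar R} := charge_of_finite_measure mut.
have uE A : measurable A -> u A = mut A by [].
have solu := control_to_state_solution uE.
have tE := tracking_ae (solution_in_W1p solu) (solution_in_W1p sol2)
  ((solvable_q (functional_Wm1p mut)).2 _ _ solu sol2).
exists u; split.
  by move=> A mA A0; rewrite uE// mutE (marginal_carried cpit).
have Ly : in_Lp Om 2 (y2 \- yd).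
  rewrite (_ : y2 \- yd = fun x => -1 * yd x + y2 x); last by apply/funext => x /=; ring.
  by apply: (in_Lp_lin oOm) => //; [rewrite ler1n|exact: (proj1 (proj1 hy2))].
have cpl : is_coupling om0 om1 u0 u pit.
  split => //.
  - move=> A mA; rewrite /pushforward fpit// pi0E; congr (u0 _).
  - by move=> A mA; rewrite uE// mutE.
rewrite /objective tE (tracking_fin Ly).
apply: (@le_lt_trans _ _ ((2^-1 * \int[leb]_(x in Om) ((y2 x - yd x) * (y2 x - yd x)))%:E +
  alpha%:E * (\int[pit]_(z in om0 `*` om1) c z)%:E)%E); last by rewrite -EFinM -EFinD ltry.
by rewrite leeD2l// lee_wpmul2l ?lee_fin ?(ltW alpha0)// transport_cost_coupling.
Qed.

Variable ubar : {charge set 'rV[R]_d -> \bar R}.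
Hypothesis optu : optimal_control Om om1 q om0 c u0 alpha (tracking Om yd) ubar.

(** Comparison with [finite_competitor] makes the transport cost finite, so the set of couplings is
    nonempty; the second marginal of a coupling shows that [ubar] is a nonnegative measure. *)
Lemma optimal_coupling : exists pi : {finite_measure set XY -> \bar R},
  [/\ is_coupling om0 om1 u0 ubar pi,
    (tracking Om yd (control_to_state Om om1 q ubar) < +oo)%E &
    transport_cost om0 om1 c u0 ubar \is a fin_num].
Proof.
have [u [cu uoo]] := finite_competitor.
have := le_lt_trans ((proj2 optu) u cu) uoo; rewrite /objective.
set J := tracking _ _ _; set D := transport_cost _ _ _ _ _ => JD.
have J0 : (0 <= J)%E by exact: tracking_ge0.
have [L LD] := transport_cost_lower ubar.
have Doo : (D < +oo)%E.
  rewrite ltey; apply/eqP => DE; move: JD; rewrite DE gt0_muley ?lte_fin//.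
  by rewrite addey ?ltxx// gt_eqF// (lt_le_trans _ J0).
have Df : D \is a fin_num.
  by rewrite fin_real// Doo andbT (lt_le_trans _ LD)// ltNyr.
have [pi cpi] : exists pi, is_coupling om0 om1 u0 ubar pi.
  apply: contrapT => /forallNP H; move: Doo; rewrite /D /transport_cost.
  rewrite (_ : [set _ | _ in _] = set0) ?ereal_inf0 ?ltxx//.
  by apply/seteqP; split => // z [pi /H].
exists pi; split => //.
move: JD; rewrite -(fineK Df) -EFinM.
by case: (J) J0 => [r| |] //= _ _; rewrite ltry.
Qed.

Local Notation w := (point_source_state b s xi).

Let hw0 : in_W1p0 Om q w.
Proof.
have := in_W1p0_point_source sb bv d2 oOm p1 q1 qp dq s0 BOm.
exact.
Qed.

Let Lw : in_Lp Om 2 w.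
Proof. by apply: in_Lp_point_source => //; rewrite ler1n. Qed.

(** The source of [w] is [M] times the point mass at [xi] minus the kernel. Taking mass [a] from
    [xi] and spreading it over the kernel of mass 1 therefore adds [-(a / M) w]. *)
Lemma perturbed_state (mu mut nu : {finite_measure set 'rV[R]_d -> \bar R}) (a : R) y :
  0 <= a ->
  (forall (f : 'rV[R]_d -> R) (K : R), measurable_fun om1 f ->
      (forall x, om1 x -> `|f x| <= K) ->
      M * \int[nu]_(x in om1) f x = \int[leb]_x (scaled d s xi eta x * f x)) ->
  (forall A, measurable A -> (mut A + a%:E * \d_xi A = mu A + a%:E * nu A)%E) ->
  poisson_solution Om q (functional mu) y ->
  poisson_solution Om q (functional mut) (fun x => - (a / M) * w x + y x).
Proof.
move=> a0 nuI rel [hy yE]; split; first exact: (in_W1p0_lin oOm _ (ltW q1)).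
move=> v hv; have [mE bE] := embed_bounded hv.
rewrite (grad_pairing_linl oOm q1 p1 qp _ (proj1 hw0) (proj1 hy) (proj1 hv)) (yE _ hv).
rewrite (grad_pairing_point_source seta sb eta0 etav bv lapb d2 oOm p1 q1 qp dq s0 BOm C0 morrey hv).
have := functional_rel oxi a0 hv rel; have := nuI _ _ mE bE.
rewrite (embed_kernel s0 BOm hv) => <-.
have M0 : M != 0 by rewrite gt_eqF.
move: (\int[nu]_(x in om1) _) (\int[mu]_(x in om1) _) (\int[mut]_(x in om1) _) => I1 I2 I3 E.
have -> : I3 = I2 + a * I1 - a * embed v xi by rewrite -E addrK.
by field.
Qed.

(* The competitors move a fraction [t] of the atom at [xi] to the kernel around
   [xi], which changes the state by a multiple of [t w]; then [t] tends to 0. *)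
Lemma optimality_inequality (mu : {finite_measure set 'rV[R]_d -> \bar R}) (H : R) :
  (forall A, measurable A -> ubar A = mu A) -> (0 < mu [set xi])%E ->
  (forall x, om0 x -> \int[leb]_z (scaled d s xi eta z * c (x, z)) <= c (x, xi) * M + H) ->
  \int[leb]_(x in Om) ((control_to_state Om om1 q ubar x - yd x) * w x) <= alpha * H.
Proof.
move=> ubarE mxi0 HH; have [pi [cpi Joo Tf]] := optimal_coupling.
set y := control_to_state Om om1 q ubar.
have soly : poisson_solution Om q (functional mu) y by exact: control_to_state_solution.
have Lf : in_Lp Om 2 (y \- yd) by apply: tracking_lty => //; exact: solution_in_W1p soly.
pose m := fine (mu [set xi]).
have mxi := measurable_rV_set1 xi.
have mE : m%:E = mu [set xi] by rewrite fineK//; exact: fin_num_measure.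
have m0 : 0 < m by rewrite -lte_fin mE.
have [nu [nuT cnu nuI]] := point_kernel_measure s0 Bom.
set B := \int[leb]_(x in Om) _.
pose D := \int[leb]_(x in Om) (w x * w x).
pose T := fine (transport_cost om0 om1 c u0 ubar).
have TE : T%:E = transport_cost om0 om1 c u0 ubar by exact: fineK.
have M0 : M != 0 by rewrite gt_eqF.
have HK x : om0 x -> \int[nu]_(z in om1) c (x, z) <= c (x, xi) + H / M.
  move=> ox; have [K _ cK] := cost_bounded com0 com1 cc.
  have mcz : measurable_fun om1 (fun z => c (x, z)).
    have mp : measurable_fun setT (fun z : 'rV[R]_d => (x, z)).
      by apply: measurable_fun_pair => //; exact: measurable_cst.
    apply: (@measurable_comp _ _ _ _ _ _ (om0 `*` om1) c om1 (fun z : 'rV[R]_d => (x, z))) => //.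
    - exact: measurableX.
    - by move=> _ [z oz <-].
    - by apply: within_continuous_measurable_prod => //; exact: measurableX.
    - exact: measurable_funTS.
  have cxK z : om1 z -> `|c (x, z)| <= K by move=> oz; apply: cK.
  have := nuI _ _ mcz cxK => E.
  rewrite -(ler_pM2l M_gt0) E mulrDr [M * (H / M)]mulrCA divff// mulr1 [M * c _]mulrC.
  exact: HH.
have snd_pi (pi' : {finite_measure set XY -> \bar R}) : is_coupling om0 om1 u0 ubar pi' ->
    forall A, measurable A -> pi' (snd @^-1` A) = mu A.
  by case=> _ _ h A mA; rewrite -ubarE// -h.
have carried (pi' : {finite_measure set XY -> \bar R}) :
  is_coupling om0 om1 u0 ubar pi' -> carried_by (om0 `*` om1) pi' by case.
have step t : 0 < t <= 1 -> B <= (2^-1 * (m / M) * D) * t + alpha * H.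
  move=> /andP[t0 t1]; have t01 : 0 <= t <= 1 by rewrite (ltW t0).
  have [n0 [pit [[_ n0T] cpit fpit spit _]]] :=
    spread_coupling mom0 mom1 xi (carried _ cpi) cnu nuT t01.
  have [mut mutE] := snd_marginal pit.
  have n0E : n0 setT = m%:E by rewrite n0T (snd_pi _ cpi)// mE.
  have tm0 : 0 <= t * m by rewrite mulr_ge0// ltW.
  have rel A : measurable A -> (mut A + (t * m)%:E * \d_xi A = mu A + (t * m)%:E * nu A)%E.
    by move=> mA; have := spit A mA; rewrite n0E !muleA -EFinM (snd_pi _ cpi)// mutE.
  pose u : {charge set 'rV[R]_d -> \bar R} := charge_of_finite_measure mut.
  have uE A : measurable A -> u A = mut A by [].
  have cu : carried_by om1 u.
    by move=> A mA A0; rewrite uE// mutE (marginal_carried cpit).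
  pose k := - (t * m / M).
  have solt := perturbed_state tm0 nuI rel soly.
  have solu := control_to_state_solution uE.
  have tE := tracking_ae (solution_in_W1p solu) (solution_in_W1p solt)
    ((solvable_q (functional_Wm1p mut)).2 _ _ solu solt).
  have ytE : ((fun x => k * w x + y x) \- yd) = (fun x => k * w x + (y \- yd) x).
    by apply/funext => x /=; rewrite addrA.
  have Lt : in_Lp Om 2 ((fun x => k * w x + y x) \- yd).
    by rewrite ytE; apply: (in_Lp_lin oOm) => //; rewrite ler1n.
  (* Every coupling of [ubar], not one optimal plan, is spread and compared; the increment is the
     same for all, since the mass [m] of the fibre over [xi] is prescribed by [ubar]. *)
  have cost : (transport_cost om0 om1 c u0 u <= (T + t * (H / M * m))%:E)%E.
    rewrite EFinD -leeBlDr// TE; apply: le_ereal_inf_tmp => _ [pi' cpi' <-].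
    have [n1 [pit' [[cn1 n1T] cpit' fpit' spit' rpit']]] :=
      spread_coupling mom0 mom1 xi (carried _ cpi') cnu nuT t01.
    have n1E : n1 setT = m%:E by rewrite n1T (snd_pi _ cpi')// mE.
    have cpl : is_coupling om0 om1 u0 u pit'.
      split => //.
        by move=> A mA; rewrite /pushforward fpit'//; case: cpi' => _ + _; apply.
      move=> A mA; rewrite uE//; have := rel A mA; have := spit' A mA.
      rewrite n1E !muleA -EFinM (snd_pi _ cpi')// => <-.
      have fd : ((t * m)%:E * \d_xi A)%E \is a fin_num by rewrite diracE fin_numM.
      by move=> /(congr1 (fun z => z - (t * m)%:E * \d_xi A)%E); rewrite !addeK.
    rewrite coupling_integral leeBlDr// -EFinD.
    apply: le_trans (transport_cost_coupling cpl) _; rewrite lee_fin.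
    have := spread_cost com0 com1 cc (ltW t0) oxi cn1 rpit' HK.
    by rewrite n1E.
  have := (proj2 optu) u cu.
  rewrite /objective tE (tracking_fin Lt) -/y (tracking_fin Lf) -TE => J.
  have {}J := le_trans J (leeD2l _ (lee_wpmul2l (_ : (0 <= alpha%:E)%E) cost)).
  have := J _; rewrite lee_fin => /(_ (ltW alpha0)).
  rewrite -!EFinM -!EFinD lee_fin.
  have E2 : \int[leb]_(x in Om) ((k * w x + y x - yd x) * (k * w x + y x - yd x)) =
    \int[leb]_(x in Om) ((y x - yd x) * (y x - yd x)) + 2 * k * B + k ^+ 2 * D.
    rewrite -(Rintegral_square_lin oOm k Lf Lw).
    by apply: eq_Rintegral => x _ /=; rewrite !addrA.
  rewrite E2 => {}J.
  have kap : 0 < t * (m / M) by rewrite mulr_gt0// divr_gt0.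
  rewrite -(ler_pM2l kap).
  have kE : k = - (t * (m / M)) by rewrite /k mulrA.
  move: J; rewrite kE.
  have -> : t * (H / M * m) = t * (m / M) * H by move: (M^-1) => z; ring.
  have -> : 2^-1 * (m / M) * D * t + alpha * H = 2^-1 * (t * (m / M)) * D + alpha * H.
    by move: (m / M) => z; ring.
  move: (t * (m / M)) kap => r r0; rewrite -subr_ge0 => J.
  rewrite -subr_ge0; apply: le_trans J _; rewrite le_eqVlt; apply/orP; left; apply/eqP.
  by move: (Rintegral _ _ _) => I; field.
rewrite leNgt; apply/negP => BH.
pose e := B - alpha * H; have e0 : 0 < e by rewrite subr_gt0.
pose P := 2^-1 * (m / M) * D.
have P0 : 0 <= P.
  rewrite !mulr_ge0 ?invr_ge0//; first by rewrite ltW.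
  by rewrite ltW.
  by apply: Rintegral_ge0 => x _; rewrite -expr2 sqr_ge0.
(* With this [t] the quadratic term [P t] is at most [e / 2], against the assumed excess [e]. *)
pose t := Num.min 1 (e / (2 * (P + 1))).
have P1 : 0 < 2 * (P + 1) by rewrite mulr_gt0// ltr_wpDl.
have t0 : 0 < t by rewrite lt_min ltr01 divr_gt0.
have := step t; rewrite t0 ge_min lexx => /(_ isT).
rewrite -lerBlDr -/e -/P => eP.
have : P * t <= P * (e / (2 * (P + 1))) by rewrite ler_wpM2l// ge_min lexx orbT.
move/(le_trans eP); rewrite mulrA ler_pdivlMr//.
by move: (P) (e) P0 e0 => {eP} x z x0 z0; nra.
Qed.

End local_ball.

End optimality.

(** * Growth of the state near an atom *)

Lemma atom_le_Rintegral (R : realType) d (T : measurableType d)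
    (mu : {finite_measure set T -> \bar R}) (D : set T) (a : T) (f : T -> R) (K : R) :
  measurable D -> measurable [set a] -> D a -> measurable_fun D f ->
  (forall x, D x -> 0 <= f x) -> (forall x, D x -> `|f x| <= K) ->
  f a * fine (mu [set a]) <= \int[mu]_(x in D) f x.
Proof.
move=> mD ma Da mf f0 fK.
have i : mu.-integrable D (EFin \o f) by exact: bounded_integrable fK.
have muf : mu [set a] \is a fin_num by exact: fin_num_measure.
rewrite -lee_fin EFinM (fineK muf) /Rintegral fineK; last exact: integrable_fin_num.
rewrite -(integral_cst mu ma).
apply: (@le_trans _ _ (\int[mu]_(x in [set a]) (f x)%:E)%E).
  rewrite le_eqVlt; apply/orP; left; apply/eqP.
  by apply: eq_integral => x; rewrite inE /= => ->.
apply: ge0_subset_integral => //.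
- exact/measurable_EFinP.
- by move=> x ->.
Qed.

Section growth.
Context {R : realType} {d : nat}.
Local Notation leb := (@lebesgue_rV R d).
Variables (b beta : 'rV[R]_d -> R).
Hypotheses (sb : smooth b) (sbeta : smooth beta).
Hypothesis (beta0 : forall x, 0 <= beta x).
Hypotheses (bv : forall x, 2^-1 < `|x| -> b x = 0) (betav : forall x, 2^-1 < `|x| -> beta x = 0).
Hypothesis lapbeta : forall x, lap beta x = - (2 ^+ d * b (2 *: x) - b x).
Hypothesis d2 : (1 < d)%N.
Variables (Om : set 'rV[R]_d) (oOm : open Om) (xi : 'rV[R]_d) (s : R).
Hypotheses (s0 : 0 < s) (BOm : [set x | `|x - xi| <= 2^-1 / s] `<=` Om).
Let mOm : measurable Om := open_measurable_rV oOm.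

Let ball_sub j : [set x | `|x - xi| <= 2^-1 / (2 ^+ j * s)] `<=` [set x | `|x - xi| <= 2^-1 / s].
Proof.
move=> x /= h; apply: le_trans h _; rewrite ler_wpM2l ?invr_ge0// lef_pV2 ?posrE ?mulr_gt0 ?exprn_gt0//.
by rewrite ler_peMl ?(ltW s0)// exprn_ege1// ler1n.
Qed.

Lemma test_scaled j : test_function Om (scaled d (2 ^+ j * s) xi b).
Proof.
have sj : 0 < 2 ^+ j * s by rewrite mulr_gt0// exprn_gt0.
apply: (@test_function_cball _ _ _ _ xi (2^-1 / (2 ^+ j * s))); first exact: smooth_scaled.
  exact: scaled_support.
exact: subset_trans (@ball_sub j) BOm.
Qed.

(* The state equation is tested with one dilate of [beta]. *)
Lemma state_growth (om1 : set 'rV[R]_d) (q C : R) y (mu : {finite_measure set 'rV[R]_d -> \bar R}) :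
  compact om1 -> om1 `<=` closure Om -> 1 < conjexp q -> 1 < q -> q^-1 + (conjexp q)^-1 = 1 ->
  0 <= C -> (forall phi x, test_function Om phi ->
    `|phi x| <= C * fine (W1p_norm Om (conjexp q) phi)) ->
  om1 xi -> 1 <= s ->
  poisson_solution Om q (fun v => \int[mu]_(x in om1) C0_embedding Om v x) y ->
  \int[leb]_(x in Om) (y x * scaled d s xi b x) + fine (mu [set xi]) * beta 0 <=
  \int[leb]_(x in Om) (y x * scaled d (2 * s) xi b x).
Proof.
move=> com1 om1Om p1 q1 qp C0 morrey oxi s1 [hy yE].
have mom1 := compact_measurable_rV com1.
(* A single dilate, written as a potential so that [lap_potential] for the pair [b], [beta] gives
   the difference of two kernels of profile [b]. *)
pose phi := potential beta s xi 1.
have phiE x : phi x = scaled d.-2 s xi beta x by rewrite /phi /potential big_nat1 mul1r.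
have tphi : test_function Om phi by exact: test_potential.
have [gE igy] := grad_pairing_test oOm p1 q1 qp (proj1 hy) tphi.
have ly : loc_integrable Om y by apply: (in_Lp_loc_integrable oOm q1); exact: (proj1 (proj1 hy)).
have i0 := loc_integrable_mul_test oOm ly (test_scaled 0).
have i1 := loc_integrable_mul_test oOm ly (test_scaled 1).
rewrite mul1r in i0; rewrite expr1 in i1.
rewrite -lerBrDl.
have E : grad_pairing Om y phi = \int[leb]_(x in Om) (y x * scaled d (2 * s) xi b x) -
    \int[leb]_(x in Om) (y x * scaled d s xi b x).
  rewrite gE -RintegralB// -[RHS]opprK; congr (- _).
  rewrite -[RHS]mulN1r -RintegralZl//; last first.
    by have := integrableB mOm i1 i0; apply: eq_integrable => // x _; rewrite /= EFinB.
  apply: eq_Rintegral => x _; rewrite (lap_potential sbeta lapbeta d2) expr1.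
  by move: (scaled _ _ _ _ _) (scaled _ _ _ _ _) => u v; ring.
rewrite -E yE; last first.
  by apply: (in_W1p0_test oOm _ tphi); exact: lt_trans ltr01 p1.
have -> : \int[mu]_(x in om1) C0_embedding Om phi x = \int[mu]_(x in om1) phi x.
  by apply: eq_Rintegral => x; rewrite inE => /om1Om /(C0_embedding_test oOm p1 C0 morrey tphi).
have cphi : continuous phi by apply: smooth_continuous; exact: smooth_potential.
have [K _ phiK] : exists2 K : R, 0 <= K & forall x, om1 x -> `|phi x| <= K.
  by apply: compact_bounded_fun => //; exact: continuous_subspaceT.
have mxi := measurable_rV_set1 xi.
have phi0 x : om1 x -> 0 <= phi x by move=> _; rewrite phiE scaled_ge0.
have mphi : measurable_fun om1 phi by apply: measurable_funTS; exact: continuous_measurable_rV.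
have := atom_le_Rintegral mu mom1 mxi oxi mphi phi0 phiK.
apply: le_trans.
(* As [s >= 1], the factor [s^(d-2)] is at least 1, so the gain from the atom has a lower bound
   independent of the scale. *)
have {}phiE : phi xi = s ^+ d.-2 * beta 0 by rewrite phiE /scaled /dilate subrr.
rewrite [leRHS]mulrC; apply: ler_wpM2l; first exact: fine_ge0.
by rewrite phiE ler_peMl// exprn_ege1.
Qed.

(** In terms of mass preserving dilates, the state of the point source is the sum of [(2^j s)^-2]
    times the dilate of [b] at scale [2^j s]. The terms after the first have nonnegative integrals
    against [f] and are dropped; the truncations converge in [L^2], which suffices as [f] lies in
    [L^2]. *)
Lemma point_source_lower f L : in_Lp Om 2 f -> d.-2%:R * 2 < d%:R :> R ->
  L <= \int[leb]_(x in Om) (f x * scaled d s xi b x) ->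
  (forall j, 0 <= \int[leb]_(x in Om) (f x * scaled d (2 ^+ j * s) xi b x)) ->
  s^-1 ^+ 2 * L <= \int[leb]_(x in Om) (f x * point_source_state b s xi x).
Proof.
move=> Lf d22 Lle pos.
have [mw woo cvgw] := point_source_Lnorm sb bv d2 xi s0 (ler1n R 2) d22.
have Lw := in_Lp_point_source sb bv d2 oOm xi s0 (ler1n R 2) d22.
have lf : loc_integrable Om f by apply: (in_Lp_loc_integrable oOm _ Lf); rewrite ltr1n.
have sE j x : scaled d.-2 (2 ^+ j * s) xi b x = (2 ^+ j * s)^-1 ^+ 2 * scaled d (2 ^+ j * s) xi b x.
  have sj : 2 ^+ j * s != 0 by rewrite mulf_neq0 ?gt_eqF// exprn_gt0.
  rewrite /scaled mulrA; congr (_ * _).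
  by rewrite -[in RHS](subnK d2) exprD mulrCA exprVn mulVf ?expf_neq0// mulr1 subn2.
have part n : (0 < n)%N ->
    s^-1 ^+ 2 * L <= \int[leb]_(x in Om) (f x * potential b s xi n x).
  move=> n0.
  have ij j := loc_integrable_mul_test oOm lf (test_scaled j).
  have ij' j : leb.-integrable Om (EFin \o (fun x => (2 ^+ j * s)^-1 ^+ 2 * (f x * scaled d (2 ^+ j * s) xi b x))).
    by have := integrableZl mOm ((2 ^+ j * s)^-1 ^+ 2) (ij j); apply: eq_integrable => // x _; rewrite /= EFinM.
  have -> : \int[leb]_(x in Om) (f x * potential b s xi n x) =
      \sum_(0 <= j < n) (2 ^+ j * s)^-1 ^+ 2 * \int[leb]_(x in Om) (f x * scaled d (2 ^+ j * s) xi b x).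
    transitivity (\int[leb]_(x in Om) \sum_(0 <= j < n)
        (2 ^+ j * s)^-1 ^+ 2 * (f x * scaled d (2 ^+ j * s) xi b x)).
      apply: eq_Rintegral => x _; rewrite /potential mulr_sumr; apply: eq_bigr => j _.
      by rewrite sE mulrCA.
    rewrite /Rintegral; under eq_integral do rewrite -sumEFin.
    rewrite (@integral_sum _ _ _ leb Om mOm _ (fun j x => ((2 ^+ j * s)^-1 ^+ 2 * (f x * scaled d (2 ^+ j * s) xi b x))%:E))//.
    rewrite -sum_fine; last by move=> j _; apply: integrable_fin_num => //; exact: ij'.
    by apply: eq_bigr => j _; rewrite -RintegralZl.
  rewrite big_ltn// mul1r; apply: (@le_trans _ _ (s^-1 ^+ 2 * \int[leb]_(x in Om) (f x * scaled d s xi b x))).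
    by rewrite ler_wpM2l// sqr_ge0.
  rewrite lerDl sumr_ge0// => j _; rewrite mulr_ge0// sqr_ge0//.
rewrite leNgt; apply/negP => lt.
set I := \int[leb]_(x in Om) _ in lt; pose e := s^-1 ^+ 2 * L - I.
have e0 : 0 < e by rewrite subr_gt0.
pose N := fine (Lp_norm Om 2 f) + 1.
have N0 : 0 < N by rewrite ltr_wpDl// fine_ge0// Lp_norm_ge0.
have eN : 0 < e / N by rewrite divr_gt0.
(* At least one term is required, since the first one provides the lower bound. *)
have [n [n0 nE]] : exists n, (0 < n)%N /\ ('N[leb]_2%:E[EFin \o
    (fun x => point_source_state b s xi x - potential b s xi n x)%R] < (e / N)%:E)%E.
  have [n _ nP] := cvgw _ eN.
  by exists (maxn n 1); split; [rewrite leq_max orbT|apply: nP; rewrite /= leq_maxl].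
have Lp : in_Lp Om 2 (potential b s xi n).
  by apply: in_Lp_test => //; exact: test_potential.
pose h x := point_source_state b s xi x - potential b s xi n x.
have hE : h = fun x => -1 * potential b s xi n x + point_source_state b s xi x.
  by apply/funext => x; rewrite /h; ring.
have Lh : in_Lp Om 2 h by rewrite hE; apply: (in_Lp_lin oOm) => //; rewrite ler1n.
have mh : measurable_fun setT h.
  apply: measurable_funB => //; apply: continuous_measurable_rV; apply: smooth_continuous.
  exact: smooth_potential.
have hn : Lp_norm Om 2 h \is a fin_num by exact: in_Lp_fin_num.
have hlt : fine (Lp_norm Om 2 h) < e / N.
  by rewrite -lte_fin (fineK hn); apply: le_lt_trans nE; exact: Lp_norm_le_Lnorm.
have [ih Bh] := in_Lp2_mul oOm Lf Lh.
have [ip _] := in_Lp2_mul oOm Lf Lp.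
have IE : I = \int[leb]_(x in Om) (f x * potential b s xi n x) + \int[leb]_(x in Om) (f x * h x).
  by rewrite /I -RintegralD//; apply: eq_Rintegral => x _; rewrite /h; ring.
have := part n n0; have : - (\int[leb]_(x in Om) (f x * h x)) < e; last first.
  by rewrite /e IE; move: (\int[leb]_(x in Om) _) (\int[leb]_(x in Om) _) (s^-1 ^+ 2 * L) => *; lra.
apply: le_lt_trans (_ : fine (Lp_norm Om 2 f) * (e / N) < e).
  apply: le_trans (le_trans _ Bh) _; first by rewrite -normrN ler_norm.
  by rewrite ler_wpM2l ?fine_ge0 ?Lp_norm_ge0// ltW.
by rewrite mulrA ltr_pdivrMr// mulrC ltr_pM2l// ltrDl.
Qed.

End growth.

Lemma ball_in_interior (R : realType) d (A : set 'rV[R]_d) (xi : 'rV[R]_d) : interior A xi ->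
  exists2 S : R, 1 <= S & forall s, S <= s -> [set x | `|x - xi| <= 2^-1 / s] `<=` A.
Proof.
move=> /nbhs_ballP[e /= e0 eA]; exists (Num.max 1 e^-1); first by rewrite le_max lexx.
move=> s; rewrite ge_max => /andP[s1 es] x /= xs; apply: eA.
rewrite -ball_normE /= distrC; apply: le_lt_trans xs _.
have s0 : 0 < s by exact: lt_le_trans ltr01 s1.
rewrite ltr_pdivrMr//; have : 1 <= e * s by rewrite -(mulfV (lt0r_neq0 e0)) ler_wpM2l// ltW.
by apply: lt_le_trans; rewrite invf_lt1// ltr1n.
Qed.

Lemma geometric_unbounded (R : realType) (a K : R) : 0 < a -> exists n, K < a * n%:R.
Proof.
move=> a0; exists (Num.truncn (K / a)).+1.
by rewrite mulrC -ltr_pdivrMr// truncnS_gt.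
Qed.

Theorem corollary5p6 (R : realType) (d0 d1 : nat)
  (Om om1 : set 'rV[R]_d1) (om0 : set 'rV[R]_d0)
  (u0 : {finite_measure set 'rV[R]_d0 -> \bar R})
  (c : 'rV[R]_d0 * 'rV[R]_d1 -> R) (alpha pOm q : R)
  (yd : 'rV[R]_d1 -> R)
  (hd1 : d1 = 2%N \/ d1 = 3%N)
  (hOm : lipschitz_domain Om) (hOmb : bounded_set Om)
  (hom0 : compact om0) (hom0n : om0 !=set0)
  (hom1 : compact om1) (hom1n : om1 !=set0) (hom1Om : om1 `<=` closure Om)
  (hu0 : carried_by om0 u0)
  (hc : {within om0 `*` om1, continuous c})
  (halpha : 0 < alpha)
  (hpOm : d1%:R < pOm) (hpoisson : poisson_exponent Om pOm)
  (hq : d1%:R < conjexp q < pOm) (hq3 : d1 = 3%N -> conjexp q < 6)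
  (hc2 : Ck_on_compact (om0 `*` om1) 2 c)
  (hyd : in_Lp Om 2 yd) (hydc : {within om1, continuous yd})
  (ubar : {charge set 'rV[R]_d1 -> \bar R}) :
  optimal_control Om om1 q om0 c u0 alpha (tracking Om yd) ubar ->
  forall xi, interior om1 xi -> ubar [set xi] = 0%E.
Proof.
move=> hopt xi xiI; apply: contrapT => unz.
have [d_p pp] := andP hq.
have dge2 : 2 <= d1%:R :> R by rewrite ler_nat; case: hd1 => ->.
have d2 : (1 < d1)%N by case: hd1 => ->.
have p2 : 2 < conjexp q by exact: le_lt_trans dge2 d_p.
have [q1 q2 qp pE] := conjexp_gt2 p2.
have p1 : 1 < conjexp q by apply: lt_trans p2; rewrite ltr1n.
(* A restatement of [d1 < conjexp q], in the form that makes the gradient of the fundamental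
   solution [q]-integrable. *)
have dq : d1.-1%:R * q < d1%:R.
  move: d_p; rewrite pE ltr_pdivlMr ?subr_gt0// mulrBr mulr1 ltrBlDr => h.
  rewrite -subn1 natrB ?(ltnW d2)// mulrBl mul1r ltrBlDr.
  by rewrite [_ + q]addrC.
have oOm : open Om by case: hOm.
have Omoo : (lebesgue_rV d1 Om < +oo)%E.
  have [r OmB] : exists r : R, Om `<=` [set x | `|x - 0| <= r].
    have [M0 [_ hM]] := hOmb; exists (M0 + 1) => x Ox.
    by rewrite /= subr0; apply: hM => //; rewrite ltrDl.
  apply: le_lt_trans (lebesgue_cball_lty 0 r); apply: le_measure => //; rewrite inE.
    exact: open_measurable_rV.
  exact: measurable_cball.
(* [om1] may touch the boundary, but an interior point of [om1] is interior to the closure of [Om],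
   and the Lipschitz property excludes boundary points there. *)
have xiOm : interior Om xi.
  apply: open_nbhs_nbhs; split => //; apply: (lipschitz_interior_closure hOm).
  exact: (interiorS hom1Om) xiI.
(* Solvability is needed for two exponents in the admissible range: [q] for the states and 2 for the
   finite competitor. *)
have pq : conjexp pOm < q by rewrite -(conjexpK q1); exact: conjexp_lt.
have q_p : q < pOm by apply: lt_trans pp; exact: lt_trans q2 p2.
have p2Om : 2 < pOm by exact: lt_trans p2 pp.
have solq : forall F, in_Wm1p Om q F -> (exists y, poisson_solution Om q F y) /\
    forall y1 y2, poisson_solution Om q F y1 -> poisson_solution Om q F y2 ->
    {ae lebesgue_rV d1, forall x, Om x -> y1 x = y2 x}.
  by apply: hpoisson; rewrite pq.
have sol2 F : in_Wm1p Om 2 F -> exists y, poisson_solution Om 2 F y.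
  move=> hF; have [|ex _] := hpoisson 2 _ F hF => //.
  by rewrite p2Om andbT (lt_trans pq).
have [eta [b [beta [[seta sb sbeta] [eta0 b0 beta0] [etav bv betav] [lapb lapbeta] [b00 M0]]]]] :=
  @telescoping_kernels R d1 (ltnW d2).
have [C C0 morrey] := morrey_test seta sb eta0 etav bv lapb d2 oOm p1 q1 qp dq M0.
have [S1 S1ge1 S1b] := ball_in_interior xiI.
have [S2 S2ge1 S2b] := ball_in_interior xiOm.
(* From this scale on the balls lie in both [om1] and [Om]; the argument then runs along the scales
   [2^j S], all at least 1. *)
pose S := Num.max S1 S2.
have sge j : S <= 2 ^+ j * S.
  rewrite ler_peMl//; last by rewrite exprn_ege1// ler1n.
  by rewrite (le_trans ler01)// le_max S1ge1.
have Sge1 : 1 <= S by rewrite le_max S1ge1.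
have s1 j : 1 <= 2 ^+ j * S by exact: le_trans Sge1 (sge j).
have s0 j : 0 < 2 ^+ j * S by exact: lt_le_trans ltr01 (s1 j).
have Bom j : [set x | `|x - xi| <= 2^-1 / (2 ^+ j * S)] `<=` om1.
  by apply: S1b; apply: le_trans (sge j); rewrite le_max lexx.
have BOm j : [set x | `|x - xi| <= 2^-1 / (2 ^+ j * S)] `<=` Om.
  by apply: S2b; apply: le_trans (sge j); rewrite le_max lexx orbT.
have oxi : om1 xi by exact: interior_subset.
have [pi [cpi Joo _]] := optimal_coupling seta eta0 etav M0 oOm Omoo hom0 hom1 hom1Om
  hu0 hc halpha solq sol2 p1 q1 q2 p2 hyd C0 morrey (s0 0) (Bom 0) (BOm 0) hopt.
have [mu muE] := snd_marginal pi.
have ubarE A : measurable A -> ubar A = mu A.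
  by move=> mA; rewrite muE; case: cpi => _ _ <-.
have mxi := measurable_rV_set1 xi.
have mu0 : (0 < mu [set xi])%E.
  by rewrite lt_neqAle measure_ge0 andbT eq_sym -ubarE//; apply/eqP.
have m0 : 0 < fine (mu [set xi]).
  by rewrite fine_gt0// mu0 -ge0_fin_numE// fin_num_measure.
have [H H0 HH] := kernel_cost seta sb eta0 b0 etav bv lapb d2 hom0 hom1 hc2.
have [Y Y0 ydY] := compact_bounded_fun hom1 hydc.
set y := control_to_state Om om1 q ubar.
have soly : poisson_solution Om q (fun v => \int[mu]_(x in om1) C0_embedding Om v x) y.
  exact: (control_to_state_solution oOm hom1 hom1Om solq p1 C0 morrey ubarE).
have Lf : in_Lp Om 2 (y \- yd) by exact: (tracking_lty oOm hyd (solution_in_W1p soly) Joo).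
pose Ib := \int[lebesgue_rV d1]_x b x.
pose G j := \int[lebesgue_rV d1]_(x in Om) (y x * scaled d1 (2 ^+ j * S) xi b x).
have cb := smooth_continuous sb.
have ib : (lebesgue_rV d1).-integrable setT (EFin \o b).
  by apply: (@compact_support_integrable _ _ _ 0 2^-1) => // x; rewrite subr0; exact: bv.
have Ib0 : 0 <= Ib by apply: Rintegral_ge0.
have mOm := open_measurable_rV oOm.
have tb j := test_scaled sb bv (s0 0) (BOm 0) j.
have iy j : (lebesgue_rV d1).-integrable Om (EFin \o (fun x => y x * scaled d1 (2 ^+ j * S) xi b x)).
  have := loc_integrable_mul_test oOm (in_Lp_loc_integrable oOm q1 (proj1 (solution_in_W1p soly))) (tb j).
  by rewrite mul1r.
have iyd j : (lebesgue_rV d1).-integrable Om (EFin \o (fun x => yd x * scaled d1 (2 ^+ j * S) xi b x)).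
  have := loc_integrable_mul_test oOm (in_Lp_loc_integrable oOm (ltr1n R 2) hyd) (tb j).
  by rewrite mul1r.
(* Continuity of [yd] on [om1] enters here: its contribution is bounded by the same constant at all
   scales, because the dilates of [b] keep their mass. *)
have ydb j : \int[lebesgue_rV d1]_(x in Om) (yd x * scaled d1 (2 ^+ j * S) xi b x) <= Y * Ib.
  have isc := integrable_scaled d1 xi (s0 j) cb bv.
  have -> : Y * Ib = \int[lebesgue_rV d1]_(x in Om) (Y * scaled d1 (2 ^+ j * S) xi b x).
    rewrite RintegralZl//; last exact: integrableS isc.
    congr (_ * _); rewrite Rintegral_Om_support; last first.
      move=> x nx; rewrite (scaled_support d1 (s0 j) bv)// ltNge.
      by apply/negP => /(@BOm j).
    by rewrite Rintegral_dilate.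
  apply: le_Rintegral => //.
    have := integrableZl mOm Y (integrableS measurableT mOm (@subsetT _ _) isc).
    by apply: eq_integrable => // x _; rewrite /= EFinM.
  move=> x _; have [xr|xr] := leP (`|x - xi|) (2^-1 / (2 ^+ j * S)); last first.
    by rewrite (scaled_support d1 (s0 j) bv xr) !mulr0.
  apply: ler_wpM2r; first exact: scaled_ge0.
  by apply: le_trans (ler_norm _) _; apply: ydY; exact: (Bom j).
have fE j : \int[lebesgue_rV d1]_(x in Om) ((y \- yd) x * scaled d1 (2 ^+ j * S) xi b x) =
    G j - \int[lebesgue_rV d1]_(x in Om) (yd x * scaled d1 (2 ^+ j * S) xi b x).
  by rewrite -RintegralB//; apply: eq_Rintegral => x _ /=; rewrite mulrBl.
have growth j : G j + fine (mu [set xi]) * beta 0 <= G j.+1.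
  rewrite /G exprS -mulrA.
  have := state_growth sb sbeta beta0 bv betav lapbeta d2 oOm (s0 j) (BOm j) hom1 hom1Om
    p1 q1 qp C0 morrey oxi (s1 j) soly.
  exact.
set a := fine (mu [set xi]) * beta 0 in growth.
have a0 : 0 < a by exact: mulr_gt0.
have growths j n : G j + a * n%:R <= G (j + n)%N.
  elim: n => [|n IH]; first by rewrite mulr0 addr0 addn0.
  by rewrite addnS; apply: le_trans (growth _); rewrite -natr1 mulrDr mulr1 addrA lerD2r.
(* The condition on [G j] starts the sign argument: by monotone growth the integrals of [y - yd]
   against all finer dilates are nonnegative, as [point_source_lower] requires. The two estimates
   then share the factor [s^-2], which cancels. *)
have bound j : Y * Ib <= G j -> G j <= Y * Ib + alpha * (H * (2 * Ib)).
  move=> Yj; set s := 2 ^+ j * S.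
  have lower : s^-1 ^+ 2 * (G j - Y * Ib) <= \int[lebesgue_rV d1]_(x in Om)
      ((y \- yd) x * point_source_state b s xi x).
    apply: (point_source_lower sb bv d2 oOm (s0 j) (BOm j) Lf).
    - by rewrite -natrM ltr_nat; case: hd1 => ->.
    - by rewrite fE lerD2l lerN2.
    - move=> i; rewrite /s mulrA -exprD fE subr_ge0.
      apply: le_trans (ydb _) _; apply: le_trans Yj _; rewrite addnC.
      by apply: le_trans (growths j i); rewrite lerDl mulr_ge0// ltW.
  have upper : \int[lebesgue_rV d1]_(x in Om) ((y \- yd) x * point_source_state b s xi x) <=
      alpha * (H * (2 * s^-1 ^+ 2 * Ib)).
    apply: (optimality_inequality seta sb eta0 etav bv lapb M0 hd1 oOm Omoo hom0 hom1 hom1Om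
      hu0 hc halpha solq sol2 p1 q1 q2 p2 qp dq hyd C0 morrey (s0 j) (Bom j) (BOm j) hopt ubarE mu0).
    move=> x ox; have := HH x xi s ox (s0 j) (Bom j).
    by rewrite -lerBlDl => /(le_trans (ler_norm _)).
  have := le_trans lower upper.
  have -> : alpha * (H * (2 * s^-1 ^+ 2 * Ib)) = s^-1 ^+ 2 * (alpha * (H * (2 * Ib))).
    by move: (s^-1) => z; ring.
  have sV : 0 < s^-1 ^+ 2 by rewrite exprn_gt0// invr_gt0; exact: s0.
  by rewrite (ler_pM2l sV) lerBlDl.
have K0 : 0 <= alpha * (H * (2 * Ib)) by rewrite !mulr_ge0// ltW.
(* Each doubling adds at least [a], so [G] exceeds any bound after finitely many scales, in
   particular the one in [bound]. *)
have [n nP] := geometric_unbounded (Y * Ib + alpha * (H * (2 * Ib)) - G 0) a0.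
have Gn : Y * Ib + alpha * (H * (2 * Ib)) < G n.
  by apply: (lt_le_trans _ (growths 0%N n)); rewrite -ltrBlDl.
suff /bound : Y * Ib <= G n by rewrite leNgt Gn.
by apply: le_trans (ltW Gn); rewrite lerDl.
Qed.
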